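(* Let $\theta_1\in\left(\frac{\beta C_A}{1+\beta C_A},1\right)$, $\theta_2\in(0,1)$, and let $v\in W^1_p(\Omega)$ with $|v|_{W^1_p(\Omega)}\neq 0$ satisfy $$|v|_{W^1_p(\Omega)}\le (1-\theta_1)\left(\alpha C_EC_A(1+\beta C_A)\right)^{-1},\qquad |v|_{W^1_p(\Omega)}\le (1-\theta_2)\left(\alpha C_EC_A(1+\beta C_A)^2\right)^{-1}.$$ Then the control-to-state map $G_v:\mathcal U\to\mathbb W^1$ admits a second-order Fréchet derivative $G_v'':\mathcal U\to\mathcal L(L^2(I)\times L^2(I),\mathbb W^1)$. For all $\bar u\in\mathcal U$ and all $(h_1,h_2)\in L^2(I)\times L^2(I)$, writing $(\bar\gamma,\bar y)=G_v(\bar u)$ and $(\gamma_i,y_i):=G_v'(\bar u)h_i$ for $i=1,2$, the pair $(\gamma,y):=G_v''(\bar u)h_1h_2\in\mathbb W^1$ satisfies, for all $(\zeta,z)\in\mathring W^1_1(I)\times\mathring W^1_q(\Omega)$, $$\mathcal B_\Gamma[\gamma,\zeta]+\mathcal D_\Omega[(\gamma,y),z+E\zeta;\bar\gamma,\bar y]=F_\Omega(z+E\zeta;h_1,h_2),$$ where $F_\Omega(\cdot;h_1,h_2)\in W^1_q(\Omega)^*$ is given by $$F_\Omega(\cdot;h_1,h_2)=-\mathcal B_\Omega[y_1,\cdot;DA[\bar\gamma]\langle\gamma_2\rangle]-\mathcal B_\Omega[y_2,\cdot;DA[\bar\gamma]\langle\gamma_1\rangle]-\mathcal B_\Omega[\bar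 y+v,\cdot;D^2A[\bar\gamma]\langle\gamma_1,\gamma_2\rangle].$$ Moreover, $$|\gamma|_{W^1_\infty(I)}\le\frac{\alpha^3}{\theta_2^3}C_EC_A(1+2\beta C_A)(1+\beta C_A)^2|v|_{W^1_p(\Omega)}\|h_1\|_{L^2(I)}\|h_2\|_{L^2(I)},$$ $$|y|_{W^1_p(\Omega)}\le\frac{\alpha^2}{\theta_2^3}\beta C_A(1+2\beta C_A)(1+\beta C_A)|v|_{W^1_p(\Omega)}\|h_1\|_{L^2(I)}\|h_2\|_{L^2(I)}.$$
   Context: Notation: $I=(0,1)$, $\Omega=(0,1)^2$ with points $x=(x_1,x_2)$, $\Gamma=(0,1)\times\{1\}$ (identified with $I$, as are function spaces on them), $\Sigma=\partial\Omega\setminus\Gamma$. $W^1_r$ denotes the usual Sobolev space with integrability exponent $r$, $\mathring W^1_r$ its subspace of functions with zero boundary trace; $|y|_{W^1_r(\Omega)}:=\|\nabla y\|_{L^r(\Omega)}$ and $|\gamma|_{W^1_r(I)}:=\|\gamma'\|_{L^r(I)}$. $\kappa>0$ is a fixed constant. For $\gamma\in\mathring W^1_\infty(I)$ with $|\gamma'|\le1$ a.e. (the state constraint; then $|\gamma|\le 1/2$), $$A[\gamma](x)=\begin{pmatrix}1+\gamma(x_1) & -\gamma'(x_1)x_2\\ -\gamma'(x_1)x_2 & \frac{1+(\gamma'(x_1)x_2)^2}{1+\gamma(x_1)}\end{pmatrix},$$ and $DA[\gamma]\langle h\rangle$, $D^2A[\gamma]\langle h_1,h_2\rangle$ are its first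 and second directional derivatives with respect to $\gamma$ in directions $h,h_1,h_2\in\mathring W^1_\infty(I)$. Bilinear forms: $\mathcal B_\Gamma[\gamma,\zeta]=\kappa\int_0^1\gamma'\zeta'\,dx_1$, and $\mathcal B_\Omega[y,z;M]=\int_\Omega M\nabla y\cdot\nabla z\,dx$ for a bounded matrix field $M$. Also $$\mathcal D_\Omega[(\gamma,y),\cdot;\bar\gamma,\bar y]:=\mathcal B_\Omega[y,\cdot;A[\bar\gamma]]+\mathcal B_\Omega[\bar y+v,\cdot;DA[\bar\gamma]\langle\gamma\rangle].$$ Fixed constants: (1) $C_A<\infty$ such that for all $\gamma\in\mathring W^1_\infty(I)$ with $|\gamma'|\le1$ a.e., $\|A[\gamma]\|_{L^\infty}+\sup_{|h|_{W^1_\infty(I)}=1}\|DA[\gamma]\langle h\rangle\|_{L^\infty}+\sup_{|h_1|_{W^1_\infty(I)}=|h_2|_{W^1_\infty(I)}=1}\|D^2A[\gamma]\langle h_1,h_2\rangle\|_{L^\infty}\le C_A$ (norms in $L^\infty(\Omega)^{2\times2}$, pointwise Euclidean operator norm). (2) $\alpha>0$ such that $|\gamma|_{W^1_\infty(I)}\le\alpha\sup_{0\ne\zeta\in\mathring W^1_1(I)}\mathcal B_\Gamma[\gamma,\zeta]/|\zeta|_{W^1_1(I)}$ for $\gamma\in\mathring W^1_\infty(I)$ and $|s|_{W^1_1(I)}\le\alpha\sup_{0\ne\zeta\in\mathring W^1_\infty(I)}\mathcal B_\Gamma[\zeta,s]/|\zeta|_{W^1_\infty(I)}$ for $s\in\mathring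 W^1_1(I)$. (3) $Q<2<P$, Hölder conjugate, and $\beta>0$ such that for every $r\in(Q,P)$ with conjugate $r'$, every $\gamma\in\mathring W^1_\infty(I)$ with $|\gamma'|\le1$ a.e. and every $y\in\mathring W^1_r(\Omega)$: $|y|_{W^1_r(\Omega)}\le\beta\sup_{0\ne z\in\mathring W^1_{r'}(\Omega)}\mathcal B_\Omega[y,z;A[\gamma]]/|z|_{W^1_{r'}(\Omega)}$. (4) $2<p<P$ and $q=p/(p-1)$. (5) $E:\mathring W^1_1(I)\to W^1_q(\Omega)$ is a fixed bounded linear extension with $E\zeta|_\Gamma=\zeta$, $E\zeta|_\Sigma=0$, and $C_E\ge1$ satisfies $|E\zeta|_{W^1_q(\Omega)}\le C_E|\zeta|_{W^1_1(I)}$. $\mathbb W^1:=\mathring W^1_\infty(I)\times\mathring W^1_p(\Omega)$ with norm $\|(\gamma,y)\|_{\mathbb W^1}:=(1+\beta C_A)|v|_{W^1_p(\Omega)}|\gamma|_{W^1_\infty(I)}+|y|_{W^1_p(\Omega)}$. $\mathcal L(L^2(I)\times L^2(I),\mathbb W^1)$ denotes the bounded bilinear maps. Control-to-state map: $\mathcal U:=\{u\in L^2(I):\|u\|_{L^2(I)}<\theta_1/\alpha\}$; under the stated conditions on $v$, for $u\in\mathcal U$, $G_v(u)=(\gamma,y)$ is the unique element of $\mathbb W^1$ with $|\gamma'|\le1$ a.e. such that $\mathcal B_\Omega[y+v,z;A[\gamma]]=0$ for all $z\in\mathring W^1_q(\Omega)$ and $\mathcal B_\Gamma[\gamma,\zeta]+\mathcal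 B_\Omega[y+v,E\zeta;A[\gamma]]=\int_0^1u\zeta\,dx_1$ for all $\zeta\in\mathring W^1_1(I)$. $G_v':\mathcal U\to\mathcal L(L^2(I),\mathbb W^1)$ is its first Fréchet derivative: $(\gamma_h,y_h)=G_v'(\bar u)h$ is the solution in $\mathbb W^1$ of $\mathcal B_\Gamma[\gamma_h,\zeta]+\mathcal D_\Omega[(\gamma_h,y_h),z+E\zeta;\bar\gamma,\bar y]=\int_0^1h\zeta\,dx_1$ for all $(\zeta,z)\in\mathring W^1_1(I)\times\mathring W^1_q(\Omega)$. *)

(* Defs.v *)
From HB Require Import structures.
From mathcomp Require Import all_boot all_order all_algebra.
From mathcomp Require Import all_classical all_reals all_analysis.

Set Implicit Arguments.
Unset Strict Implicit.
Unset Printing Implicit Defensive.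

Import Order.TTheory GRing.Theory Num.Theory.
Import numFieldNormedType.Exports.

Local Open Scope classical_set_scope.
Local Open Scope ring_scope.

(* A Sobolev function is represented by a function together with (versions of)
   its weak first-order partial derivatives, and equality of Sobolev functions
   is equality almost everywhere.  On I = (0,1) the representation is
   (zeta, zeta'), on Omega = (0,1)^2 it is (y, (d_1 y, d_2 y)).  Sums and scalar
   multiples are those of the product of function spaces. *)
Notation jetI R := ((R -> R) * (R -> R))%type.
Notation jetO R := ((R * R -> R) * ((R * R -> R) * (R * R -> R)))%type.
Notation jetW R := (jetI R * jetO R)%type.

Section Domains.
Context {R : realType}.

Definition itvI : set R := [set` `]0, 1[].
Definition Omega : set (R * R) := itvI `*` itvI.

Lemma lebesgue_itvI_fin : (@lebesgue_measure R `]0%R, 1%R[ < +oo)%E.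
Proof.
by rewrite lebesgue_measure_itv/=; case: ifP => _; rewrite ?ltry// sube0 ltry.
Qed.

Definition muI : {finite_measure set (measurableTypeR R) -> \bar R} :=
  @mfrestr _ (measurableTypeR R) _ _ _ (measurable_itv `]0, 1[)
    lebesgue_itvI_fin.

Definition muO :
    {measure set (measurableTypeR R * measurableTypeR R)%type -> \bar R} :=
  product_measure1 (muI : {measure set (measurableTypeR R) -> \bar R})
    (muI : {sigma_finite_measure set (measurableTypeR R) -> \bar R}).

End Domains.

Section Calculus.
Context {R : realType} {V : normedModType R}.

(* C^oo on a finite-dimensional V: every iterated directional derivative is
   differentiable. *)
Definition Cinfty (f : V -> R) : Prop :=
  forall (s : seq V) (x : V),
    differentiable (foldr (fun w g => 'D_w g) f s) x.

Definition C1 (f : V -> R) : Prop :=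
  (forall x, differentiable f x) /\ (forall w, continuous ('D_w f)).

Definition test_fun (D : set V) (f : V -> R) : Prop :=
  Cinfty f /\
  exists K, [/\ compact K, K `<=` D & forall x, ~ K x -> f x = 0].

End Calculus.

Section Euclid.
Context {R : realType}.

Definition dotv (a b : 'cV[R]_2) : R := \sum_i a i 0 * b i 0.
Definition enorm (a : 'cV[R]_2) : R := Num.sqrt (dotv a a).

Definition opnorm (M : 'M[R]_2) : R :=
  sup [set enorm (M *m a) | a in [set a | enorm a = 1]].

Definition mx22 (a b c d : R) : 'M[R]_2 :=
  \matrix_(i, j) (if i == 0 then (if j == 0 then a else b)
                  else (if j == 0 then c else d)).

End Euclid.

Section Sobolev.
Context {R : realType}.
Local Notation muI := (@muI R).
Local Notation muO := (@muO R).

Definition grad (y : jetO R) (x : R * R) : 'cV[R]_2 :=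
  \col_i (if i == 0 then y.2.1 x else y.2.2 x).

Definition eqI (u w : jetI R) : Prop := u.1 = w.1 %[ae muI].
Definition eqO (y z : jetO R) : Prop := y.1 = z.1 %[ae muO].
Definition eqW (a b : jetW R) : Prop := eqI a.1 b.1 /\ eqO a.2 b.2.

Definition L2norm (u : R -> R) : R := fine ('N[muI]_2%:E[EFin \o u])%E.

(* The seminorms |.|_{W^1_r}, to be used on members of W^1_r only (fine is 0
   on infinite norms). *)
Definition snormI (r : \bar R) (u : jetI R) : R :=
  fine ('N[muI]_r[EFin \o u.2])%E.
Definition snormO (r : \bar R) (y : jetO R) : R :=
  fine ('N[muO]_r[EFin \o (enorm \o grad y)])%E.

(* The full norms of W^1_r. *)
Definition normI (r : \bar R) (u : jetI R) : \bar R :=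
  ('N[muI]_r[EFin \o u.1] + 'N[muI]_r[EFin \o u.2])%E.
Definition normO (r : \bar R) (y : jetO R) : \bar R :=
  ('N[muO]_r[EFin \o y.1] + 'N[muO]_r[EFin \o (enorm \o grad y)])%E.

Definition W1I (r : \bar R) (u : jetI R) : Prop :=
  [/\ u.1 \in Lfun muI r, u.2 \in Lfun muI r &
      forall phi : R -> R, test_fun itvI phi ->
        \int[muI]_x (u.1 x * derive1 phi x) = - \int[muI]_x (u.2 x * phi x)].

Definition W1O (r : \bar R) (y : jetO R) : Prop :=
  [/\ y.1 \in Lfun muO r, y.2.1 \in Lfun muO r, y.2.2 \in Lfun muO r &
      forall phi : R * R -> R, test_fun Omega phi ->
        (\int[muO]_x (y.1 x * 'D_(1, 0) phi x)
          = - \int[muO]_x (y.2.1 x * phi x)) /\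
        (\int[muO]_x (y.1 x * 'D_(0, 1) phi x)
          = - \int[muO]_x (y.2.2 x * phi x))].

(* Traces: continuous extension to W^1_1 (which contains every W^1_r, r >= 1)
   of the restriction of functions that are C^1 up to the boundary. *)
Definition traceI (u : jetI R) (a b : R) : Prop :=
  exists phi : nat -> R -> R,
  [/\ forall n, C1 (phi n),
      normI 1%E ((phi n, derive1 (phi n)) - u) @[n --> \oo] --> 0%E,
      phi n 0 @[n --> \oo] --> a &
      phi n 1 @[n --> \oo] --> b].

(* The L^1-norm on the boundary of Omega, side by side; boundary data are
   given as functions on the plane, of which only the values there matter. *)
Definition bdnorm (g : R * R -> R) : \bar R :=
  (\int[muI]_t (`|g (t, 0)%R| + `|g (t, 1)%R|
               + `|g (0, t)%R| + `|g (1, t)%R|)%R%:E)%E.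

Definition traceO (y : jetO R) (g : R * R -> R) : Prop :=
  exists phi : nat -> R * R -> R,
  [/\ forall n, C1 (phi n),
      normO 1%E ((phi n, ('D_(1, 0) (phi n), 'D_(0, 1) (phi n))) - y)
        @[n --> \oo] --> 0%E &
      bdnorm (phi n - g) @[n --> \oo] --> 0%E].

Definition W10I (r : \bar R) (u : jetI R) : Prop :=
  W1I r u /\ traceI u 0 0.
Definition W10O (r : \bar R) (y : jetO R) : Prop :=
  W1O r y /\ traceO y (fun=> 0).

Definition state_constraint (g : jetI R) : Prop :=
  {ae muI, forall t, `|g.2 t| <= 1}.

End Sobolev.

Section Forms.
Context {R : realType}.
Local Notation muI := (@muI R).
Local Notation muO := (@muO R).

(* g = (gamma, gamma') *)
Definition Acoef (g : jetI R) (x : R * R) : 'M[R]_2 :=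
  mx22 (1 + g.1 x.1)         (- (g.2 x.1 * x.2))
       (- (g.2 x.1 * x.2))   ((1 + (g.2 x.1 * x.2) ^+ 2) / (1 + g.1 x.1)).

(* Pointwise in x, the derivatives at t = 0 of t |-> A[gamma + t h](x) and of
   t |-> DA[gamma + t h2]<h1>(x). *)
Definition DA (g h : jetI R) (x : R * R) : 'M[R]_2 :=
  \matrix_(i, j) derive1 (fun t : R => Acoef (g + t *: h) x i j) 0.

Definition D2A (g h1 h2 : jetI R) (x : R * R) : 'M[R]_2 :=
  \matrix_(i, j) derive1 (fun t : R => DA (g + t *: h2) h1 x i j) 0.

Definition Linfty (M : R * R -> 'M[R]_2) : \bar R :=
  ('N[muO]_+oo[EFin \o (opnorm \o M)])%E.

Definition BG (kappa : R) (g z : jetI R) : R :=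
  kappa * \int[muI]_t (g.2 t * z.2 t).

Definition BO (y z : jetO R) (M : R * R -> 'M[R]_2) : R :=
  \int[muO]_x dotv (M x *m grad y x) (grad z x).

Definition DO (v : jetO R) (a : jetW R) (z : jetO R) (abar : jetW R) : R :=
  BO a.2 z (Acoef abar.1) + BO (abar.2 + v) z (DA abar.1 a.1).

Definition FO (v : jetO R) (abar a1 a2 : jetW R) (z : jetO R) : R :=
  - BO a1.2 z (DA abar.1 a2.1) - BO a2.2 z (DA abar.1 a1.1)
  - BO (abar.2 + v) z (D2A abar.1 a1.1 a2.1).

End Forms.

Section Constants.
Context {R : realType}.
Local Open Scope ereal_scope.

Definition coef_bound (CA : R) : Prop :=
  forall g : jetI R, W10I +oo g -> state_constraint g ->
    let dirs := [set h : jetI R | W10I +oo h /\ snormI +oo h = 1%R] in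
    Linfty (Acoef g)
    + ereal_sup [set Linfty (DA g h) | h in dirs]
    + ereal_sup [set Linfty (D2A g h.1 h.2) | h in dirs `*` dirs] <= CA%:E.

Definition infsupG (kappa alpha : R) : Prop :=
  (forall g : jetI R, W10I +oo g ->
    (snormI +oo g)%:E <= alpha%:E *
      ereal_sup [set (BG kappa g z / snormI 1 z)%:E
                | z in [set z | W10I 1 z /\ ~ eqI z 0%R]]) /\
  (forall s : jetI R, W10I 1 s ->
    (snormI 1 s)%:E <= alpha%:E *
      ereal_sup [set (BG kappa z s / snormI +oo z)%:E
                | z in [set z | W10I +oo z /\ ~ eqI z 0%R]]).

Definition infsupO (Q P beta : R) : Prop :=
  forall r r' : R, (Q < r < P)%R -> (r^-1 + r'^-1 = 1)%R ->
  forall g : jetI R, W10I +oo g -> state_constraint g ->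
  forall y : jetO R, W10O r%:E y ->
    (snormO r%:E y)%:E <= beta%:E *
      ereal_sup [set (BO y z (Acoef g) / snormO r'%:E z)%:E
                | z in [set z | W10O r'%:E z /\ ~ eqO z 0%R]].

Definition bounded_extension (q CE : R) (E : jetI R -> jetO R) : Prop :=
  [/\ forall z, W10I 1 z -> W1O q%:E (E z),
      forall (a : R) z1 z2, W10I 1 z1 -> W10I 1 z2 ->
        eqO (E (a *: z1 + z2)%R) (a *: E z1 + E z2)%R,
      exists C : R, forall z, W10I 1 z ->
        normO q%:E (E z) <= (C * snormI 1 z)%:E,
      forall z, W10I 1 z ->
        traceO (E z) (fun x => if x.2 == 1%R then z.1 x.1 else 0%R) &
      forall z, W10I 1 z -> (snormO q%:E (E z) <= CE * snormI 1 z)%R].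

End Constants.

Section ControlToState.
Context {R : realType}.
Variables (kappa CA beta p : R) (E : jetI R -> jetO R) (v : jetO R).
Local Notation q := (p / (p - 1)).

Definition L2 (u : R -> R) : Prop := u \in Lfun (@muI R) 2%:E.

Definition WW (a : jetW R) : Prop := W10I +oo%E a.1 /\ W10O p%:E a.2.

Definition normW (a : jetW R) : R :=
  (1 + beta * CA) * snormO p%:E v * snormI +oo%E a.1 + snormO p%:E a.2.

Definition state_solution (u : R -> R) (a : jetW R) : Prop :=
  [/\ WW a, state_constraint a.1,
      forall z, W10O q%:E z -> BO (a.2 + v) z (Acoef a.1) = 0 &
      forall zeta, W10I 1%E zeta ->
        BG kappa a.1 zeta + BO (a.2 + v) (E zeta) (Acoef a.1)
          = \int[@muI R]_t (u t * zeta.1 t)].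

Definition control_to_state (U : set (R -> R)) (G : (R -> R) -> jetW R) : Prop :=
  forall u, U u ->
    state_solution u (G u) /\ forall a, state_solution u a -> eqW a (G u).

(* Solutions in WW of the problem linearized at the state abar, with
   right-hand side rhs. *)
Definition linearized_solution (abar : jetW R)
    (rhs : jetI R -> jetO R -> R) (a : jetW R) : Prop :=
  WW a /\
  forall zeta z, W10I 1%E zeta -> W10O q%:E z ->
    BG kappa a.1 zeta + DO v a (z + E zeta) abar = rhs zeta z.

Definition bounded_linear (T : (R -> R) -> jetW R) : Prop :=
  [/\ forall h, L2 h -> WW (T h),
      forall (a : R) h k, L2 h -> L2 k -> eqW (T (a *: h + k)) (a *: T h + T k) &
      exists C : R, forall h, L2 h -> normW (T h) <= C * L2norm h].

Definition bounded_bilinear (T : (R -> R) -> (R -> R) -> jetW R) : Prop :=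
  [/\ forall h1 h2, L2 h1 -> L2 h2 -> WW (T h1 h2),
      forall (a : R) h k h2, L2 h -> L2 k -> L2 h2 ->
        eqW (T (a *: h + k) h2) (a *: T h h2 + T k h2),
      forall (a : R) h1 h k, L2 h1 -> L2 h -> L2 k ->
        eqW (T h1 (a *: h + k)) (a *: T h1 h + T h1 k) &
      exists C : R, forall h1 h2, L2 h1 -> L2 h2 ->
        normW (T h1 h2) <= C * L2norm h1 * L2norm h2].

Definition frechet (U : set (R -> R)) (G : (R -> R) -> jetW R)
    (G' : (R -> R) -> (R -> R) -> jetW R) : Prop :=
  forall u, U u -> bounded_linear (G' u) /\
  forall e : R, 0 < e -> exists2 d : R, 0 < d &
    forall h, L2 h -> L2norm h < d -> U (u + h) ->
      normW (G (u + h) - G u - G' u h) <= e * L2norm h.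

(* Frechet derivative of G' : U -> L(L^2, WW), the target carrying the operator
   norm; L(L^2, L(L^2, WW)) is identified with the bounded bilinear maps. *)
Definition frechet2 (U : set (R -> R)) (G' : (R -> R) -> (R -> R) -> jetW R)
    (G'' : (R -> R) -> (R -> R) -> (R -> R) -> jetW R) : Prop :=
  forall u, U u -> bounded_bilinear (G'' u) /\
  forall e : R, 0 < e -> exists2 d : R, 0 < d &
    forall h, L2 h -> L2norm h < d -> U (u + h) ->
      forall k, L2 k ->
        normW (G' (u + h) k - G' u k - G'' u h k) <= e * L2norm h * L2norm k.

Definition W1q_dual (F : jetO R -> R) : Prop :=
  (forall (a : R) y z, W1O q%:E y -> W1O q%:E z ->
     F (a *: y + z) = a * F y + F z) /\
  exists C : R, forall z, W1O q%:E z -> (`|F z|%:E <= C%:E * normO q%:E z)%E.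

End ControlToState.

(* Main.v *)
(* No existence theory for the linearized problem is needed.  The inf-sup
   conditions and the smallness of v give an a priori estimate: a pair whose
   linearized residual is at most L |w| on test functions w = z + E zeta has
   norm at most a multiple of L.  The two problems solved by G'(u + h) k and
   G'(u) k differ by D_Omega at two different states; expanding A and DA to
   second order around the first state shows that this difference is
   F_Omega(w; h, k) up to o(|h|) |k| |w|.  Hence the difference quotients
   (G'(u + t h) k - G'(u) k) / t solve the linearized problem with right-hand
   side F_Omega up to an error tending to 0 with t, the a priori estimate makes
   them a Cauchy sequence along suitable t -> 0, and the limit is G''(u) h k.
   Linearity, the Frechet property and the bounds come from the same estimate.
   Completeness of the zero-trace spaces rests on the Poincare inequality for
   the approximating C^1 functions and on completeness of L^p. *)

Require Import Defs.
From HB Require Import structures.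
From mathcomp Require Import all_boot all_order all_algebra.
From mathcomp Require Import all_classical all_reals all_analysis.
From mathcomp Require Import measurable_realfun ess_sup_inf ring lra.

Set Implicit Arguments.
Unset Strict Implicit.
Unset Printing Implicit Defensive.

Import Order.TTheory GRing.Theory Num.Theory.
Import numFieldNormedType.Exports.

Local Open Scope classical_set_scope.
Local Open Scope ring_scope.

(** * Lebesgue spaces *)

(** The two linearized equations are coupled, and this shapes the a priori estimate. Testing with
    zeta = 0 bounds y by the residual plus a multiple of |v| |gamma|. Inserting this into the test
    with z = 0 leaves gamma on both sides, with the factor alpha C_E C_A (1 + beta C_A)^2 |v| on the
    right. The second condition on v makes this factor at most 1 - theta_2, so gamma is absorbed at
    the price of 1 / theta_2. The cube of theta_2 in the final bounds arises from G'(u) h_1, from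
    G'(u) h_2, and from the problem for G'' itself.

    A second difficulty is that [eqW] compares function values only, while the forms see gradients.
    Linearity of [G'] is therefore recovered in the gradient seminorms, from uniqueness for the
    linearized problem.

    Finally, C_A controls derivatives of A up to order two, whereas the remainder in the expansion
    of DA is of third order. The expansions hence carry explicit numerical constants, which enter
    only the o(|h|) terms and never the final bounds. *)

Section IntegralAe.
Context d {T : measurableType d} {R : realType}.
Variable mu : {measure set T -> \bar R}.
Import HBNNSimple.
Local Open Scope ereal_scope.

(* No measurability assumption: the lower integral does not see null sets. *)
Lemma ge0_le_integral_ae (f g : T -> \bar R) :
  (forall x, 0 <= f x) -> (forall x, 0 <= g x) ->
  {ae mu, forall x, f x <= g x} ->
  \int[mu]_x f x <= \int[mu]_x g x.
Proof.
move=> f0 g0 [N [mN muN fgN]].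
rewrite ge0_integralTE// ge0_integralTE//.
apply: ge_ereal_sup => _ [h /= hf <-].
have mNC : measurable (~` N) by exact: measurableC.
have hN x : proj_nnsfun h mNC x = (h \_ (~` N)) x by rewrite mrestrict.
apply: le_ereal_sup_tmp; exists (sintegral mu (proj_nnsfun h mNC)).
  exists (proj_nnsfun h mNC) => // x; rewrite hN patchE.
  case: ifPn => [|_]; last exact: g0.
  rewrite inE => xN; apply: (le_trans (hf x)).
  by apply: contrapT => nfg; apply: xN; exact: fgN.
rewrite -!integralT_nnsfun.
suff -> : \int[mu]_x (h x)%:E = \int[mu]_x (proj_nnsfun h mNC x)%:E by [].
apply: ae_eq_integral => //.
- exact/measurable_EFinP.
- exact/measurable_EFinP.
- exists N; split => // x nx; apply: contrapT => xN; apply: nx => _ .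
  by rewrite hN patchE mem_set.
Qed.

(** Needed for integrands containing [DA] or [D2A], which agree with measurable functions only off a
    null set. *)
Lemma ae_eq_integral_nomeas (f g : T -> \bar R) :
  {ae mu, forall x, f x = g x} -> \int[mu]_x f x = \int[mu]_x g x.
Proof.
move=> fg; rewrite integralE [RHS]integralE; congr (_ - _);
  apply/eqP; rewrite eq_le; apply/andP; split; apply: ge0_le_integral_ae => //;
  by apply: filterS fg => x fgx; rewrite unlock fgx.
Qed.

End IntegralAe.

Section LnormFacts.
Context d {T : measurableType d} {R : realType}.
Variable mu : {measure set T -> \bar R}.
Implicit Types (f g : T -> R) (p : \bar R).
Local Open Scope ereal_scope.

Lemma Lfun_measurable f p : f \in Lfun mu p -> measurable_fun setT f.
Proof. by rewrite inE => /andP[+ _]; rewrite inE. Qed.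

Lemma Lfun_lty f p : f \in Lfun mu p -> 'N[mu]_p[EFin \o f] < +oo.
Proof. by rewrite inE => /andP[_ +]; rewrite inE. Qed.

Lemma LfunI f p : measurable_fun setT f -> 'N[mu]_p[EFin \o f] < +oo ->
  f \in Lfun mu p.
Proof. by move=> mf Nf; rewrite inE; apply/andP; split; rewrite inE. Qed.

Lemma Lfun_fin_num f p : f \in Lfun mu p -> 'N[mu]_p[EFin \o f] \is a fin_num.
Proof. by move=> /Lfun_lty; rewrite ge0_fin_numE ?Lnorm_ge0. Qed.

Lemma Lfun_lincomb (a : R) f g p : 1 <= p -> f \in Lfun mu p ->
  g \in Lfun mu p -> (a *: f + g)%R \in Lfun mu p.
Proof. by move=> p1 Lf Lg; apply: (Lfun_submod_closed mu p1).2. Qed.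

Lemma Lnorm_scale (a : R) f p : 1 <= p -> f \in Lfun mu p ->
  'N[mu]_p[EFin \o (a *: f)%R] = `|a|%:E * 'N[mu]_p[EFin \o f].
Proof.
by move=> p1 Lf; rewrite -(LnormZ (Lfun_Sub p1 Lf) a).
Qed.

Lemma le_Lnorm_ae f g p : 1 <= p ->
  measurable_fun setT f -> measurable_fun setT g ->
  {ae mu, forall x, `|f x| <= `|g x|}%R ->
  'N[mu]_p[EFin \o f] <= 'N[mu]_p[EFin \o g].
Proof.
case: p => [r||//]; rewrite ?lee_fin => r1 mf mg fg.
  have r0 : (0 < r)%R by exact: lt_le_trans r1.
  rewrite unlock /=; apply: gt0_ler_poweR.
  - by rewrite invr_ge0 ltW.
  - by rewrite in_itv/= leey integral_ge0// => x _; rewrite lee_fin powR_ge0.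
  - by rewrite in_itv/= leey integral_ge0// => x _; rewrite lee_fin powR_ge0.
  apply: ge0_le_integral_ae => [x|x|]; rewrite ?lee_fin ?powR_ge0//.
  by apply: filterS fg => x fg; rewrite lee_fin ge0_ler_powR// ltW.
rewrite unlock; case: ifP => // _.
apply: le_ess_sup; apply: filterS fg => x /= fg.
by rewrite lee_fin.
Qed.

Lemma Lfun_dominated f g p : 1 <= p -> measurable_fun setT f ->
  g \in Lfun mu p -> {ae mu, forall x, `|f x| <= `|g x|}%R ->
  f \in Lfun mu p.
Proof.
move=> p1 mf Lg fg; apply: LfunI => //.
by apply: le_lt_trans (le_Lnorm_ae p1 mf (Lfun_measurable Lg) fg) (Lfun_lty Lg).
Qed.

Lemma hoelder_Lfun f g (p q : R) : (1 < p)%R -> (1 < q)%R ->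
  (p^-1 + q^-1 = 1)%R -> f \in Lfun mu p%:E -> g \in Lfun mu q%:E ->
  (f \* g)%R \in Lfun mu 1 /\
  (\int[mu]_x `|f x * g x| <=
   fine ('N[mu]_p%:E[EFin \o f]) * fine ('N[mu]_q%:E[EFin \o g]))%R.
Proof.
move=> p1 q1 pq Lf Lg.
have mf := Lfun_measurable Lf; have mg := Lfun_measurable Lg.
have h := hoelder mu mf mg (lt_trans ltr01 p1) (lt_trans ltr01 q1) pq.
have L1 : (f \* g)%R \in Lfun mu 1.
  apply: LfunI; first exact: measurable_funM.
  by apply: (le_lt_trans h); rewrite ltey_eq fin_numM// Lfun_fin_num.
split=> //.
rewrite -lee_fin EFinM !fineK ?Lfun_fin_num//.
  by apply: le_trans h; rewrite Lnorm1.
by have := Lfun_fin_num L1; rewrite Lnorm1.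
Qed.

Lemma Lfun1_int f : f \in Lfun mu 1 -> mu.-integrable setT (EFin \o f).
Proof. by move/Lfun1_integrable. Qed.

Lemma Lfun1_norm f : f \in Lfun mu 1 ->
  (\int[mu]_x `|f x|)%R = fine ('N[mu]_1[EFin \o f]).
Proof. by move=> L1; rewrite Lnorm1. Qed.

(** Hölder's inequality against the constant 1, whose norm is 1 on a probability space. The
    exponents 1 and [+oo] are treated apart. *)
Lemma le_Lnorm1_Lnorm f p : mu setT = 1 -> 1 <= p ->
  measurable_fun setT f -> 'N[mu]_1[EFin \o f] <= 'N[mu]_p[EFin \o f].
Proof.
move=> mu1 p1 mf.
have mabs : measurable_fun setT (fun x => `|f x|%:E).
  exact/measurable_EFinP/measurableT_comp.
case: p => [r||//] in p1 *.
  move: p1; rewrite lee_fin le_eqVlt => /predU1P[<-//|r1].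
  pose r' := (1 - r^-1)^-1%R.
  have rV1 : (r^-1 < 1)%R by rewrite invf_lt1 ?(lt_trans ltr01).
  have r'0 : (0 < r')%R by rewrite invr_gt0 subr_gt0.
  have rr' : (r^-1 + r'^-1 = 1)%R by rewrite /r' invrK subrKC.
  have := @hoelder _ _ _ mu f (cst 1)%R r r' mf (measurable_cst _)
    (lt_trans ltr01 r1) r'0 rr'.
  rewrite Lnorm_cst1 mu1 poweR1r mule1.
  by under [in leLHS]eq_Lnorm do rewrite /= mulr1.
rewrite Lnorm1 unlock mu1 lte01.
have fe := ess_sup_ge mu (abse \o (EFin \o f)).
set M := ess_sup _ _ in fe *.
have [Moo|Moo] := eqVneq M +oo; first by rewrite Moo leey.
have M0 : 0 <= M by rewrite ess_sup_gee ?mu1 ?lte01//; apply: nearW => x /=.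
have Mf : M \is a fin_num by rewrite ge0_fin_numE// ltey.
rewrite [leRHS](_ : _ = \int[mu]_x cst M x); last first.
  by rewrite integral_cst// mu1 mule1.
by apply: ge0_le_integral_ae => // x; rewrite lee_fin.
Qed.

Lemma Lfun1_le_Lnorm f p : mu setT = 1 -> 1 <= p -> f \in Lfun mu p ->
  f \in Lfun mu 1 /\ 'N[mu]_1[EFin \o f] <= 'N[mu]_p[EFin \o f].
Proof.
move=> mu1 p1 Lf; split; last exact: le_Lnorm1_Lnorm (Lfun_measurable Lf).
by apply: (Lfun_subset (lexx 1) p1) Lf => //; rewrite mu1.
Qed.

(* Approximate inequalities pass to the limit although the error terms only
   vanish in mean: their infimum has integral 0. *)
Lemma ae_le_of_le_add_small (f h : T -> \bar R) :
  (forall x, 0 <= h x) ->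
  (forall e : R, (0 < e)%R -> exists g : T -> \bar R,
    [/\ measurable_fun setT g, forall x, 0 <= g x, \int[mu]_x g x <= e%:E &
        {ae mu, forall x, f x <= h x + g x}]) ->
  {ae mu, forall x, f x <= h x}.
Proof.
move=> h0 H.
have /choice[g gP] : forall n : nat, exists g : T -> \bar R,
    [/\ measurable_fun setT g, forall x, 0 <= g x,
        \int[mu]_x g x <= (n.+1%:R^-1)%:E &
        {ae mu, forall x, f x <= h x + g x}].
  by move=> n; apply: H; rewrite invr_gt0.
pose G x := einfs (g ^~ x) 0%N.
have mG : measurable_fun setT G.
  by apply: measurable_fun_einfs => n; have [] := gP n.
have G0 x : 0 <= G x.
  by apply: le_ereal_inf_tmp => _ [n _ <-]; have [] := gP n.
have Gg n x : G x <= g n x by apply: ereal_inf_lbound; exists n.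
have iG : \int[mu]_x `|G x| = 0.
  apply/eqP; rewrite eq_le integral_ge0// andbT.
  apply/lee_addgt0Pr => e e0; rewrite add0e.
  have [n ne] : exists n : nat, (n.+1%:R^-1 < e :> R)%R.
    by have [n _ /(_ n (leqnn n))] := near_infty_natSinv_lt (PosNum e0); exists n.
  have [_ g0 gn _] := gP n.
  apply: le_trans (le_trans gn _); last by rewrite lee_fin ltW.
  apply: ge0_le_integral_ae => //; apply: nearW => x.
  by rewrite gee0_abs.
have aeG := (ae_eq_integral_abs mu measurableT mG).1 iG.
have aef : {ae mu, forall x n, f x <= h x + g n x}.
  by apply: ae_foralln => n; have [] := gP n.
apply: filterS2 aeG aef => x /(_ I)/= Gx fx.
have [hoo|hfin] := eqVneq (h x) +oo; first by rewrite hoo leey.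
have hf : h x \is a fin_num by rewrite ge0_fin_numE ?h0// ltey.
rewrite -(adde0 (h x)) -leeBlDl// -Gx.
by apply: le_ereal_inf_tmp => _ [n _ <-]; rewrite leeBlDl.
Qed.

End LnormFacts.

(** * Completeness of L^p along geometrically Cauchy sequences *)

Section LpComplete.
Context d {T : measurableType d} {R : realType}.
Variable mu : {measure set T -> \bar R}.
Hypothesis mu1 : mu setT = 1%E.

Lemma sum_half_le (C : R) (m n : nat) : 0 <= C ->
  \sum_(m <= k < n) C / 2 ^+ k <= 2 * C / 2 ^+ m.
Proof.
move=> C0; have [mn|nm] := leqP m n; last first.
  by rewrite big_geq ?(ltnW nm)// !mulr_ge0// invr_ge0 exprn_ge0.
(* The subtracted term is the tail of the geometric series; keeping it lets the induction on n - m
   close. *)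
suff : \sum_(m <= k < n) C / 2 ^+ k <= 2 * C / 2 ^+ m - 2 * C / 2 ^+ n.
  by move=> /le_trans; apply; rewrite lerBlDr lerDl !mulr_ge0// invr_ge0 exprn_ge0.
rewrite -(subnKC mn); elim: (n - m)%N => [|k ih].
  by rewrite addn0 big_geq// subrr.
rewrite addnS big_nat_recr ?leq_addr//=.
apply: (le_trans (lerD ih (lexx _))).
rewrite exprS invfM; set a := (2 ^+ (m + k))^-1; set b := (2 ^+ m)^-1.
lra.
Qed.

(** The sum of the increments |f (n+1) - f n| has integral at most 2 C, hence is finite almost
    everywhere, and there the telescoping series converges absolutely. *)
Lemma ae_cvg_of_fast_cauchy (f : (T -> R)^nat) (C : R) : 0 <= C ->
  (forall n, measurable_fun setT (f n)) ->
  (forall n, \int[mu]_x `|(f n.+1 x - f n x)%R%:E| <= (C / 2 ^+ n)%:E)%E ->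
  {ae mu, forall x, cvgn (f ^~ x)}.
Proof.
move=> C0 mf fC.
pose h n x : R := `|f n.+1 x - f n x|.
have mh n : measurable_fun setT (fun x => (h n x)%:E).
  by apply/measurable_EFinP; apply: measurableT_comp => //; exact: measurable_funB.
have h0 n x : (0 <= (h n x)%:E)%E by rewrite lee_fin normr_ge0.
pose H x := (\sum_(0 <= n <oo) (h n x)%:E)%E.
have mH : measurable_fun setT H.
  by apply: ge0_emeasurable_sum => // n x _ _.
have H0 x : (0 <= H x)%E by apply: nneseries_ge0 => n _ _.
have iH : mu.-integrable setT H.
  apply/integrableP; split=> //.
  under eq_integral do rewrite gee0_abs//.
  rewrite integral_nneseries//.
  apply: (@le_lt_trans _ _ (2 * C)%:E); last exact: ltry.
  apply: lime_le.
    by apply: is_cvg_nneseries => n _ _; apply: integral_ge0 => x _.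
  apply: nearW => n.
  apply: (@le_trans _ _ (\sum_(0 <= k < n) (C / 2 ^+ k)%:E)%E).
    by apply: lee_sum => k _; exact: fC.
  rewrite sumEFin lee_fin.
  by apply: le_trans (sum_half_le 0 n C0) _; rewrite expr0 invr1 mulr1.
apply: filterS (integrable_ae measurableT iH) => x /(_ I) Hx.
pose u n := f n.+1 x - f n x.
have cu : cvgn (series u).
  apply: normed_cvg; apply: nondecreasing_is_cvgn.
    by apply: nondecreasing_series => n _ _; exact: normr_ge0.
  exists (fine (H x)) => _ [n _ <-].
  rewrite -lee_fin fineK// /series/= -sumEFin.
  by apply: nneseries_lim_ge => k _.
have -> : f ^~ x = (fun n => f 0%N x + series u n).
  by apply/funext => n; rewrite /series/= telescope_sumr// addrC subrK.
by apply: is_cvgD => //; exact: is_cvg_cst.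
Qed.

(** The form of continuity that Fatou's lemma asks for. At a = 0 the left side is 0; elsewhere the
    power is exp (r ln x), which is continuous. *)
Lemma powR_le_limn_einf (u : R^nat) (a r : R) : 0 < r -> 0 <= a ->
  (forall n, 0 <= u n) -> u @ \oo --> a ->
  ((a `^ r)%:E <= limn_einf (fun n => (u n `^ r)%:E))%E.
Proof.
move=> r0 a0 u0 ua.
have [->|aN0] := eqVneq a 0.
  rewrite powR0 ?gt_eqF// limn_einf_lim; apply: lime_ge; first exact: is_cvg_einfs.
  apply: nearW => n; apply: le_ereal_inf_tmp => _ [m _ <-].
  by rewrite lee_fin powR_ge0.
suff cu : (fun n => (u n `^ r)%:E) @ \oo --> (a `^ r)%:E.
  by rewrite (cvg_limn_einf_sup cu).1.
apply: cvg_EFin; first by apply: nearW.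
have ap : 0 < a by rewrite lt_neqAle eq_sym aN0.
have cf : continuous_at a (fun x => expR (r * ln x)).
  apply: (@continuous_comp _ _ _ (fun x => r * ln x) expR); last exact: continuous_expR.
  by apply: continuousM; [exact: cst_continuous|exact: continuous_ln].
have h : (fun n => expR (r * ln (u n))) @ \oo --> expR (r * ln a).
  exact: (cvg_comp _ _ ua cf).
rewrite [X in _ --> X](_ : _ = expR (r * ln a)); last by rewrite /powR gt_eqF.
apply: cvg_trans h; apply: near_eq_cvg.
near=> n; rewrite /= /powR gt_eqF//.
near: n; exact: (cvgr_gt _ ua).
Unshelve. all: by end_near. Qed.

Lemma Lnorm_leP (h : T -> R) (r K : R) : 0 < r -> 0 <= K ->
  ('N[mu]_r%:E[EFin \o h] <= K%:E)%E <->
  (\int[mu]_x (`|h x| `^ r)%:E <= (K `^ r)%:E)%E.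
Proof.
move=> r0 K0.
have rN0 : r != 0 by rewrite gt_eqF.
have inK : K%:E \in `[0%E, +oo%E] by rewrite in_itv/= leey lee_fin K0.
have NE : (\int[mu]_x (`|h x| `^ r)%:E = 'N[mu]_r%:E[EFin \o h] `^ r)%E.
  by rewrite poweR_Lnorm.
split=> h1.
  rewrite NE; apply: (@gt0_ler_poweR _ r (ltW r0) _ K%:E) => //.
  by rewrite in_itv/= leey Lnorm_ge0.
have rV0 : 0 <= r^-1 by rewrite invr_ge0 ltW.
have := @gt0_ler_poweR _ r^-1 rV0 _ (K `^ r)%:E _ _ h1.
rewrite NE -poweRrM mulfV// poweRe1 ?Lnorm_ge0// poweR_EFin -powRrM mulfV//.
rewrite powRr1//; apply.
  by rewrite in_itv/= leey poweR_ge0.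
by rewrite in_itv/= leey lee_fin powR_ge0.
Qed.

(** Norm bounds survive almost everywhere limits: by Fatou for finite p, pointwise for [+oo]. The
    shift by [N] turns a bound on a tail into a bound for all indices. *)
Lemma le_Lnorm_lim (f : (T -> R)^nat) (g g' : T -> R) p (K : R) (N : nat) :
  (1 <= p)%E -> 0 <= K ->
  (forall n, measurable_fun setT (f n)) -> measurable_fun setT g ->
  measurable_fun setT g' ->
  {ae mu, forall x, f ^~ x @ \oo --> g x} ->
  (forall n, (N <= n)%N -> 'N[mu]_p[EFin \o (f n - g')%R] <= K%:E)%E ->
  ('N[mu]_p[EFin \o (g - g')%R] <= K%:E)%E.
Proof.
have fgN x : f ^~ x @ \oo --> g x ->
    (fun n => `|f (n + N)%N x - g' x|) @ \oo --> `|g x - g' x|.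
  move=> fx; apply: cvg_norm; apply: cvgB; last exact: cvg_cst.
  by rewrite (cvg_shiftn _ (f ^~ x)).
case: p => [r||//]; rewrite ?lee_fin => r1 K0 mf mg mg' fg fK.
  have r0 : 0 < r by exact: lt_le_trans r1.
  pose F n x := (`|f (n + N)%N x - g' x| `^ r)%:E.
  have mF n : measurable_fun setT (F n).
    apply/measurable_EFinP.
    apply: (@measurableT_comp _ _ _ _ _ _ (@powR R ^~ r)) => //.
    by apply: measurableT_comp => //; exact: measurable_funB.
  have F0 n x : (0 <= F n x)%E by rewrite lee_fin powR_ge0.
  have intF n : (\int[mu]_x F n x <= (K `^ r)%:E)%E.
    by apply/(Lnorm_leP _ r0 K0); exact: fK (leq_addl n N).
  apply/(Lnorm_leP _ r0 K0).
    apply: (@le_trans _ _ (\int[mu]_x limn_einf (F ^~ x))%E).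
      apply: ge0_le_integral_ae => [x|x|].
      - by rewrite lee_fin powR_ge0.
      - rewrite limn_einf_lim; apply: lime_ge; first exact: is_cvg_einfs.
        by apply: nearW => n; apply: le_ereal_inf_tmp => _ [m _ <-].
      by apply: filterS fg => x /fgN; exact: powR_le_limn_einf.
    apply: (le_trans (fatou mu measurableT mF _)) => //.
    rewrite limn_einf_lim; apply: lime_le; first exact: is_cvg_einfs.
    apply: nearW => n; apply: ge_ereal_inf.
    by exists (\int[mu]_x F n x)%E => //; exists n => /=.
rewrite unlock mu1 lte01 in fK *.
apply/ess_supP.
have : {ae mu, forall x n, (`|f (n + N)%N x - g' x| <= K)}.
  apply/ae_foralln => n.
  by have /ess_supP := fK _ (leq_addl n N); apply: filterS => x /=; rewrite lee_fin.
apply: filterS2 fg => x /fgN fx fxK; rewrite /= lee_fin.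
by apply: (cvgr_to_le fx); apply: nearW => n; exact: fxK.
Qed.

Lemma Lp_fast_cauchy_cvg (f : (T -> R)^nat) p (C : R) : (1 <= p)%E -> 0 <= C ->
  (forall n, f n \in Lfun mu p) ->
  (forall n, 'N[mu]_p[EFin \o (f n.+1 - f n)%R] <= (C / 2 ^+ n)%:E)%E ->
  exists g, [/\ g \in Lfun mu p,
    forall n, ('N[mu]_p[EFin \o (g - f n)%R] <= (2 * C / 2 ^+ n)%:E)%E &
    {ae mu, forall x, f ^~ x @ \oo --> g x}].
Proof.
move=> p1 C0 Lf fC.
have mf n : measurable_fun setT (f n) by exact: Lfun_measurable (Lf n).
have Lsub m n : (f m - f n)%R \in Lfun mu p.
  by rewrite addrC -scaleN1r; exact: Lfun_lincomb.
have cf : {ae mu, forall x, cvgn (f ^~ x)}.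
  apply: (ae_cvg_of_fast_cauchy C0) => // n.
  have [_] := Lfun1_le_Lnorm mu1 p1 (Lsub n.+1 n).
  by rewrite Lnorm1 => /le_trans; apply; exact: fC.
(* The upper limit is defined and measurable everywhere, while the pointwise limit exists only
   almost everywhere. *)
pose g x := fine (limn_esup (fun n => (f n x)%:E)).
have mg : measurable_fun setT g.
  apply: (@measurableT_comp _ _ _ _ _ _ (@fine R)) => //.
  by apply: measurable_fun_limn_esup => n; exact/measurable_EFinP.
have fg : {ae mu, forall x, f ^~ x @ \oo --> g x}.
  apply: filterS cf => x cfx.
  have cE : (fun n => (f n x)%:E) @ \oo --> (limn (f ^~ x))%:E.
    by apply: cvg_EFin => //; exact: nearW.
  by rewrite /g (cvg_limn_einf_sup cE).2.
have gf n : ('N[mu]_p[EFin \o (g - f n)%R] <= (2 * C / 2 ^+ n)%:E)%E.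
  apply: (@le_Lnorm_lim f _ _ _ _ n) => //.
    by rewrite !mulr_ge0// invr_ge0 exprn_ge0.
  move=> m nm.
  apply: (@le_trans _ _ (\sum_(n <= k < m) C / 2 ^+ k)%:E); last first.
    by rewrite lee_fin; exact: sum_half_le.
  rewrite -(subnKC nm); elim: (m - n)%N => [|k ih].
    rewrite addn0 subrr big_geq// (_ : EFin \o 0 = cst 0%E)//.
    by rewrite Lnorm0// gt_eqF// (lt_le_trans _ p1).
  rewrite addnS big_nat_recr ?leq_addr//= addrC EFinD.
  rewrite (_ : f (n + k).+1 - f n =
    (f (n + k).+1 - f (n + k)%N) \+ (f (n + k)%N - f n)); last first.
    by apply/funext => x /=; rewrite addrA subrK.
  apply: le_trans (eminkowski mu _ _ p1) _.
  - exact: Lfun_measurable (Lsub _ _).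
  - exact: Lfun_measurable (Lsub _ _).
  by apply: leeD.
exists g; split=> //.
have Lgf : (g - f 0%N)%R \in Lfun mu p.
  apply: LfunI; first exact: measurable_funB.
  by apply: le_lt_trans (gf 0%N) _; exact: ltry.
have -> : g = (1 *: (g - f 0%N) + f 0%N)%R by rewrite scale1r subrK.
exact: Lfun_lincomb.
Qed.

End LpComplete.

Lemma ae_muI_filter (R : realType) : Filter (nbhs (almost_everywhere (@muI R))).
Proof.
exact: (ae_filter_ringOfSetsType
  (muI : {measure set (measurableTypeR R) -> \bar R})).
Qed.
#[global] Hint Extern 0 (Filter (nbhs (almost_everywhere _))) =>
  (exact: ae_muI_filter) : typeclass_instances.

(** * The domains I and Omega as probability spaces *)

Section Domain.
Context {R : realType}.
Local Notation muI := (@muI R).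
Local Notation muO := (@muO R).

Lemma itvIE (t : R) : itvI t = (0 < t < 1) :> Prop.
Proof. by rewrite /itvI/= in_itv. Qed.

Lemma measurable_itvI : measurable (itvI : set (measurableTypeR R)).
Proof. exact: measurable_itv. Qed.

Lemma muIE (A : set (measurableTypeR R)) : muI A = lebesgue_measure (A `&` itvI).
Proof. by []. Qed.

Lemma muI_setT : muI setT = 1%E.
Proof.
by rewrite muIE setTI /itvI lebesgue_measure_itv/= lte_fin ltr01 sube0.
Qed.

Lemma muOE (A B : set (measurableTypeR R)) : measurable A -> measurable B ->
  muO (A `*` B) = (muI A * muI B)%E.
Proof. by move=> mA mB; exact: product_measure1E. Qed.

Lemma muO_setT : muO setT = 1%E.
Proof. by rewrite -setXTT muOE// muI_setT mule1. Qed.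

Lemma ae_itvI : {ae muI, forall t : R, 0 < t < 1}.
Proof.
exists (~` itvI); split.
- by apply: measurableC; exact: measurable_itvI.
- by rewrite muIE setICl measure0.
- by move=> t /= h; rewrite itvIE.
Qed.

Lemma ae_muO_fst (P : R -> Prop) : {ae muI, forall t, P t} ->
  {ae muO, forall x, P x.1}.
Proof.
move=> [N [mN N0 PN]]; exists (N `*` setT); split.
- exact: measurableX.
- by rewrite muOE// N0 mul0e.
- by move=> x nP; split=> //; exact: PN.
Qed.

Lemma ae_muO_snd (P : R -> Prop) : {ae muI, forall t, P t} ->
  {ae muO, forall x, P x.2}.
Proof.
move=> [N [mN N0 PN]]; exists (setT `*` N); split.
- exact: measurableX.
- by rewrite muOE// N0 mule0.
- by move=> x nP; split=> //; exact: PN.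
Qed.

Lemma integral_muI (f : R -> \bar R) :
  (\int[muI]_x f x = \int[lebesgue_measure]_(x in `]0%R, 1%R[) f x)%E.
Proof.
transitivity (\int[muI]_(x in itvI) f x)%E.
  rewrite [RHS]integral_mkcond; apply: ae_eq_integral_nomeas.
  by apply: filterS ae_itvI => x x01; rewrite patchE mem_set// itvIE.
apply: eq_measure_integral => A mA AI.
by rewrite -[LHS]/(lebesgue_measure (A `&` itvI)) setIidl.
Qed.

Lemma continuous_section2 (f : R * R -> R) (a : R) : continuous f ->
  continuous (fun s : R => f (a, s)).
Proof.
move=> cf s; apply: (cvg_comp _ f _ (cf (a, s))).
by apply: (@cvg_pair _ _ _ _ (nbhs a) (nbhs s)); [exact: cvg_cst|exact: cvg_id].
Qed.

Lemma continuous_section1 (f : R * R -> R) (b : R) : continuous f ->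
  continuous (fun s : R => f (s, b)).
Proof.
move=> cf s; apply: (cvg_comp _ f _ (cf (s, b))).
by apply: (@cvg_pair _ _ _ _ (nbhs s) (nbhs b)); [exact: cvg_id|exact: cvg_cst].
Qed.

(* Sampling the first coordinate on the grid of mesh 1/(n+1) reduces joint
   measurability to that of the sections. *)
Lemma continuous_measurable_prod (f : R * R -> R) : continuous f ->
  measurable_fun setT (f : measurableTypeR R * measurableTypeR R -> R).
Proof.
move=> cf.
pose gr (n : nat) (t : R) : int := Num.floor (t * n.+1%:R).
pose g (n : nat) (x : R * R) : R := f ((gr n x.1)%:~R / n.+1%:R, x.2).
have mgr n (k : int) : measurable (gr n @^-1` [set k] : set (measurableTypeR R)).
  have -> : gr n @^-1` [set k] =
      [set` `[k%:~R / n.+1%:R, (k + 1)%:~R / n.+1%:R[].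
    apply/seteqP; split=> t /=; rewrite in_itv/= /gr.
      move=> <-; rewrite ler_pdivrMr// ltr_pdivlMr//.
      by rewrite ge_floor floorD1_gt.
    rewrite ler_pdivrMr// ltr_pdivlMr// => /andP[h1 h2].
    by apply/eqP; rewrite floor_eq; rewrite h1 h2.
  exact: measurable_itv.
have mg n : measurable_fun setT
    (g n : measurableTypeR R * measurableTypeR R -> measurableTypeR R).
  move=> _ A mA; rewrite setTI.
  have -> : g n @^-1` A = \bigcup_(k in [set: int])
      ((gr n @^-1` [set k]) `*` ((fun s => f (k%:~R / n.+1%:R, s)) @^-1` A)).
    apply/seteqP; split=> x /=.
      by move=> Ax; exists (gr n x.1).
    by move=> [k _ [/= <-]].
  apply: countable_bigcupT_measurable => [|k]; first exact: countableP.
  apply: measurableX; first exact: mgr.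
  rewrite -[X in measurable X]setTI.
  suff : measurable_fun setT (fun s => f (k%:~R / n.+1%:R, s)) by exact.
  by apply: continuous_measurable_fun; exact: continuous_section2.
apply: (measurable_fun_cvg (fun n => mg n)) => // -[s t] _.
apply: (cvg_comp _ f _ (cf (s, t))).
apply: (@cvg_pair _ _ _ _ (nbhs s) (nbhs t)); last exact: cvg_cst.
apply/cvgrPdist_lt => e e0; near=> n.
have n0 : 0 < n.+1%:R :> R by [].
have := ge_floor (s * n.+1%:R); have := floorD1_gt (s * n.+1%:R).
rewrite -/(gr n s) intrD addrC => h1 h2.
have h3 : (gr n s)%:~R / n.+1%:R <= s by rewrite ler_pdivrMr.
rewrite ger0_norm ?subr_ge0//.
apply: (@lt_trans _ _ (n.+1%:R^-1)); last by near: n; exact: (near_infty_natSinv_lt (PosNum e0)).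
rewrite ltrBlDr -ltrBlDl -(ltr_pM2r n0) mulrBl mulfVK ?gt_eqF// mulVf ?gt_eqF//.
by rewrite ltrBlDr addrC; exact: h1.
Unshelve. all: by end_near. Qed.

End Domain.

(** * Pointwise bounds for C^1 functions *)

Section FTC.
Context {R : realType}.
Local Notation muI := (@muI R).
Local Notation lam := (@lebesgue_measure R).

Lemma FTC2_abs (f f' : R -> R) (a b : R) : a < b -> continuous f' ->
  (forall t, derivable f t 1) -> (forall t, derive1 f t = f' t) ->
  (`|f b - f a|%:E <= \int[lam]_(t in `[a, b]) `|f' t|%:E)%E.
Proof.
move=> ab cf' df ff'.
have cw : {within `[a, b], continuous f'} by exact: continuous_subspaceT.
have h : (\int[lam]_(t in `[a, b]) (f' t)%:E = (f b)%:E - (f a)%:E)%E.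
  apply: continuous_FTC2 => //.
  have cf : continuous f.
    by move=> t; apply: differentiable_continuous; apply/derivable1_diffP.
  split=> [t _|//|//]; first exact: df.
  - exact/cvg_at_right_filter/cf.
  - exact/cvg_at_left_filter/cf.
rewrite -abse_EFin EFinB -h.
apply: le_trans (le_abse_integral _ _ _) _ => //.
by apply/measurable_EFinP/measurable_funTS; exact: continuous_measurable_fun.
Qed.

(** Integrate from each endpoint to x and add: the two intervals tile (0,1), so the integral of |f'|
    is paid once for 2 |f x|. This factor 2 later yields |gamma| <= 1/2, hence 1 + gamma >= 1/2,
    under the state constraint. *)
Lemma C1_two_point_bound (f f' : R -> R) (x : R) : 0 < x < 1 -> continuous f' ->
  (forall t, derivable f t 1) -> (forall t, derive1 f t = f' t) ->
  ((2 * `|f x|)%:E <= (`|f 0| + `|f 1|)%:E + \int[muI]_t `|f' t|%:E)%E.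
Proof.
move=> /andP[x0 x1] cf' df ff'.
have mf' (D : set R) : measurable_fun D (fun t => `|f' t|%:E).
  apply/measurable_EFinP/measurable_funTS/measurableT_comp => //.
  exact: continuous_measurable_fun.
have h1 := FTC2_abs x0 cf' df ff'.
have h2 := FTC2_abs x1 cf' df ff'.
rewrite integral_muI integral_itv_bndo_bndc// integral_itv_obnd_cbnd//.
have -> : [set` `[0, 1]] = [set` `[0, x]] `|` [set` `]x, 1]] :> set R.
  by rewrite -itv_bndbnd_setU// bnd_simp ltW.
rewrite ge0_integral_setU//=; last 2 first.
- exact: mf'.
- apply/disj_setPRL => t /=; rewrite !in_itv/= => /andP[h _].
  by apply/negP; rewrite negb_and -!ltNge h orbT.
rewrite integral_itv_obnd_cbnd//.
apply: (@le_trans _ _ ((`|f 0| + `|f 1|)%:E + (`|f x - f 0|%:E + `|f 1 - f x|%:E))%E).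
  rewrite -!EFinD lee_fin.
  have := ler_normD (f x - f 0) (f 0); rewrite subrK.
  have := ler_normD (f x - f 1) (f 1); rewrite subrK distrC.
  lra.
by apply: leeD => //; exact: leeD.
Qed.

Lemma C1_derive1 (f : R -> R) : C1 f ->
  continuous (derive1 f) /\ (forall t, derivable f t 1).
Proof.
move=> [df cf]; split; last by move=> t; exact/derivable1_diffP.
have -> : derive1 f = 'D_1 f by apply/funext => t; rewrite derive1E.
exact: cf.
Qed.

(** The difference quotients of a horizontal section are those of f in the direction (1, 0). *)
Lemma C1_section1 (f : R * R -> R) (s : R) : C1 f ->
  let g := fun t => f (t, s) in
  [/\ continuous (fun t => 'D_(1, 0) f (t, s)), forall t, derivable g t 1 &
      forall t, derive1 g t = 'D_(1, 0) f (t, s)].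
Proof.
move=> [df cf] g.
have gE t : (fun h : R => h^-1 *: ((g \o shift t) (h *: (1 : R)) - g t)) =
    (fun h : R => h^-1 *: ((f \o shift (t, s)) (h *: ((1, 0) : R * R)) - f (t, s))).
  apply/funext => h /=; congr (_ *: (_ - _)); rewrite /g; congr f.
  transitivity (h *: (1 : R) + t, h *: (0 : R) + s) => //.
  by rewrite scaler0 add0r.
split.
- exact: (@continuous_section1 R _ s (cf (1, 0))).
- by move=> t; rewrite /derivable gE; exact: diff_derivable.
- by move=> t; rewrite derive1E /derive gE.
Qed.

End FTC.

(** * L^1 approximation and weak derivatives *)

Section L1Approx.
Context d {T : measurableType d} {R : realType}.
Variable mu : {measure set T -> \bar R}.
Implicit Types (f g psi chi : T -> R) (e : R).

(** Zero traces and weak derivative identities are both stable under L^1 limits, and on a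
    probability space every L^p distance with p >= 1 dominates this one; a single notion therefore
    serves all exponents. *)
Definition L1near e f g : Prop := ('N[mu]_1[EFin \o (f - g)%R] <= e%:E)%E.

Lemma L1near_sym e f g : L1near e f g -> L1near e g f.
Proof.
rewrite /L1near -(oppe_Lnorm mu (EFin \o (g - f))).
suff -> : EFin \o (f - g)%R = (\- (EFin \o (g - f)%R))%E by [].
by apply/funext => x /=; rewrite opprB.
Qed.

Lemma L1near_trans e e' f g h :
  measurable_fun setT f -> measurable_fun setT g -> measurable_fun setT h ->
  L1near e f g -> L1near e' g h -> L1near (e + e') f h.
Proof.
move=> mf mg mh fg gh; rewrite /L1near.
rewrite (_ : f - h = (f - g) \+ (g - h)); last first.
  by apply/funext => x /=; rewrite addrA subrK.
apply: le_trans (eminkowski mu _ _ (lexx _)) _; try exact: measurable_funB.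
by rewrite EFinD leeD.
Qed.

Lemma L1near_lincomb e e' (a : R) f g f' g' :
  measurable_fun setT f -> measurable_fun setT g ->
  measurable_fun setT f' -> measurable_fun setT g' ->
  L1near e f g -> L1near e' f' g' ->
  L1near (`|a| * e + e') (a *: f + f') (a *: g + g').
Proof.
move=> mf mg mf' mg' fg fg'; rewrite /L1near.
rewrite (_ : _ - _ = (a *: (f - g)) \+ (f' - g')); last first.
  by apply/funext => x /=; rewrite scalerBr opprD addrACA.
have Lfg : f - g \in Lfun mu 1.
  apply: LfunI; first exact: measurable_funB.
  by apply: le_lt_trans fg _; exact: ltry.
apply: le_trans (eminkowski mu _ _ (lexx _)) _.
- exact/measurable_funM/measurable_funB.
- exact: measurable_funB.
by rewrite Lnorm_scale// EFinD EFinM leeD// lee_wpmul2l.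
Qed.

Lemma L1near_le e e' f g : e <= e' -> L1near e f g -> L1near e' f g.
Proof. by move=> ee' /le_trans; apply; rewrite lee_fin. Qed.

Lemma Lfun1_mul_bounded f psi (K : R) : f \in Lfun mu 1 ->
  measurable_fun setT psi -> (forall x, `|psi x| <= K) ->
  f \* psi \in Lfun mu 1.
Proof.
move=> L1 mpsi psiK.
have mf := Lfun_measurable L1.
apply: (@Lfun_dominated _ _ _ _ _ (K *: f + 0)) => //.
- exact: measurable_funM.
- apply: Lfun_lincomb => //; apply: LfunI; first exact: measurable_cst.
  by rewrite (_ : EFin \o 0 = cst 0%E)// Lnorm0 ?oner_eq0 ?ltry.
- apply: nearW => x /=; rewrite addr0 !normrM mulrC ler_wpM2r//.
  exact: le_trans (ler_norm _).
Qed.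

Lemma int_mul_bounded_near f g psi (K e : R) : 0 <= K ->
  f \in Lfun mu 1 -> g \in Lfun mu 1 ->
  measurable_fun setT psi -> (forall x, `|psi x| <= K) -> L1near e f g ->
  `|\int[mu]_x (f x * psi x) - \int[mu]_x (g x * psi x)| <= K * e.
Proof.
move=> K0 Lf Lg mpsi psiK fg.
have i1 := Lfun1_int (Lfun1_mul_bounded Lf mpsi psiK).
have i2 := Lfun1_int (Lfun1_mul_bounded Lg mpsi psiK).
have Lfg : f - g \in Lfun mu 1.
  by rewrite addrC -scaleN1r; exact: Lfun_lincomb.
have i3 := Lfun1_int (Lfun1_mul_bounded Lfg mpsi psiK).
rewrite -RintegralB//.
under eq_Rintegral do rewrite -mulrBl.
apply: le_trans (le_normr_Rintegral _ i3) _ => //.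
have i4 := Lfun1_int (Lfun_norm Lfg).
apply: (@le_trans _ _ (\int[mu]_x (K * `|f x - g x|))).
  apply: le_Rintegral => //.
  - exact: Lfun1_int (Lfun_norm (Lfun1_mul_bounded Lfg mpsi psiK)).
  - exact: (integrableZl measurableT K i4).
  - by move=> x _; rewrite normrM mulrC ler_wpM2r.
rewrite RintegralZl// ler_wpM2l//.
rewrite -lee_fin (Lfun1_norm Lfg) fineK ?Lfun_fin_num//.
Qed.

(* psi plays the derivative of a test function chi. *)
Definition weak_pairing psi chi f g : Prop :=
  \int[mu]_x (f x * psi x) = - \int[mu]_x (g x * chi x).

Lemma weak_pairing_lincomb psi chi f g f' g' (a K : R) :
  measurable_fun setT psi -> (forall x, `|psi x| <= K) ->
  measurable_fun setT chi -> (forall x, `|chi x| <= K) ->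
  f \in Lfun mu 1 -> g \in Lfun mu 1 -> f' \in Lfun mu 1 -> g' \in Lfun mu 1 ->
  weak_pairing psi chi f g -> weak_pairing psi chi f' g' ->
  weak_pairing psi chi (a *: f + f') (a *: g + g').
Proof.
move=> mpsi psiK mchi chiK Lf Lg Lf' Lg' w w'; rewrite /weak_pairing.
have lin (h h' th : T -> R) : h \in Lfun mu 1 -> h' \in Lfun mu 1 ->
    measurable_fun setT th -> (forall x, `|th x| <= K) ->
    \int[mu]_x ((a *: h + h') x * th x) =
    a * \int[mu]_x (h x * th x) + \int[mu]_x (h' x * th x).
  move=> Lh Lh' mth thK.
  have i1 := Lfun1_int (Lfun1_mul_bounded Lh mth thK).
  have i2 := Lfun1_int (Lfun1_mul_bounded Lh' mth thK).
  rewrite -RintegralZl// -RintegralD//.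
    by apply: eq_Rintegral => x _ /=; rewrite mulrDl mulrA.
  exact: (integrableZl measurableT a i1).
by rewrite !lin// w w' mulrN opprD.
Qed.

Lemma weak_pairing_closed psi chi f g (K : R) : 0 <= K ->
  measurable_fun setT psi -> (forall x, `|psi x| <= K) ->
  measurable_fun setT chi -> (forall x, `|chi x| <= K) ->
  f \in Lfun mu 1 -> g \in Lfun mu 1 ->
  (forall e, 0 < e -> exists f' g', [/\ f' \in Lfun mu 1, g' \in Lfun mu 1,
     L1near e f' f, L1near e g' g & weak_pairing psi chi f' g']) ->
  weak_pairing psi chi f g.
Proof.
move=> K0 mpsi psiK mchi chiK Lf Lg H; rewrite /weak_pairing.
apply/eqP; rewrite -subr_eq0 -normr_le0; apply/ler_addgt0Pr => e e0; rewrite add0r.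
(* With tolerance e / (2 (K + 1)) the two pairing errors, each at most K times the tolerance, add up
   to at most e, also when K = 0. *)
have K1 : 0 < 2 * (K + 1) by rewrite mulr_gt0// ltr_wpDl.
have [f' [g' [Lf' Lg' ff' gg' w]]] := H _ (divr_gt0 e0 K1).
have := int_mul_bounded_near K0 Lf' Lf mpsi psiK ff'.
have := int_mul_bounded_near K0 Lg' Lg mchi chiK gg'.
rewrite w opprK.
set A := Rintegral _ _ _; set B := Rintegral _ _ _.
set C := Rintegral _ _ _; set s := e / _ => h1 h2.
have Ke : K * s + K * s <= e.
  have -> : e = s * (2 * (K + 1)) by rewrite /s mulfVK// gt_eqF.
  have : 0 <= s by rewrite ltW// divr_gt0.
  nra.
apply: le_trans Ke.
have -> : C + B = - (- A - C) - (A - B) by ring.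
by rewrite (le_trans (ler_normD _ _))// !normrN addrC lerD.
Qed.

End L1Approx.

(** * Sobolev functions with zero trace *)

Section TestFunctions.
Context {R : realType} {V : normedModType R}.

Lemma compact_support_bounded (D K : set V) (f : V -> R) : compact K ->
  (forall x, ~ K x -> f x = 0) -> continuous f ->
  exists2 M, 0 <= M & forall x, `|f x| <= M.
Proof.
move=> cK f0 cf.
have /compact_bounded [M [_ HM]] : compact (f @` K).
  by apply: continuous_compact => //; exact: continuous_subspaceT.
exists (`|M| + 1); first by rewrite addr_ge0.
move=> x; have [Kx|nKx] := pselect (K x); last by rewrite f0// normr0 addr_ge0.
apply: (HM (`|M| + 1)); last by exists x.
by rewrite (le_lt_trans (ler_norm M))// ltrDl.
Qed.

Lemma test_fun_continuous (D : set V) (f : V -> R) : test_fun D f ->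
  continuous f /\ forall w, continuous ('D_w f).
Proof.
move=> [sf _]; split=> [x|w x]; apply: differentiable_continuous.
- exact: (sf [::] x).
- exact: (sf [:: w] x).
Qed.

Lemma test_fun_bounded (D : set V) (f : V -> R) : test_fun D f -> forall w,
  exists2 M, 0 <= M & (forall x, `|f x| <= M) /\ (forall x, `|'D_w f x| <= M).
Proof.
move=> tf w; have [cf cdf] := test_fun_continuous tf.
move: tf => [_ [K [cK _ f0]]].
have [M M0 fM] := compact_support_bounded D cK f0 cf.
(* K is closed, so f vanishes on a neighbourhood of every point outside K; the derivative is thus
   supported in K as well. *)
have df0 x : ~ K x -> 'D_w f x = 0.
  move=> nKx; rewrite (@near_eq_derive _ _ _ f (cst 0) x w) ?derive_cst//.
  have oK : open (~` K).
    by apply: closed_openC; exact: compact_closed (@norm_hausdorff _ _) cK.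
  by apply: filterS (open_nbhs_nbhs (conj oK nKx)) => y; exact: f0.
have [N N0 dfN] := compact_support_bounded D cK df0 (cdf w).
exists (M + N); first exact: addr_ge0.
split=> x; first by rewrite (le_trans (fM x))// lerDl.
by rewrite (le_trans (dfN x))// lerDr.
Qed.

Lemma C1_lincomb (f g : V -> R) (a : R) : C1 f -> C1 g ->
  C1 (a *: f + g) /\
  forall w, 'D_w (a *: f + g) = a *: 'D_w f + 'D_w g.
Proof.
move=> [df cf] [dg cg].
have D w : 'D_w (a *: f + g) = a *: 'D_w f + 'D_w g.
  apply/funext => x; rewrite deriveD ?deriveZ//; try exact: diff_derivable.
  by apply: derivableZ; exact: diff_derivable.
split=> //; split=> [x|w x].
  by apply: differentiableD => //; exact: differentiableZ.
rewrite D; apply: cvgD; last exact: cg.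
by apply: cvgZr; exact: cf.
Qed.

Lemma C1_continuous (f : V -> R) : C1 f -> continuous f.
Proof. by move=> [df _] x; exact: differentiable_continuous. Qed.

End TestFunctions.

Section EuclideanNorm.
Context {R : realType}.
Implicit Types (a b : 'cV[R]_2) (y : jetO R).

Lemma dotvE a b : dotv a b = a 0 0 * b 0 0 + a 1 0 * b 1 0.
Proof. by rewrite /dotv 2!big_ord_recl big_ord0 addr0; congr (_ + _ * _);
  congr (_ _ _); apply/val_inj. Qed.

Lemma enormE a : enorm a = Num.sqrt (a 0 0 ^+ 2 + a 1 0 ^+ 2).
Proof. by rewrite /enorm dotvE !expr2. Qed.

Lemma enorm_ge0 a : 0 <= enorm a.
Proof. by rewrite /enorm sqrtr_ge0. Qed.

Lemma enorm_sqr a : enorm a ^+ 2 = a 0 0 ^+ 2 + a 1 0 ^+ 2.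
Proof. by rewrite enormE sqr_sqrtr// addr_ge0// sqr_ge0. Qed.

Lemma le_enorm0 a : `|a 0 0| <= enorm a.
Proof. by rewrite enormE -sqrtr_sqr ler_sqrt ?addr_ge0 ?sqr_ge0// lerDl sqr_ge0. Qed.

Lemma le_enorm1 a : `|a 1 0| <= enorm a.
Proof. by rewrite enormE -sqrtr_sqr ler_sqrt ?addr_ge0 ?sqr_ge0// lerDr sqr_ge0. Qed.

Lemma enorm_le_sum a : enorm a <= `|a 0 0| + `|a 1 0|.
Proof.
rewrite -[leRHS]ger0_norm ?addr_ge0// -sqrtr_sqr enormE ler_sqrt ?sqr_ge0//.
rewrite -(real_normK (num_real (a 0 0))) -(real_normK (num_real (a 1 0))).
have := mulr_ge0 (normr_ge0 (a 0 0)) (normr_ge0 (a 1 0)); nra.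
Qed.

Lemma cauchy_schwarz_dotv a b : `|dotv a b| <= enorm a * enorm b.
Proof.
rewrite -(@ler_pXn2r _ 2) ?nnegrE ?mulr_ge0 ?enorm_ge0//.
rewrite exprMn !enorm_sqr real_normK ?num_real// dotvE.
(* Lagrange's identity: this square is the difference of the two sides. *)
have := sqr_ge0 (a 0 0 * b 1 0 - a 1 0 * b 0 0); nra.
Qed.

Lemma enormD a b : enorm (a + b) <= enorm a + enorm b.
Proof.
rewrite -(@ler_pXn2r _ 2) ?nnegrE ?addr_ge0 ?enorm_ge0//.
have := le_trans (ler_norm _) (cauchy_schwarz_dotv a b); rewrite dotvE.
rewrite sqrrD !enorm_sqr !mxE; nra.
Qed.

Lemma enormZ (c : R) a : enorm (c *: a) = `|c| * enorm a.
Proof.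
by rewrite !enormE !mxE !exprMn -mulrDr sqrtrM ?sqr_ge0// sqrtr_sqr.
Qed.

Lemma grad_lincomb (c : R) y z x : grad (c *: y + z) x = c *: grad y x + grad z x.
Proof. by apply/matrixP => i j; rewrite !mxE; case: ifP. Qed.

Lemma grad0 y x : grad y x 0 0 = y.2.1 x. Proof. by rewrite mxE. Qed.

Lemma grad1 y x : grad y x 1 0 = y.2.2 x. Proof. by rewrite mxE. Qed.

End EuclideanNorm.

(** * Zero traces *)

Section SmallTraces.
Context {R : realType}.
Local Notation muI := (@muI R).
Local Notation muO := (@muO R).
Implicit Types (u w : jetI R) (y z : jetO R).

Lemma ecvg0_ev (s : (\bar R)^nat) (e : R) : s @ \oo --> 0%E -> 0 < e ->
  \forall n \near \oo, (s n <= e%:E)%E.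
Proof.
move=> /fine_cvgP[fs cs] e0.
have he : \forall n \near \oo, `|(fine \o s) n| <= e.
  by move/cvgr0_norm_le : cs; exact.
apply: filterS2 fs he => n fn; rewrite /= => hn.
rewrite -(fineK fn) lee_fin; exact: le_trans (ler_norm _) hn.
Qed.

Lemma ecvg0_of_le (s : (\bar R)^nat) : (forall n, 0 <= s n)%E ->
  (forall n, s n <= (n.+1%:R^-1)%:E)%E -> s @ \oo --> 0%E.
Proof.
move=> s0 sn; apply: (squeeze_cvge _ (cvg_cst 0%E) cvge_harmonic).
by apply: nearW => n; rewrite s0 /= sn.
Qed.

(** Zero trace in epsilon form: one C^1 function per tolerance replaces the approximating sequence,
    so that sums and limits need no diagonal argument. *)
Definition approxI u := forall e : R, 0 < e -> exists phi : R -> R,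
  [/\ C1 phi, L1near muI e phi u.1, L1near muI e (derive1 phi) u.2,
      `|phi 0| <= e & `|phi 1| <= e].

Definition approxO y := forall e : R, 0 < e -> exists phi : R * R -> R,
  [/\ C1 phi, L1near muO e phi y.1, L1near muO e ('D_(1, 0) phi) y.2.1,
      L1near muO e ('D_(0, 1) phi) y.2.2 & (bdnorm phi <= e%:E)%E].

Lemma approxIP u : measurable_fun setT u.1 -> measurable_fun setT u.2 ->
  traceI u 0 0 <-> approxI u.
Proof.
move=> mu1 mu2; split=> [[phi [C1phi nphi phi0 phi1]] e e0|H].
  have h1 := ecvg0_ev nphi e0.
  have h2 : \forall n \near \oo, `|phi n 0| <= e by move/cvgr0_norm_le : phi0; exact.
  have h3 : \forall n \near \oo, `|phi n 1| <= e by move/cvgr0_norm_le : phi1; exact.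
  have [n [[hn1 hn2] hn3]] := @filter_ex _ _ _ _ (filterI (filterI h1 h2) h3).
  exists (phi n); split=> //.
  - by apply: le_trans hn1; rewrite leeDl ?Lnorm_ge0.
  - by apply: le_trans hn1; rewrite leeDr ?Lnorm_ge0.
(* The W^1_1 norm on I adds two L^1 norms, hence the halved tolerance. *)
have /choice[phi phiP] : forall n : nat, exists phi : R -> R,
    let e := (n.+1%:R^-1 / 2) in
    [/\ C1 phi, L1near muI e phi u.1, L1near muI e (derive1 phi) u.2,
        `|phi 0| <= e & `|phi 1| <= e].
  by move=> n; apply: H; rewrite divr_gt0// invr_gt0.
have ltn (n : nat) : n.+1%:R^-1 / 2 <= n.+1%:R^-1 :> R.
  by rewrite ler_pdivrMr// ler_peMr ?ler1n// invr_ge0.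
exists phi; split.
- by move=> n; have [] := phiP n.
- apply: ecvg0_of_le => n; first by rewrite /normI adde_ge0 ?Lnorm_ge0.
  have [_ h1 h2 _ _] := phiP n.
  by rewrite [(n.+1%:R^-1)](splitr (n.+1%:R^-1 : R)) EFinD leeD.
- apply/cvgrPdist_le => e e0; near=> n.
  have [_ _ _ h _] := phiP n.
  rewrite sub0r normrN (le_trans h)// (le_trans (ltn n))// ltW//.
  by near: n; exact: (near_infty_natSinv_lt (PosNum e0)).
- apply/cvgrPdist_le => e e0; near=> n.
  have [_ _ _ _ h] := phiP n.
  rewrite sub0r normrN (le_trans h)// (le_trans (ltn n))// ltW//.
  by near: n; exact: (near_infty_natSinv_lt (PosNum e0)).
Unshelve. all: by end_near. Qed.

Lemma measurable_enorm_grad y : measurable_fun setT y.2.1 ->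
  measurable_fun setT y.2.2 -> measurable_fun setT (enorm \o grad y).
Proof.
move=> m1 m2.
rewrite (_ : _ \o _ = fun x => Num.sqrt (y.2.1 x ^+ 2 + y.2.2 x ^+ 2)).
  apply: (@measurableT_comp _ _ _ _ _ _ (@Num.sqrt R)) => //.
    exact: continuous_measurable_fun (@sqrt_continuous R).
  by apply: measurable_funD; exact: measurable_funX.
by apply/funext => x /=; rewrite enormE grad0 grad1.
Qed.

Lemma Lnorm_grad_le (p : \bar R) y : (1 <= p)%E -> measurable_fun setT y.2.1 ->
  measurable_fun setT y.2.2 ->
  [/\ 'N[muO]_p[EFin \o y.2.1] <= 'N[muO]_p[EFin \o (enorm \o grad y)],
      'N[muO]_p[EFin \o y.2.2] <= 'N[muO]_p[EFin \o (enorm \o grad y)] &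
      'N[muO]_p[EFin \o (enorm \o grad y)] <=
        'N[muO]_p[EFin \o y.2.1] + 'N[muO]_p[EFin \o y.2.2]]%E.
Proof.
move=> p1 m1 m2; have me := measurable_enorm_grad m1 m2; split.
- apply: le_Lnorm_ae => //; apply: nearW => x /=.
  by rewrite (ger0_norm (enorm_ge0 _)) -grad0 le_enorm0.
- apply: le_Lnorm_ae => //; apply: nearW => x /=.
  by rewrite (ger0_norm (enorm_ge0 _)) -grad1 le_enorm1.
rewrite -(Lnorm_abse muO (EFin \o y.2.1)) -(Lnorm_abse muO (EFin \o y.2.2)).
apply: le_trans (eminkowski muO _ _ p1) => //; try exact: measurableT_comp.
apply: le_Lnorm_ae => //.
  by apply: measurable_funD; exact: measurableT_comp.
apply: nearW => x /=.
rewrite (ger0_norm (enorm_ge0 _)) [leRHS]ger0_norm ?addr_ge0//.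
by rewrite -(grad0 y x) -(grad1 y x) enorm_le_sum.
Qed.

Lemma C1_measurable_prod (phi : R * R -> R) : C1 phi ->
  measurable_fun setT (phi : measurableTypeR R * measurableTypeR R -> R) /\
  forall r : R * R, measurable_fun setT
    ('D_r phi : measurableTypeR R * measurableTypeR R -> R).
Proof.
move=> Cphi; split=> [|r]; apply: continuous_measurable_prod.
- exact: (C1_continuous Cphi).
- exact: (Cphi.2 r).
Qed.

Lemma approxOP y : measurable_fun setT y.1 -> measurable_fun setT y.2.1 ->
  measurable_fun setT y.2.2 -> traceO y (fun=> 0) <-> approxO y.
Proof.
move=> my m1 m2.
have bd0 (g : R * R -> R) : g - (fun=> 0) = g by apply/funext => x /=; rewrite subr0.
split=> [[phi [C1phi nphi bphi]] e e0|H].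
  have h1 := ecvg0_ev nphi e0; have h2 := ecvg0_ev bphi e0.
  have [n [hn1 hn2]] := @filter_ex _ _ _ _ (filterI h1 h2).
  have [mphi mD] := C1_measurable_prod (C1phi n).
  have [g1 g2 _] := @Lnorm_grad_le 1%E
      ((phi n, ('D_(1, 0) (phi n), 'D_(0, 1) (phi n))) - y) (lexx _)
      (measurable_funB (mD _) m1) (measurable_funB (mD _) m2).
  have gn : (normO 1 ((phi n, ('D_(1, 0) (phi n), 'D_(0, 1) (phi n))) - y)%R
      <= e%:E)%E by exact: hn1.
  exists (phi n); rewrite bd0 in hn2; split=> //.
  - by apply: le_trans gn; rewrite leeDl ?Lnorm_ge0.
  - by apply: (le_trans g1); apply: le_trans gn; rewrite leeDr ?Lnorm_ge0.
  - by apply: (le_trans g2); apply: le_trans gn; rewrite leeDr ?Lnorm_ge0.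
(* A third, because the W^1_1 norm on Omega is bounded by three L^1 norms, those of the function and
   of its two partial derivatives. *)
have /choice[phi phiP] : forall n : nat, exists phi : R * R -> R,
    let e := (n.+1%:R^-1 / 3) in
    [/\ C1 phi, L1near muO e phi y.1, L1near muO e ('D_(1, 0) phi) y.2.1,
      L1near muO e ('D_(0, 1) phi) y.2.2 & (bdnorm phi <= e%:E)%E].
  by move=> n; apply: H; rewrite divr_gt0// invr_gt0.
exists phi; split.
- by move=> n; have [] := phiP n.
- apply: ecvg0_of_le => n; first by rewrite /normO adde_ge0 ?Lnorm_ge0.
  have [C1phi h1 h2 h3 _] := phiP n.
  have [mphi mD] := C1_measurable_prod C1phi.
  have -> : n.+1%:R^-1 = n.+1%:R^-1 / 3 + (n.+1%:R^-1 / 3 + n.+1%:R^-1 / 3) :> R.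
    by field.
  rewrite EFinD leeD//.
  have [_ _] := @Lnorm_grad_le 1%E
      ((phi n, ('D_(1, 0) (phi n), 'D_(0, 1) (phi n))) - y) (lexx _)
      (measurable_funB (mD _) m1) (measurable_funB (mD _) m2).
  by move=> /le_trans; apply; rewrite EFinD leeD.
- apply: ecvg0_of_le => n.
    by apply: integral_ge0 => t _; rewrite lee_fin !addr_ge0.
  rewrite bd0; have [_ _ _ _ h] := phiP n; apply: le_trans h _.
  by rewrite lee_fin ler_pdivrMr// ler_peMr ?ler1n// invr_ge0.
Qed.

End SmallTraces.

Section TraceZero.
Context {R : realType}.
Local Notation muI := (@muI R).
Local Notation muO := (@muO R).
Implicit Types (u w : jetI R) (y z : jetO R).

Definition measI u := measurable_fun setT u.1 /\ measurable_fun setT u.2.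

Definition measO y := [/\ measurable_fun setT y.1, measurable_fun setT y.2.1 &
  measurable_fun setT y.2.2].

Lemma split_eps (a e : R) : 0 < e -> exists2 s, 0 < s & `|a| * s + s <= e.
Proof.
move=> e0; have a1 : 0 < `|a| + 1 by rewrite ltr_wpDl.
exists (e / (`|a| + 1)); first exact: divr_gt0.
by rewrite -[X in _ + X]mul1r -mulrDl mulrC mulfVK// gt_eqF.
Qed.

Lemma C1_measurable (f : R -> R) : C1 f ->
  measurable_fun setT (f : measurableTypeR R -> R) /\
  measurable_fun setT (derive1 f : measurableTypeR R -> R).
Proof.
move=> Cf; split; apply: continuous_measurable_fun.
- exact: C1_continuous.
- exact: (C1_derive1 Cf).1.
Qed.

Lemma approxI_lincomb (a : R) u w : measI u -> measI w ->
  approxI u -> approxI w -> approxI (a *: u + w).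
Proof.
move=> [mu1 mu2] [mw1 mw2] au aw e e0.
have [s s0 se] := split_eps a e0.
have [f [Cf f1 f2 f3 f4]] := au s s0; have [g [Cg g1 g2 g3 g4]] := aw s s0.
have [mf mdf] := C1_measurable Cf; have [mg mdg] := C1_measurable Cg.
have [Cfg Dfg] := C1_lincomb a Cf Cg.
have dE : derive1 (a *: f + g) = a *: derive1 f + derive1 g.
  apply/funext => t; rewrite -[RHS]/(a * derive1 f t + derive1 g t) !derive1E.
  exact: (congr1 (fun k => k t) (Dfg 1)).
have bnd (x y : R) : `|x| <= s -> `|y| <= s -> `|a *: x + y| <= e.
  move=> xs ys; apply: le_trans se; apply: le_trans (ler_normD _ _) _.
  by rewrite lerD// normrM ler_wpM2l.
exists (a *: f + g); split => //.
- by apply: (L1near_le se); exact: L1near_lincomb.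
- by rewrite dE; apply: (L1near_le se); exact: L1near_lincomb.
- exact: bnd.
- exact: bnd.
Qed.

Lemma bdnorm_lincomb (a : R) (f g : R * R -> R) : continuous f -> continuous g ->
  (bdnorm (a *: f + g)%R <= `|a|%:E * bdnorm f + bdnorm g)%E.
Proof.
move=> cf cg.
pose B (h : R * R -> R) (t : R) :=
  `|h (t, 0)| + `|h (t, 1)| + `|h (0, t)| + `|h (1, t)|.
have mB (h : R * R -> R) : continuous h ->
    measurable_fun setT (fun t : measurableTypeR R => (B h t)%:E).
  move=> ch; apply/measurable_EFinP.
  by do 3?apply: measurable_funD; apply: measurableT_comp => //;
    apply: continuous_measurable_fun;
    solve [exact: continuous_section1 | exact: continuous_section2].
have B0 h t : (0 <= (B h t)%:E)%E by rewrite lee_fin !addr_ge0.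
rewrite /bdnorm -ge0_integralZl//; [|exact: mB..].
rewrite -ge0_integralD//; last 2 first.
- by apply: measurable_funeM; exact: mB.
- exact: mB.
apply: ge0_le_integral_ae => [t|t|]; first exact: B0.
  by rewrite adde_ge0// mule_ge0// lee_fin.
apply: nearW => t; rewrite -EFinM -EFinD lee_fin /=.
have h (x y : R) : `|a *: x + y| <= `|a| * `|x| + `|y|.
  by apply: le_trans (ler_normD _ _) _; rewrite normrM.
have h1 := h (f (t, 0)) (g (t, 0)); have h2 := h (f (t, 1)) (g (t, 1)).
have h3 := h (f (0, t)) (g (0, t)); have h4 := h (f (1, t)) (g (1, t)).
by move: (lerD (lerD (lerD h1 h2) h3) h4) => /le_trans; apply; lra.
Qed.

Lemma approxO_lincomb (a : R) y z : measO y -> measO z ->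
  approxO y -> approxO z -> approxO (a *: y + z).
Proof.
move=> [my my1 my2] [mz mz1 mz2] ay az e e0.
have [s s0 se] := split_eps a e0.
have [f [Cf f1 f2 f3 f4]] := ay s s0; have [g [Cg g1 g2 g3 g4]] := az s s0.
have [mf mdf] := C1_measurable_prod Cf; have [mg mdg] := C1_measurable_prod Cg.
have [Cfg Dfg] := C1_lincomb a Cf Cg.
exists (a *: f + g); split => //.
- by apply: (L1near_le se); exact: L1near_lincomb.
- by rewrite Dfg; apply: (L1near_le se);
    exact: (L1near_lincomb a (mdf _) my1 (mdg _) mz1 f2 g2).
- by rewrite Dfg; apply: (L1near_le se);
    exact: (L1near_lincomb a (mdf _) my2 (mdg _) mz2 f3 g3).
- apply: le_trans (bdnorm_lincomb a (C1_continuous Cf) (C1_continuous Cg)) _.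
  apply: (@le_trans _ _ ((`|a| * s + s)%:E)); last by rewrite lee_fin.
  by rewrite EFinD EFinM leeD// lee_wpmul2l.
Qed.

(** No trace inequality enters: the C^1 function that approximates a nearby w and is small at the
    endpoints approximates u as well. *)
Lemma approxI_closed u : measI u ->
  (forall e, 0 < e -> exists w, [/\ measI w, approxI w,
     L1near muI e w.1 u.1 & L1near muI e w.2 u.2]) -> approxI u.
Proof.
move=> [mu1 mu2] H e e0; have e20 : 0 < e / 2 by rewrite divr_gt0.
have [w [[mw1 mw2] aw w1 w2]] := H _ e20.
have [f [Cf f1 f2 f3 f4]] := aw _ e20.
have [mf mdf] := C1_measurable Cf.
have le2 : e / 2 <= e by rewrite ler_pdivrMr// ler_pMr// ler1n.
exists f; split => //.
- by rewrite (splitr e); exact: L1near_trans f1 w1.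
- by rewrite (splitr e); exact: L1near_trans f2 w2.
- exact: le_trans le2.
- exact: le_trans le2.
Qed.

Lemma approxO_closed y : measO y ->
  (forall e, 0 < e -> exists z, [/\ measO z, approxO z,
     L1near muO e z.1 y.1, L1near muO e z.2.1 y.2.1 &
     L1near muO e z.2.2 y.2.2]) -> approxO y.
Proof.
move=> [my my1 my2] H e e0; have e20 : 0 < e / 2 by rewrite divr_gt0.
have [z [[mz mz1 mz2] az z1 z2 z3]] := H _ e20.
have [f [Cf f1 f2 f3 f4]] := az _ e20.
have [mf mdf] := C1_measurable_prod Cf.
exists f; split => //.
- by rewrite (splitr e); exact: L1near_trans f1 z1.
- by rewrite (splitr e); exact: (L1near_trans (mdf _) mz1 my1 f2 z2).
- by rewrite (splitr e); exact: (L1near_trans (mdf _) mz2 my2 f3 z3).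
- by apply: le_trans f4 _; rewrite lee_fin ler_pdivrMr// ler_pMr// ler1n.
Qed.

End TraceZero.

Lemma ae_muO_filter (R : realType) : Filter (nbhs (almost_everywhere (@muO R))).
Proof.
exact: (ae_filter_ringOfSetsType
  (muO : {measure set (measurableTypeR R * measurableTypeR R)%type -> \bar R})).
Qed.
#[global] Hint Extern 0 (Filter (nbhs (almost_everywhere _))) =>
  (exact: ae_muO_filter) : typeclass_instances.

(** * Poincaré inequalities *)

Section Poincare.
Context {R : realType}.
Local Notation muI := (@muI R).
Local Notation muO := (@muO R).
Implicit Types (u w : jetI R) (y z : jetO R).

Lemma integral_muI_cst (c : \bar R) : (\int[muI]_t c = c)%E.
Proof. by rewrite integral_cst// [X in (_ * X)%E](@muI_setT R) mule1. Qed.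

(** The two-point bound holds for C^1 approximants f. Its endpoint values and derivative error are
    small constants, but |f - u| is small only in mean; [ae_le_of_le_add_small] removes all of these
    at once. *)
Lemma poincareI_ae u : measI u -> approxI u ->
  {ae muI, forall t, (2 * `|u.1 t|)%:E <= 'N[muI]_1[EFin \o u.2]}%E.
Proof.
move=> [mu1 mu2] au.
apply: (ae_le_of_le_add_small (h := fun=> ('N[muI]_1[EFin \o u.2])%E)).
  by move=> _; exact: Lnorm_ge0.
(* Two shares pay for 2 |f - u|, two for the endpoint values and one for the error of the
   derivative. *)
move=> e e0; pose s := e / 5.
have s0 : 0 < s by exact: divr_gt0.
have [f [Cf f1 f2 f3 f4]] := au _ s0.
have [mf mdf] := C1_measurable Cf.
have [cdf df] := C1_derive1 Cf.
pose g (t : R) : \bar R := (2%:E * `|(f t - u.1 t)%:E| + (3 * s)%:E)%E.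
have mg : measurable_fun setT (fun t : measurableTypeR R => `|(f t - u.1 t)%:E|%E).
  by apply: measurableT_comp => //; apply/measurable_EFinP; exact: measurable_funB.
exists g; split.
- by apply: emeasurable_funD => //; exact: measurable_funeM.
- by move=> t; rewrite adde_ge0 ?mule_ge0 ?lee_fin ?mulr_ge0// ltW.
- rewrite ge0_integralD//; last 2 first.
  + exact: measurable_funeM.
  + by move=> t _; rewrite lee_fin mulr_ge0// ltW.
  rewrite integral_muI_cst ge0_integralZl//.
  have -> : e = 2 * s + 3 * s by rewrite /s; field.
  rewrite [leRHS]EFinD leeD// [leRHS]EFinM lee_wpmul2l//.
  by move: f1; rewrite /L1near Lnorm1.
- apply: filterS ae_itvI => t t01.
  have h1 := C1_two_point_bound t01 cdf df (fun _ => erefl).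
  have h2 : (\int[muI]_t `|derive1 f t|%:E <= 'N[muI]_1[EFin \o u.2] + s%:E)%E.
    have := eminkowski muI mu2 (measurable_funB mdf mu2) (lexx _).
    rewrite (_ : u.2 \+ (derive1 f - u.2) = derive1 f); last first.
      by apply/funext => x /=; rewrite addrC subrK.
    by rewrite [X in (X <= _)%E]Lnorm1 => /le_trans; apply; rewrite leeD.
  apply: (@le_trans _ _ (2%:E * `|(f t - u.1 t)%:E| + (2 * `|f t|)%:E)%E).
    rewrite abse_EFin -EFinM -EFinD lee_fin -mulrDr ler_pM2l//.
    by have := ler_normB (f t) (f t - u.1 t); rewrite subKr addrC.
  rewrite addeCA leeD//.
  apply: (le_trans h1); rewrite (_ : 3 * s = (s + s) + s); last by ring.
  by rewrite [(s + s + s)%:E]EFinD addeCA leeD// lee_fin lerD.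
Qed.

Lemma integral_muO_snd (F : R -> \bar R) :
  measurable_fun setT (F : measurableTypeR R -> \bar R) ->
  (forall t, 0 <= F t)%E -> (\int[muO]_x F x.2 = \int[muI]_t F t)%E.
Proof.
move=> mF F0; rewrite fubini_tonelli2//=; last first.
  exact: (measurableT_comp mF (@measurable_snd _ _ _ _)).
apply: eq_integral => t _; by rewrite /fubini_G/= integral_muI_cst.
Qed.

Lemma measurable_section2 (F : R * R -> \bar R) (s : R) :
  measurable_fun setT (F : measurableTypeR R * measurableTypeR R -> \bar R) ->
  measurable_fun setT (fun t : measurableTypeR R => F (t, s)).
Proof.
move=> mF; apply: (measurableT_comp mF).
exact: (@pair2_measurable _ _ (measurableTypeR R) (measurableTypeR R) s).
Qed.

Lemma integral_muO_iter (F : R * R -> \bar R) :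
  measurable_fun setT (F : measurableTypeR R * measurableTypeR R -> \bar R) ->
  (forall x, 0 <= F x)%E ->
  measurable_fun setT (fun s : measurableTypeR R => \int[muI]_t F (t, s))%E /\
  (\int[muO]_x F x = \int[muI]_s \int[muI]_t F (t, s))%E.
Proof.
move=> mF F0; split; first exact: (@measurable_fun_fubini_tonelli_G _ _ _ _ R muI F mF F0).
by rewrite fubini_tonelli2.
Qed.

(** The two-point bound on horizontal sections of an approximant. The boundary term [B] and the
    derivative error [g3] depend on x_2 only; by Tonelli their integrals over Omega are the boundary
    norm and an L^1 distance, both small. *)
Lemma poincareO_ae y : measO y -> approxO y ->
  {ae muO, forall x, `|y.1 x|%:E <= \int[muI]_t `|y.2.1 (t, x.2)|%:E}%E.
Proof.
move=> [my my1 my2] ay.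
apply: (@ae_le_of_le_add_small _ _ _ muO (fun x => `|y.1 x|%:E)
  (fun x : R * R => (\int[muI]_t `|y.2.1 (t, x.2)|%:E)%E)).
  by move=> x; apply: integral_ge0.
move=> e e0; pose s := e / 3.
have s0 : 0 < s by exact: divr_gt0.
have [f [Cf f1 f2 _ f4]] := ay _ s0.
have [mf mdf] := C1_measurable_prod Cf; have cf := C1_continuous Cf.
pose g1 (x : R * R) : \bar R := `|f x - y.1 x|%:E.
pose B (t : R) : R := `|f (t, 0)| + `|f (t, 1)| + `|f (0, t)| + `|f (1, t)|.
have B0 t : 0 <= B t by rewrite !addr_ge0.
have mB : measurable_fun setT (fun t : measurableTypeR R => (B t)%:E).
  apply/measurable_EFinP.
  by do 3?apply: measurable_funD; apply: measurableT_comp => //;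
    apply: continuous_measurable_fun;
    solve [exact: continuous_section1 | exact: continuous_section2].
pose D (x : R * R) : \bar R := `|'D_(1, 0) f x - y.2.1 x|%:E.
have mD : measurable_fun setT (D : measurableTypeR R * measurableTypeR R -> \bar R).
  apply/measurable_EFinP; apply: measurableT_comp => //.
  exact: (measurable_funB (mdf _) my1).
have D0 x : (0 <= D x)%E by rewrite lee_fin.
pose g3 (t : R) : \bar R := (\int[muI]_r D (r, t))%E.
have [mg3 intg3] := integral_muO_iter mD D0.
have g30 t : (0 <= g3 t)%E by apply: integral_ge0.
have g10 x : (0 <= g1 x)%E by rewrite lee_fin.
have B0E t : (0 <= (B t)%:E)%E by rewrite lee_fin.
have msnd := @measurable_snd _ _ (measurableTypeR R) (measurableTypeR R).
have mg1 : measurable_fun setT (g1 : measurableTypeR R * measurableTypeR R -> \bar R).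
  apply/measurable_EFinP; apply: measurableT_comp => //.
  exact: (measurable_funB mf my).
have mg2' : measurable_fun setT
    (fun x : measurableTypeR R * measurableTypeR R => (B x.2)%:E).
  exact: (measurableT_comp mB msnd).
have mg3' : measurable_fun setT
    (fun x : measurableTypeR R * measurableTypeR R => g3 x.2).
  exact: (measurableT_comp mg3 msnd).
exists (fun x => g1 x + (B x.2)%:E + g3 x.2)%E; split.
- exact: (emeasurable_funD (emeasurable_funD mg1 mg2') mg3').
- by move=> x; exact: adde_ge0 (adde_ge0 (g10 x) (B0E x.2)) (g30 x.2).
- rewrite (ge0_integralD _ measurableT _ (emeasurable_funD mg1 mg2') _ mg3')//;
    last by move=> x _; exact: adde_ge0 (g10 x) (B0E x.2).
  rewrite (ge0_integralD _ measurableT _ mg1 _ mg2')//.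
  have -> : e = s + s + s by rewrite /s; field.
  rewrite [leRHS]EFinD leeD//.
    rewrite [leRHS]EFinD leeD//; first by move: f1; rewrite /L1near Lnorm1.
    by rewrite (integral_muO_snd mB).
  rewrite (integral_muO_snd mg3)// -intg3.
  by move: f2; rewrite /L1near Lnorm1.
- apply: filterS (ae_muO_fst ae_itvI) => -[a b] /= a01.
  have [cdf df dfE] := C1_section1 b Cf.
  have h1 := C1_two_point_bound a01 cdf df dfE.
  have msec : measurable_fun setT (fun t : measurableTypeR R => `|y.2.1 (t, b)|%:E).
    apply: (@measurable_section2 (fun x => `|y.2.1 x|%:E) b).
    by apply/measurable_EFinP; exact: measurableT_comp.
  have h2 : (\int[muI]_t `|'D_(1, 0) f (t, b)|%:E <=
      \int[muI]_t `|y.2.1 (t, b)|%:E + g3 b)%E.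
    rewrite /g3 -ge0_integralD//; last exact: (measurable_section2 b mD).
    apply: ge0_le_integral_ae => //.
      by move=> t; exact: adde_ge0.
    apply: nearW => t; rewrite -EFinD lee_fin.
    have := ler_normD (y.2.1 (t, b)) ('D_(1, 0) f (t, b) - y.2.1 (t, b)).
    by rewrite addrC subrK.
  (* The gain of the two-point bound is given away here: |f| <= 2 |f|, and the constant 1 is enough
     on Omega. *)
  apply: (@le_trans _ _ (g1 (a, b) + (2 * `|f (a, b)|)%:E)%E).
    rewrite /g1 -EFinD lee_fin.
    have := ler_normB (f (a, b)) (f (a, b) - y.1 (a, b)); rewrite subKr.
    have := normr_ge0 (f (a, b)); lra.
  have h3 : ((2 * `|f (a, b)|)%:E <=
      (B b)%:E + (\int[muI]_t `|y.2.1 (t, b)|%:E + g3 b))%E.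
    apply: (le_trans h1); apply: leeD => //.
    rewrite lee_fin /B; have := normr_ge0 (f (b, 0)); have := normr_ge0 (f (b, 1)).
    lra.
  rewrite -[X in (_ <= _ + X)%E]addeA addeCA [X in (_ <= _ + X)%E]addeCA.
  by rewrite leeD.
Qed.

(** On each horizontal line the integral of |d_1 y| is at most its L^p norm, because I has measure
    1; raising to the power p and integrating over Omega gives the claim. *)
Lemma poincareO y (p : R) : 1 <= p -> measO y -> approxO y ->
  ('N[muO]_p%:E[EFin \o y.1] <= 'N[muO]_p%:E[EFin \o y.2.1])%E.
Proof.
move=> p1 my ay; have [m0 m1 m2] := my.
have p0 : 0 < p by exact: lt_le_trans p1.
pose F (x : R * R) : \bar R := (`|y.2.1 x| `^ p)%:E.
have mF : measurable_fun setT (F : measurableTypeR R * measurableTypeR R -> \bar R).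
  apply/measurable_EFinP.
  apply: (@measurableT_comp _ _ _ _ _ _ (@powR R ^~ p)) => //.
  exact: measurableT_comp.
have F0 x : (0 <= F x)%E by rewrite lee_fin powR_ge0.
have [mG intG] := integral_muO_iter mF F0.
pose G (t : R) : \bar R := (\int[muI]_r F (r, t))%E.
have G0 t : (0 <= G t)%E by exact: integral_ge0.
rewrite unlock /=; apply: gt0_ler_poweR.
- by rewrite invr_ge0 ltW.
- by rewrite in_itv/= leey integral_ge0// => x _; rewrite lee_fin powR_ge0.
- by rewrite in_itv/= leey integral_ge0// => x _; rewrite lee_fin powR_ge0.
rewrite -/F intG -(integral_muO_snd mG)//.
apply: ge0_le_integral_ae => [x|x|]; first by rewrite lee_fin powR_ge0.
  exact: G0.
apply: filterS (poincareO_ae my ay) => x hx.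
pose S := ('N[muI]_p%:E[EFin \o (fun t => y.2.1 (t, x.2))])%E.
have msec : measurable_fun setT (fun t : measurableTypeR R => y.2.1 (t, x.2)).
  apply/measurable_EFinP.
  by apply: (@measurable_section2 (EFin \o y.2.1)); exact/measurable_EFinP.
have hS : (`|y.1 x|%:E <= S)%E.
  apply: (le_trans hx).
  have := @le_Lnorm1_Lnorm _ _ _ muI _ p%:E (@muI_setT R) _ msec.
  by rewrite Lnorm1 lee_fin; exact.
have -> : (\int[muI]_t F (t, x.2) = S `^ p)%E by rewrite /S poweR_Lnorm// gt_eqF.
rewrite -poweR_EFin; apply: (@gt0_ler_poweR _ p (ltW p0) _ S _ _ hS).
  by rewrite in_itv/= leey lee_fin normr_ge0.
by rewrite in_itv/= leey Lnorm_ge0.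
Qed.

End Poincare.

(** * The zero-trace Sobolev spaces *)

Section SobolevSpaces.
Context {R : realType}.
Local Notation muI := (@muI R).
Local Notation muO := (@muO R).
Implicit Types (u w : jetI R) (y z : jetO R) (r : \bar R).

Lemma W1I_meas r u : W1I r u -> measI u.
Proof. by move=> [h1 h2 _]; split; [exact: Lfun_measurable h1|exact: Lfun_measurable h2]. Qed.

Lemma W1O_meas r y : W1O r y -> measO y.
Proof.
by move=> [h1 h2 h3 _]; split;
  [exact: Lfun_measurable h1|exact: Lfun_measurable h2|exact: Lfun_measurable h3].
Qed.

Lemma W10IP r u : W10I r u <-> W1I r u /\ approxI u.
Proof.
by split=> -[Wu tu]; split=> //; have [m1 m2] := W1I_meas Wu; apply/(approxIP m1 m2).
Qed.

Lemma W10OP r y : W10O r y <-> W1O r y /\ approxO y.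
Proof.
by split=> -[Wu tu]; split=> //; have [m1 m2 m3] := W1O_meas Wu;
  apply/(approxOP m1 m2 m3).
Qed.

Lemma LfunI_1 r (f : R -> R) : (1 <= r)%E -> f \in Lfun muI r -> f \in Lfun muI 1.
Proof. by move=> r1 Lf; have [] := Lfun1_le_Lnorm (@muI_setT R) r1 Lf. Qed.

Lemma LfunO_1 r (f : R * R -> R) : (1 <= r)%E ->
  f \in Lfun muO r -> f \in Lfun muO 1.
Proof. by move=> r1 Lf; have [] := Lfun1_le_Lnorm (@muO_setT R) r1 Lf. Qed.

Lemma test_funI_bounded (phi : R -> R) : test_fun itvI phi ->
  exists2 M, 0 <= M &
  [/\ measurable_fun setT (phi : measurableTypeR R -> R), forall x, `|phi x| <= M,
      measurable_fun setT (derive1 phi : measurableTypeR R -> R) &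
      forall x, `|derive1 phi x| <= M].
Proof.
move=> tphi; have [M M0 [b1 b2]] := test_fun_bounded tphi (1 : R).
have [c1 c2] := test_fun_continuous tphi.
have dE : derive1 phi = 'D_1 phi by apply/funext => t; rewrite derive1E.
exists M; first exact: M0.
rewrite dE; split.
- exact: (continuous_measurable_fun c1).
- exact: b1.
- exact: (continuous_measurable_fun (c2 1)).
- exact: b2.
Qed.

Lemma test_funO_bounded (phi : R * R -> R) (d : R * R) : test_fun Omega phi ->
  exists2 M, 0 <= M &
  [/\ measurable_fun setT (phi : measurableTypeR R * measurableTypeR R -> R),
      forall x, `|phi x| <= M,
      measurable_fun setT ('D_d phi : measurableTypeR R * measurableTypeR R -> R) &
      forall x, `|'D_d phi x| <= M].
Proof.
move=> tphi; have [M M0 [b1 b2]] := test_fun_bounded tphi d.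
have [c1 c2] := test_fun_continuous tphi.
exists M; first exact: M0.
split.
- exact: (continuous_measurable_prod c1).
- exact: b1.
- exact: (continuous_measurable_prod (c2 d)).
- exact: b2.
Qed.

Lemma W1I_lincomb r (a : R) u w : (1 <= r)%E -> W1I r u -> W1I r w ->
  W1I r (a *: u + w).
Proof.
move=> r1 [u1 u2 wu] [w1 w2 ww]; split; [exact: (Lfun_lincomb a r1 u1 w1)|
  exact: (Lfun_lincomb a r1 u2 w2)|].
move=> phi tphi; have [M M0 [m1 b1 m2 b2]] := test_funI_bounded tphi.
by apply: (weak_pairing_lincomb a m2 b2 m1 b1 (LfunI_1 r1 u1) (LfunI_1 r1 u2)
  (LfunI_1 r1 w1) (LfunI_1 r1 w2)); [exact: wu|exact: ww].
Qed.

Lemma W1O_lincomb r (a : R) y z : (1 <= r)%E -> W1O r y -> W1O r z ->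
  W1O r (a *: y + z).
Proof.
move=> r1 [y1 y2 y3 wy] [z1 z2 z3 wz]; split; [exact: (Lfun_lincomb a r1 y1 z1)|
  exact: (Lfun_lincomb a r1 y2 z2)|exact: (Lfun_lincomb a r1 y3 z3)|].
move=> phi tphi; have [hy1 hy2] := wy _ tphi; have [hz1 hz2] := wz _ tphi.
have [M M0 [m1 b1 m2 b2]] := test_funO_bounded (1, 0) tphi.
have [M' M0' [m1' b1' m2' b2']] := test_funO_bounded (0, 1) tphi.
split.
- exact: (weak_pairing_lincomb a m2 b2 m1 b1 (LfunO_1 r1 y1) (LfunO_1 r1 y2)
    (LfunO_1 r1 z1) (LfunO_1 r1 z2) hy1 hz1).
- exact: (weak_pairing_lincomb a m2' b2' m1' b1' (LfunO_1 r1 y1) (LfunO_1 r1 y3)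
    (LfunO_1 r1 z1) (LfunO_1 r1 z3) hy2 hz2).
Qed.

Lemma W10I_lincomb r (a : R) u w : (1 <= r)%E -> W10I r u -> W10I r w ->
  W10I r (a *: u + w).
Proof.
move=> r1 /W10IP[Wu au] /W10IP[Ww aw]; apply/W10IP; split.
  exact: W1I_lincomb.
by apply: approxI_lincomb => //; [exact: W1I_meas Wu|exact: W1I_meas Ww].
Qed.

Lemma W10O_lincomb r (a : R) y z : (1 <= r)%E -> W10O r y -> W10O r z ->
  W10O r (a *: y + z).
Proof.
move=> r1 /W10OP[Wu au] /W10OP[Ww aw]; apply/W10OP; split.
  exact: W1O_lincomb.
by apply: approxO_lincomb => //; [exact: W1O_meas Wu|exact: W1O_meas Ww].
Qed.

(** Trace and weak derivative pass to L^1 limits; the exponent r enters through the integrability of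
    the limit itself. *)
Lemma W10I_closed r u : (1 <= r)%E -> u.1 \in Lfun muI r -> u.2 \in Lfun muI r ->
  (forall e, 0 < e -> exists w,
    [/\ W10I r w, L1near muI e w.1 u.1 & L1near muI e w.2 u.2]) -> W10I r u.
Proof.
move=> r1 u1 u2 H.
have mu : measI u by split; [exact: Lfun_measurable u1|exact: Lfun_measurable u2].
apply/W10IP; split; last first.
  apply: approxI_closed => // e /H[w [/W10IP[Ww aw] n1 n2]].
  by exists w; split=> //; exact: W1I_meas Ww.
split=> // phi tphi; have [M M0 [m1 b1 m2 b2]] := test_funI_bounded tphi.
apply: (weak_pairing_closed M0 m2 b2 m1 b1 (LfunI_1 r1 u1) (LfunI_1 r1 u2)).
move=> e /H[w [[[w1 w2 ww] _] n1 n2]].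
by exists w.1, w.2; split=> //; [exact: LfunI_1 w1|exact: LfunI_1 w2|exact: ww].
Qed.

Lemma W10O_closed r y : (1 <= r)%E -> y.1 \in Lfun muO r ->
  y.2.1 \in Lfun muO r -> y.2.2 \in Lfun muO r ->
  (forall e, 0 < e -> exists z,
    [/\ W10O r z, L1near muO e z.1 y.1, L1near muO e z.2.1 y.2.1 &
        L1near muO e z.2.2 y.2.2]) -> W10O r y.
Proof.
move=> r1 y1 y2 y3 H.
have my : measO y by split;
  [exact: Lfun_measurable y1|exact: Lfun_measurable y2|exact: Lfun_measurable y3].
apply/W10OP; split; last first.
  apply: approxO_closed => // e /H[w [/W10OP[Ww aw] n1 n2 n3]].
  by exists w; split=> //; exact: W1O_meas Ww.
split=> // phi tphi; split.
- have [M M0 [m1 b1 m2 b2]] := test_funO_bounded (1, 0) tphi.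
  apply: (weak_pairing_closed M0 m2 b2 m1 b1 (LfunO_1 r1 y1) (LfunO_1 r1 y2)).
  move=> e /H[w [[[w1 w2 w3 ww] _] n1 n2 n3]].
  by exists w.1, w.2.1; split=> //;
    [exact: LfunO_1 w1|exact: LfunO_1 w2|exact: (ww _ tphi).1].
- have [M M0 [m1 b1 m2 b2]] := test_funO_bounded (0, 1) tphi.
  apply: (weak_pairing_closed M0 m2 b2 m1 b1 (LfunO_1 r1 y1) (LfunO_1 r1 y3)).
  move=> e /H[w [[[w1 w2 w3 ww] _] n1 n2 n3]].
  by exists w.1, w.2.2; split=> //;
    [exact: LfunO_1 w1|exact: LfunO_1 w3|exact: (ww _ tphi).2].
Qed.

Lemma Lfun0 d (T : measurableType d) (mu : {measure set T -> \bar R}) r :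
  (1 <= r)%E -> (0 : T -> R) \in Lfun mu r.
Proof.
move=> r1; apply: LfunI; first exact: measurable_cst.
by rewrite (_ : EFin \o 0 = cst 0%E)// Lnorm0 ?ltry// gt_eqF// (lt_le_trans _ r1).
Qed.

Lemma C1_0 (V : normedModType R) : C1 (0 : V -> R).
Proof.
split=> [x|w]; first exact: differentiable_cst.
rewrite (_ : 'D_w 0 = cst 0); first exact: cst_continuous.
by apply/funext => x; exact: derive_cst.
Qed.

Lemma W10I0 r : (1 <= r)%E -> W10I r 0.
Proof.
move=> r1; apply/W10IP; split.
  split; [exact: Lfun0..|move=> phi _].
  under eq_Rintegral do rewrite mul0r.
  rewrite [X in - X](_ : _ = \int[muI]_x 0).
    by rewrite Rintegral_cst// mul0r oppr0.
  by apply: eq_Rintegral => x _; rewrite mul0r.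
move=> e e0; exists 0; split; rewrite ?normr0 ?ltW//; first exact: C1_0.
- rewrite /L1near subrr (_ : EFin \o 0 = cst 0%E)// Lnorm0 ?oner_eq0//.
  by rewrite lee_fin ltW.
- rewrite (_ : derive1 0 = 0); last first.
    by apply/funext => x; rewrite derive1E; exact: derive_cst.
  rewrite /L1near subrr (_ : EFin \o 0 = cst 0%E)// Lnorm0 ?oner_eq0//.
  by rewrite lee_fin ltW.
Qed.

End SobolevSpaces.

Lemma half_pow_small (R : realType) (C e : R) : 0 < e ->
  exists n : nat, C / 2 ^+ n <= e.
Proof.
move=> e0; have h : `|2^-1 : R| < 1 by rewrite gtr0_norm// invf_lt1// ltr1n.
have h1 := @cvg_geometric R C _ h.
have : \forall n \near \oo, `|geometric C 2^-1 n| <= e.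
  by move/cvgr0_norm_le : h1; exact.
move=> /filter_ex[n hn]; exists n; apply: le_trans hn.
by rewrite /geometric/= exprVn ler_norm.
Qed.

(** * Completeness of the zero-trace spaces *)

Section Completeness.
Context {R : realType}.
Local Notation muI := (@muI R).
Local Notation muO := (@muO R).
Implicit Types (u w : jetI R) (y z : jetO R).

Lemma Lnorm_oo_leP d (T : measurableType d) (mu : {measure set T -> \bar R})
    (f : T -> R) (K : R) : mu setT = 1%E ->
  ('N[mu]_+oo[EFin \o f] <= K%:E)%E <-> {ae mu, forall x, `|f x| <= K}.
Proof.
move=> mu1; rewrite unlock mu1 lte01; split=> [/ess_supP|h].
  by apply: filterS => x /=; rewrite lee_fin.
by apply/ess_supP; apply: filterS h => x /=; rewrite lee_fin.
Qed.

Lemma snormIE r u : W1I r u -> (snormI r u)%:E = ('N[muI]_r[EFin \o u.2])%E.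
Proof. by move=> [_ u2 _]; rewrite fineK// Lfun_fin_num. Qed.

Lemma snormI_ge0 r u : 0 <= snormI r u.
Proof. by rewrite fine_ge0 ?Lnorm_ge0. Qed.

Lemma snormO_ge0 r y : 0 <= snormO r y.
Proof. by rewrite fine_ge0 ?Lnorm_ge0. Qed.

Lemma Lfun_enorm_grad (r : R) y : 1 <= r -> y.2.1 \in Lfun muO r%:E ->
  y.2.2 \in Lfun muO r%:E -> enorm \o grad y \in Lfun muO r%:E.
Proof.
move=> r1 y2 y3.
have m2 := Lfun_measurable y2; have m3 := Lfun_measurable y3.
apply: LfunI; first exact: measurable_enorm_grad.
have [_ _ h] := @Lnorm_grad_le _ r%:E y r1 m2 m3.
by apply: le_lt_trans h _; apply: lte_add_pinfty; exact: Lfun_lty.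
Qed.

Lemma snormOE (r : R) y : 1 <= r -> y.2.1 \in Lfun muO r%:E ->
  y.2.2 \in Lfun muO r%:E ->
  (snormO r%:E y)%:E = ('N[muO]_r%:E[EFin \o (enorm \o grad y)])%E.
Proof. by move=> r1 y2 y3; rewrite fineK// Lfun_fin_num// Lfun_enorm_grad. Qed.

Lemma W10I_oo_bounds u : W10I +oo%E u ->
  {ae muI, forall t, 2 * `|u.1 t| <= snormI +oo%E u} /\
  {ae muI, forall t, `|u.2 t| <= snormI +oo%E u}.
Proof.
move=> /W10IP[Wu au]; have h := snormIE Wu.
have mu := W1I_meas Wu; split; last first.
  by apply/(Lnorm_oo_leP _ _ (@muI_setT R)); rewrite h.
apply: filterS (poincareI_ae mu au) => t ht.
rewrite -lee_fin h; apply: (le_trans ht).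
exact: (le_Lnorm1_Lnorm (@muI_setT R) (leey _) mu.2).
Qed.

Lemma W10I_1_bound (s : jetI R) : W10I 1%E s ->
  {ae muI, forall t, 2 * `|s.1 t| <= snormI 1%E s}.
Proof.
move=> /W10IP[Wu au]; have h := snormIE Wu.
apply: filterS (poincareI_ae (W1I_meas Wu) au) => t ht.
by rewrite -lee_fin h.
Qed.

(** The hypothesis controls derivatives only. Poincaré's inequality transfers the geometric decay to
    the functions, and completeness of L^oo then applies to each component of the jet. *)
Lemma W10I_complete (u : nat -> jetI R) (C : R) : 0 <= C ->
  (forall n, W10I +oo%E (u n)) ->
  (forall n, snormI +oo%E (u n.+1 - u n) <= C / 2 ^+ n) ->
  exists2 w, W10I +oo%E w & forall n, snormI +oo%E (w - u n) <= 2 * C / 2 ^+ n.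
Proof.
move=> C0 Wu uC.
have oo1 : (1 <= +oo :> \bar R)%E by rewrite leey.
have Wsub n : W10I +oo%E (u n.+1 - u n).
  by rewrite addrC -scaleN1r; exact: W10I_lincomb.
have b1 n : ('N[muI]_+oo[EFin \o ((u n.+1).1 - (u n).1)%R] <= (C / 2 ^+ n)%:E)%E.
  apply/(Lnorm_oo_leP _ _ (@muI_setT R)).
  apply: filterS (W10I_oo_bounds (Wsub n)).1 => t ht.
  apply: le_trans (uC n); apply: le_trans ht.
  by rewrite ler_peMl// ler1n.
have b2 n : ('N[muI]_+oo[EFin \o ((u n.+1).2 - (u n).2)%R] <= (C / 2 ^+ n)%:E)%E.
  apply: le_trans (_ : (_ <= (snormI +oo%E (u n.+1 - u n))%:E)%E) _; last first.
    by rewrite lee_fin.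
  by rewrite (snormIE (Wsub n).1).
have [g1 [L1 c1 _]] := Lp_fast_cauchy_cvg (@muI_setT R) oo1 C0
  (fun n => let: And3 h _ _ := (Wu n).1 in h) b1.
have [g2 [L2 c2 _]] := Lp_fast_cauchy_cvg (@muI_setT R) oo1 C0
  (fun n => let: And3 _ h _ := (Wu n).1 in h) b2.
have Wg : W10I +oo%E (g1, g2).
  apply: W10I_closed => // e e0.
  have [n hn] := half_pow_small (2 * C) e0.
  have [[m1 m2 _] _] := Wu n.
  exists (u n); split => //; apply: L1near_sym.
  - apply: le_trans (le_trans (c1 n) _); last by rewrite lee_fin.
    apply: (le_Lnorm1_Lnorm (@muI_setT R) oo1).
    exact: measurable_funB (Lfun_measurable L1) (Lfun_measurable m1).
  - apply: le_trans (le_trans (c2 n) _); last by rewrite lee_fin.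
    apply: (le_Lnorm1_Lnorm (@muI_setT R) oo1).
    exact: measurable_funB (Lfun_measurable L2) (Lfun_measurable m2).
exists (g1, g2) => // n.
have Wd : W10I +oo%E ((g1, g2) - u n).
  by rewrite addrC -scaleN1r; exact: W10I_lincomb.
by rewrite -lee_fin (snormIE Wd.1); exact: c2.
Qed.

(** The factor 4 is 2 from the geometric tail times 2 from bounding the Euclidean norm of the
    gradient by the sum of its components. *)
Lemma W10O_complete (p : R) (y : nat -> jetO R) (C : R) : 1 <= p -> 0 <= C ->
  (forall n, W10O p%:E (y n)) ->
  (forall n, snormO p%:E (y n.+1 - y n) <= C / 2 ^+ n) ->
  exists2 z, W10O p%:E z & forall n, snormO p%:E (z - y n) <= 4 * C / 2 ^+ n.
Proof.
move=> p1 C0 Wy yC.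
have pE1 : (1 <= p%:E)%E by rewrite lee_fin.
have Wsub n : W10O p%:E (y n.+1 - y n).
  by rewrite addrC -scaleN1r; exact: W10O_lincomb.
have bS n : ('N[muO]_p%:E[EFin \o (enorm \o grad (y n.+1 - y n)%R)] <= (C / 2 ^+ n)%:E)%E.
  have [[d1 d2 d3 _] _] := Wsub n.
  by rewrite -(snormOE p1 d2 d3) lee_fin.
have bG n := let: And4 d1 d2 d3 _ := (Wsub n).1 in
  @Lnorm_grad_le _ p%:E (y n.+1 - y n) pE1 (Lfun_measurable d2) (Lfun_measurable d3).
have b2 n : ('N[muO]_p%:E[EFin \o ((y n.+1).2.1 - (y n).2.1)%R] <= (C / 2 ^+ n)%:E)%E.
  by have [h _ _] := bG n; exact: le_trans h (bS n).
have b3 n : ('N[muO]_p%:E[EFin \o ((y n.+1).2.2 - (y n).2.2)%R] <= (C / 2 ^+ n)%:E)%E.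
  by have [_ h _] := bG n; exact: le_trans h (bS n).
have b1 n : ('N[muO]_p%:E[EFin \o ((y n.+1).1 - (y n).1)%R] <= (C / 2 ^+ n)%:E)%E.
  apply: le_trans (b2 n).
  have /W10OP[Wd ad] := Wsub n.
  exact: (poincareO p1 (W1O_meas Wd) ad).
have [g1 [L1 c1 _]] := Lp_fast_cauchy_cvg (@muO_setT R) pE1 C0
  (fun n => let: And4 h _ _ _ := (Wy n).1 in h) b1.
have [g2 [L2 c2 _]] := Lp_fast_cauchy_cvg (@muO_setT R) pE1 C0
  (fun n => let: And4 _ h _ _ := (Wy n).1 in h) b2.
have [g3 [L3 c3 _]] := Lp_fast_cauchy_cvg (@muO_setT R) pE1 C0
  (fun n => let: And4 _ _ h _ := (Wy n).1 in h) b3.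
have near (g h : R * R -> R) (e K : R) : g \in Lfun muO p%:E -> h \in Lfun muO p%:E ->
    K <= e -> ('N[muO]_p%:E[EFin \o (g - h)%R] <= K%:E)%E -> L1near muO e h g.
  move=> Lg Lh Ke gh; apply: L1near_sym.
  apply: le_trans (le_trans gh _); last by rewrite lee_fin.
  apply: (le_Lnorm1_Lnorm (@muO_setT R) pE1).
  exact: (measurable_funB (Lfun_measurable Lg) (Lfun_measurable Lh)).
have Wg : W10O p%:E (g1, (g2, g3)).
  apply: (@W10O_closed R p%:E (g1, (g2, g3)) pE1 L1 L2 L3) => e e0.
  have [n hn] := half_pow_small (2 * C) e0.
  have [[m1 m2 m3 _] _] := Wy n.
  exists (y n); split; first exact: Wy.
  - exact: near L1 m1 hn (c1 n).
  - exact: near L2 m2 hn (c2 n).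
  - exact: near L3 m3 hn (c3 n).
exists (g1, (g2, g3)) => // n.
have [[d1 d2 d3 _] _] : W10O p%:E ((g1, (g2, g3)) - y n).
  by rewrite addrC -scaleN1r; exact: W10O_lincomb.
rewrite -lee_fin (snormOE p1 d2 d3).
have [_ _ h] := @Lnorm_grad_le _ p%:E ((g1, (g2, g3)) - y n) pE1
  (Lfun_measurable d2) (Lfun_measurable d3).
apply: (le_trans h).
have -> : 4 * C / 2 ^+ n = 2 * C / 2 ^+ n + 2 * C / 2 ^+ n by ring.
by rewrite EFinD; apply: leeD; [exact: c2|exact: c3].
Qed.

End Completeness.

(** * The coefficient matrix and its derivatives *)

Section MatrixBounds.
Context {R : realType}.
Implicit Types (M N : 'M[R]_2) (a b : 'cV[R]_2) (c : R).

(** A bound on the bilinear form rather than on [opnorm]: this is what [BO] consumes, and it adds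
    and scales without handling a supremum. *)
Definition mxbd c M := forall a b, `|dotv (M *m a) b| <= c * enorm a * enorm b.

Lemma dotvDl a a' b : dotv (a + a') b = dotv a b + dotv a' b.
Proof. by rewrite !dotvE !mxE; ring. Qed.

Lemma dotvZl c a b : dotv (c *: a) b = c * dotv a b.
Proof. by rewrite !dotvE !mxE; ring. Qed.

Lemma dotvDr a b b' : dotv a (b + b') = dotv a b + dotv a b'.
Proof. by rewrite !dotvE !mxE; ring. Qed.

Lemma dotvZr c a b : dotv a (c *: b) = c * dotv a b.
Proof. by rewrite !dotvE !mxE; ring. Qed.

Lemma dotv_mulmxE M a b : dotv (M *m a) b =
  (M 0 0 * a 0 0 + M 0 1 * a 1 0) * b 0 0 + (M 1 0 * a 0 0 + M 1 1 * a 1 0) * b 1 0.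
Proof.
have E i : (M *m a) i 0 = M i 0 * a 0 0 + M i 1 * a 1 0.
  rewrite mxE 2!big_ord_recl big_ord0 addr0.
  by congr (_ + M _ _ * a _ _); apply/val_inj.
by rewrite dotvE !E.
Qed.

Lemma mxbd_le c c' M : c <= c' -> mxbd c M -> mxbd c' M.
Proof.
move=> cc' h a b; apply: le_trans (h a b) _.
by rewrite ler_wpM2r ?enorm_ge0// ler_wpM2r ?enorm_ge0.
Qed.

Lemma mxbdZ (k : R) c M : mxbd c M -> mxbd (`|k| * c) (k *: M).
Proof.
by move=> h a b; rewrite -scalemxAl dotvZl normrM -!mulrA ler_wpM2l// mulrA.
Qed.

Lemma mxbd_entries c M : (forall i j, `|M i j| <= c) -> mxbd (4 * c) M.
Proof.
move=> h a b; have c0 : 0 <= c by apply: le_trans (h 0 0).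
rewrite dotv_mulmxE !mulrDl.
have H i j (x y : R) : `|x| <= enorm a -> `|y| <= enorm b ->
    `|M i j * x * y| <= c * enorm a * enorm b.
  by move=> xa yb; rewrite !normrM; do 2?apply: ler_pM => //; rewrite ?mulr_ge0.
have h1 := H 0 0 _ _ (le_enorm0 a) (le_enorm0 b).
have h2 := H 0 1 _ _ (le_enorm1 a) (le_enorm0 b).
have h3 := H 1 0 _ _ (le_enorm0 a) (le_enorm1 b).
have h4 := H 1 1 _ _ (le_enorm1 a) (le_enorm1 b).
apply: le_trans (ler_normD _ _) _.
have := lerD (le_trans (ler_normD _ _) (lerD h1 h2))
  (le_trans (ler_normD _ _) (lerD h3 h4)).
by move=> /le_trans; apply; lra.
Qed.

Lemma enorm_eq0 a : enorm a = 0 -> a = 0.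
Proof.
move=> a0; apply/colP => i; rewrite mxE; apply/eqP; rewrite -normr_le0 -a0.
by case: i => -[|[|//]] i; [rewrite (_ : Ordinal i = 0)|rewrite (_ : Ordinal i = 1)];
  rewrite ?le_enorm0 ?le_enorm1//; apply/val_inj.
Qed.

Lemma mxbd_opnorm M : mxbd (opnorm M) M.
Proof.
have Mle a : enorm a = 1 -> enorm (M *m a) <= opnorm M.
  move=> a1; apply: ub_le_sup; last by exists a.
  (* [ub_le_sup] asks for boundedness of the set of norms; the entrywise bound with second vector
     [M *m d] supplies it. *)
  pose C := \big[Num.max/0]_(ij : 'I_2 * 'I_2) `|M ij.1 ij.2|.
  have MC i j : `|M i j| <= C by exact: (le_bigmax _ _ (i, j)).
  have C4 := mxbd_entries MC.
  exists (4 * C) => _ [d /= d1 <-].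
  have := C4 d (M *m d); rewrite d1 mulr1 -/(dotv _ _).
  rewrite ger0_norm; last by rewrite dotvE addr_ge0// -expr2 sqr_ge0.
  have -> : dotv (M *m d) (M *m d) = enorm (M *m d) ^+ 2.
    by rewrite enorm_sqr dotvE !expr2.
  have [->|n0] := eqVneq (enorm (M *m d)) 0.
    by rewrite mulr_ge0// (le_trans (normr_ge0 _) (MC 0 0)).
  by rewrite expr2 ler_pM2r// lt_neqAle eq_sym n0 enorm_ge0.
move=> a b; have [a0|a0] := eqVneq (enorm a) 0.
  rewrite a0 mulr0 mul0r (enorm_eq0 a0) mulmx0 dotvE !mxE !mul0r addr0.
  by rewrite normr0.
apply: le_trans (cauchy_schwarz_dotv _ _) _.
rewrite ler_wpM2r ?enorm_ge0//.
have ap : 0 < enorm a by rewrite lt_neqAle eq_sym a0 enorm_ge0.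
pose a' := (enorm a)^-1 *: a.
have a'1 : enorm a' = 1 by rewrite enormZ ger0_norm ?invr_ge0 ?enorm_ge0// mulVf.
have -> : M *m a = enorm a *: (M *m a').
  by rewrite /a' -scalemxAr scalerA mulfV// scale1r.
by rewrite enormZ ger0_norm ?enorm_ge0// mulrC ler_wpM2r ?enorm_ge0// Mle.
Qed.

End MatrixBounds.

Section Coefficient.
Context {R : realType}.
Implicit Types (g h : jetI R) (x : R * R).

Lemma mx22P (M : 'M[R]_2) (a b c d : R) :
  M 0 0 = a -> M 0 1 = b -> M 1 0 = c -> M 1 1 = d -> M = mx22 a b c d.
Proof.
move=> <- <- <- <-; apply/matrixP => i j; rewrite mxE.
by case: i => -[|[|//]] i; case: j => -[|[|//]] j;
  rewrite /=; congr (M _ _); apply/val_inj.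
Qed.

(** One rule for every entry: along a line, entries of A have degree at most 2 over degree at most
    1, and those of DA degree at most 2 over degree at most 2. The quadratic coefficients do not
    affect the derivative at 0. *)
Lemma derive1_quot (n0 n1 n2 a k l : R) : a != 0 ->
  derive1 (fun t => (n0 + n1 * t + n2 * t ^+ 2) / (a + k * t + l * t ^+ 2)) 0
  = n1 / a - n0 * k / a ^+ 2.
Proof.
move=> a0; rewrite /derive1.
pose Dn (h : R) := a + k * h + l * h ^+ 2.
(* The difference quotient with the factor h cancelled: it is continuous at 0, where its value is
   the derivative. *)
pose q (h : R) := ((n1 + n2 * h) * a - n0 * (k + l * h)) * (a * Dn h)^-1.
have aff (c d : R) : c + d * h @[h --> (0 : R)] --> c + d * 0.
  by apply: cvgD; [exact: cvg_cst|apply: cvgMr; exact: cvg_id].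
have cDn : Dn h @[h --> (0 : R)] --> a.
  have -> : a = a + k * 0 + l * (0 * 0) by rewrite !mulr0 !addr0.
  apply: cvgD; first exact: aff.
  apply: cvgMr; under eq_fun do rewrite expr2.
  by apply: cvgM; exact: cvg_id.
have cq : q h @[h --> (0 : R)] --> q 0.
  rewrite /q /Dn !mulr0 expr0n mulr0 !addr0.
  apply: cvgM.
    apply: cvgB.
      by apply: cvgMl; have := aff n1 n2; rewrite mulr0 addr0.
    by apply: cvgMr; have := aff k l; rewrite mulr0 addr0.
  apply: cvgV; first by rewrite mulf_neq0.
  exact: cvgMr cDn.
have -> : n1 / a - n0 * k / a ^+ 2 = q 0.
  by rewrite /q /Dn !mulr0 expr0n mulr0 !addr0; field.
have nD : \forall h \near (0 : R), Dn h != 0 by move/cvgr_neq0 : cDn; exact.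
apply: cvg_lim => //.
have cq' : q h @[h --> (0 : R)^'] --> q 0 by exact: cvg_within_filter cq.
apply: cvg_trans cq'.
apply: near_eq_cvg; near=> h.
have h0 : h != 0 by near: h; exact: nbhs_dnbhs_neq.
have Dh0 : Dn h != 0.
  by near: h; exact: nbhs_dnbhs nD.
rewrite /= addr0 /q /Dn mulr0 expr0n mulr0 !mulr0 !addr0.
rewrite -[RHS]/(h^-1 * _) -/(Dn h).
have E : n0 + n1 * h + n2 * h ^+ 2 - n0 / a * Dn h =
    h / a * ((n1 + n2 * h) * a - n0 * (k + l * h)) by rewrite /Dn; field.
rewrite -[n0 + _ + _](subrK (n0 / a * Dn h)) E.
by field; rewrite a0 h0 Dh0.
Unshelve. all: by end_near. Qed.

End Coefficient.

Section CoefficientDerivatives.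
Context {R : realType}.
Implicit Types (g h : jetI R) (x : R * R).

(* In terms of a = 1 + gamma, S = gamma' x_2, H = h, L = h' x_2. *)
Definition dA22 (a S H L : R) : R := 2 * S * L / a - (1 + S ^+ 2) * H / a ^+ 2.

Definition d2A22 (a S H L K M : R) : R :=
  2 * L * M / a - 2 * S * L * K / a ^+ 2 - 2 * S * M * H / a ^+ 2
  + 2 * (1 + S ^+ 2) * H * K / a ^+ 3.

Lemma AcoefE g x : Acoef g x = mx22 (1 + g.1 x.1) (- (g.2 x.1 * x.2))
  (- (g.2 x.1 * x.2)) ((1 + (g.2 x.1 * x.2) ^+ 2) / (1 + g.1 x.1)).
Proof. by []. Qed.

Lemma derive1_affine (c k : R) : derive1 (fun t => c + k * t) 0 = k.
Proof.
have := @derive1_quot R c k 0 1 0 0 (oner_neq0 _).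
rewrite !mulr0 !mul0r subr0 divr1 => E; rewrite -[RHS]E; congr (derive1 _ 0).
by apply/funext => t; rewrite !mul0r !addr0 divr1.
Qed.

Lemma DAE g h x : 1 + g.1 x.1 != 0 ->
  DA g h x = mx22 (h.1 x.1) (- (h.2 x.1 * x.2)) (- (h.2 x.1 * x.2))
    (dA22 (1 + g.1 x.1) (g.2 x.1 * x.2) (h.1 x.1) (h.2 x.1 * x.2)).
Proof.
move=> a0; set a := 1 + _ in a0 *.
have E01 : derive1 (fun t : R => - ((g.2 x.1 + t * h.2 x.1) * x.2)) 0
    = - (h.2 x.1 * x.2).
  rewrite -[RHS](derive1_affine (- (g.2 x.1 * x.2)) (- (h.2 x.1 * x.2))).
  by congr (derive1 _ 0); apply/funext => t; ring.
apply: mx22P; rewrite mxE.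
- rewrite -[RHS](derive1_affine (1 + g.1 x.1) (h.1 x.1)).
  congr (derive1 _ 0); apply/funext => t; rewrite mxE /=.
  by rewrite -[LHS]/(1 + (g.1 x.1 + t * h.1 x.1)); ring.
- by rewrite -E01; congr (derive1 _ 0); apply/funext => t; rewrite mxE.
- by rewrite -E01; congr (derive1 _ 0); apply/funext => t; rewrite mxE.
- have := @derive1_quot R (1 + (g.2 x.1 * x.2) ^+ 2)
    (2 * (g.2 x.1 * x.2) * (h.2 x.1 * x.2)) ((h.2 x.1 * x.2) ^+ 2)
    a (h.1 x.1) 0 a0.
  rewrite -/(dA22 a (g.2 x.1 * x.2) (h.1 x.1) (h.2 x.1 * x.2)) => E; rewrite -[RHS]E.
  congr (derive1 _ 0); apply/funext => t; rewrite mxE /=.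
  rewrite -[LHS]/((1 + ((g.2 x.1 + t * h.2 x.1) * x.2) ^+ 2) /
    (1 + (g.1 x.1 + t * h.1 x.1))).
  by congr (_ / _); rewrite /a; ring.
Qed.

Lemma D2AE g h1 h2 x : 1 + g.1 x.1 != 0 ->
  D2A g h1 h2 x = mx22 0 0 0
    (d2A22 (1 + g.1 x.1) (g.2 x.1 * x.2) (h1.1 x.1) (h1.2 x.1 * x.2)
       (h2.1 x.1) (h2.2 x.1 * x.2)).
Proof.
move=> a0; set a := 1 + _ in a0 *.
set S := g.2 x.1 * x.2; set H := h1.1 x.1; set L := h1.2 x.1 * x.2.
set K := h2.1 x.1; set M := h2.2 x.1 * x.2.
(* The closed form of [DA] holds for small t, which suffices for a derivative at 0. *)
have nz : \forall t \near (0 : R), 1 + (g + t *: h2).1 x.1 != 0.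
  have c : (1 + (g + t *: h2).1 x.1) @[t --> (0 : R)] --> a.
    rewrite (_ : a = a + 0 * K); last by rewrite mul0r addr0.
    under eq_fun => t do rewrite -[1 + _]/(1 + (g.1 x.1 + t * K)) addrA.
    by apply: cvgD; [exact: cvg_cst|apply: cvgMl; exact: cvg_id].
  by move/cvgr_neq0 : c; exact.
have E (i j : 'I_2) : D2A g h1 h2 x i j = derive1 (fun t : R =>
    mx22 H (- L) (- L) (dA22 (a + K * t) (S + M * t) H L) i j) 0.
  rewrite mxE !derive1E; apply: near_eq_derive.
  apply: filterS nz => t /DAE ->.
  congr (mx22 _ _ _ _ i j); rewrite /dA22.
  rewrite -[(g + t *: h2).1 x.1]/(g.1 x.1 + t * K).
  rewrite -[(g + t *: h2).2 x.1]/(g.2 x.1 + t * h2.2 x.1).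
  have -> : 1 + (g.1 x.1 + t * K) = a + K * t by rewrite /a; ring.
  by have -> : (g.2 x.1 + t * h2.2 x.1) * x.2 = S + M * t by rewrite /S /M; ring.
have C (c : R) : derive1 (fun _ : R => c) 0 = 0.
  by rewrite derive1E; exact: derive_cst.
apply: mx22P; rewrite E.
- by rewrite (_ : (fun t => _) = fun=> H) ?C//; apply/funext => t; rewrite mxE.
- by rewrite (_ : (fun t => _) = fun=> - L) ?C//; apply/funext => t; rewrite mxE.
- by rewrite (_ : (fun t => _) = fun=> - L) ?C//; apply/funext => t; rewrite mxE.
(* Both fractions of [dA22] over the common denominator (a + K t)^2, the shape expected by
   [derive1_quot]. *)
rewrite (_ : (fun t => _) = fun t => ((2 * S * L * a - (1 + S ^+ 2) * H)
    + ((2 * M * L * a + 2 * S * L * K) - 2 * S * M * H) * t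
    + (2 * M * L * K - M ^+ 2 * H) * t ^+ 2)
    / (a ^+ 2 + 2 * a * K * t + K ^+ 2 * t ^+ 2)).
  rewrite derive1_quot ?expf_neq0//.
  by rewrite /d2A22; field.
apply/funext => t; rewrite mxE /= /dA22.
have -> : a ^+ 2 + 2 * a * K * t + K ^+ 2 * t ^+ 2 = (a + K * t) ^+ 2 by ring.
(* Division by zero gives 0, so the two forms agree even where the denominator vanishes. *)
have [->|z] := eqVneq (a + K * t) 0.
  by rewrite expr0n /= invr0 !mulr0 subr0.
by field.
Qed.

End CoefficientDerivatives.

(** * Pointwise Taylor estimates for the coefficients *)

Section TaylorBounds.
Context {R : realType}.
Implicit Types (a d S T H L m n p q : R).

Lemma absM (x y A B : R) : `|x| <= A -> `|y| <= B -> `|x * y| <= A * B.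
Proof. by move=> xA yB; rewrite normrM ler_pM. Qed.

Lemma absD (x y A B : R) : `|x| <= A -> `|y| <= B -> `|x + y| <= A + B.
Proof. by move=> xA yB; apply: le_trans (ler_normD _ _) _; rewrite lerD. Qed.

Lemma absN (x A : R) : `|x| <= A -> `|- x| <= A.
Proof. by rewrite normrN. Qed.

Lemma abs_nat (k : nat) : `|k%:R : R| <= k%:R.
Proof. by rewrite ger0_norm. Qed.

Lemma abs_one_sqr S : `|S| <= 1 -> `|1 + S ^+ 2| <= 2.
Proof.
move=> S1; have := absD (abs_nat 1) (absM S1 S1); rewrite -expr2 => /le_trans.
by apply; lra.
Qed.

Lemma abs_inv a : 2^-1 <= a -> `|a^-1| <= 2.
Proof.
move=> a2; have a0 : 0 < a by apply: lt_le_trans a2; rewrite invr_gt0.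
by rewrite gtr0_norm ?invr_gt0// -[2]invrK lef_pV2// posrE invr_gt0.
Qed.

Lemma half_le_neq0 a : 2^-1 <= a -> a != 0.
Proof. by move=> a2; rewrite gt_eqF// (lt_le_trans _ a2)// invr_gt0. Qed.

(** Replaces every atom by its bound in the context. The constants 12, 26, 52 and 156 below are the
    resulting values when 1/a, 1/(a + d) and 1 + S^2 are bounded by 2 and S, S + T by 1. *)
Ltac absbound := lazymatch goal with
  | H : is_true (`|?x| <= _) |- is_true (`|?x| <= _) => exact: H
  | |- is_true (`|_ + _| <= _) => apply: absD; absbound
  | |- is_true (`|- _| <= _) => apply: absN; absbound
  | |- is_true (`|_ * _| <= _) => apply: absM; absbound
  | |- is_true (`|_%:R| <= _) => exact: abs_nat
  end.

Section Pointwise.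
Variables (a d S T m : R).
Hypotheses (a2 : 2^-1 <= a) (b2 : 2^-1 <= a + d) (S1 : `|S| <= 1)
  (ST1 : `|S + T| <= 1) (dm : `|d| <= m) (Tm : `|T| <= m).

Let a0 : a != 0 := half_le_neq0 a2.
Let b0 : a + d != 0 := half_le_neq0 b2.
Let pb : `|a^-1| <= 2 := abs_inv a2.
Let qb : `|(a + d)^-1| <= 2 := abs_inv b2.
Let Nb : `|1 + S ^+ 2| <= 2 := abs_one_sqr S1.

Lemma A22_lipschitz :
  `|(1 + (S + T) ^+ 2) / (a + d) - (1 + S ^+ 2) / a| <= 12 * m.
Proof.
have -> : (1 + (S + T) ^+ 2) / (a + d) - (1 + S ^+ 2) / a =
  - ((1 + S ^+ 2) * d * a^-1 * (a + d)^-1) + T * (S + (S + T)) * (a + d)^-1.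
  by field; rewrite a0 b0.
by apply: le_trans; [absbound|lra].
Qed.

(** The identity is arranged so that every term carries two factors among d and T; no cancellation
    is left, and absolute values can be taken term by term. The Lipschitz estimates follow the same
    scheme with at least one such factor per term. *)
Lemma A22_taylor :
  `|(1 + (S + T) ^+ 2) / (a + d) - (1 + S ^+ 2) / a - dA22 a S d T|
  <= 26 * m ^+ 2.
Proof.
have -> : (1 + (S + T) ^+ 2) / (a + d) - (1 + S ^+ 2) / a - dA22 a S d T =
  (1 + S ^+ 2) * d * d * a^-1 * a^-1 * (a + d)^-1
  - 2 * S * T * d * a^-1 * (a + d)^-1 + T * T * (a + d)^-1.
  by rewrite /dA22; field; rewrite a0 b0.
by apply: le_trans; [absbound|lra].
Qed.

Variables (H L n : R).
Hypotheses (Hn : `|H| <= n) (Ln : `|L| <= n).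

Lemma dA22_lipschitz :
  `|dA22 (a + d) (S + T) H L - dA22 a S H L| <= 52 * m * n.
Proof.
have -> : dA22 (a + d) (S + T) H L - dA22 a S H L =
  2 * T * L * (a + d)^-1 - 2 * S * L * d * a^-1 * (a + d)^-1
  + H * ((1 + S ^+ 2) * d * a^-1 * (a + d)^-1 * (a^-1 + (a + d)^-1)
         - T * (S + (S + T)) * (a + d)^-1 * (a + d)^-1).
  by rewrite /dA22; field; rewrite a0 b0.
by apply: le_trans; [absbound|lra].
Qed.

Lemma dA22_taylor :
  `|dA22 (a + d) (S + T) H L - dA22 a S H L - d2A22 a S H L d T|
  <= 156 * m ^+ 2 * n.
Proof.
have -> : dA22 (a + d) (S + T) H L - dA22 a S H L - d2A22 a S H L d T =
  - (2 * T * L * d * a^-1 * (a + d)^-1)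
  + 2 * S * L * d * d * a^-1 * a^-1 * (a + d)^-1
  - H * ((1 + S ^+ 2) * d * d * a^-1 * a^-1 * (a + d)^-1
            * ((a + d)^-1 + 2 * a^-1)
         - 2 * S * T * d * a^-1 * (a + d)^-1 * ((a + d)^-1 + a^-1)
         + T * T * (a + d)^-1 * (a + d)^-1).
  by rewrite /dA22 /d2A22; field; rewrite a0 b0.
by apply: le_trans; [absbound|lra].
Qed.

End Pointwise.
End TaylorBounds.

(** * Bounded matrix fields and the form [BO] *)

Section BoundedFields.
Context {R : realType}.
Local Notation muI := (@muI R).
Local Notation muO := (@muO R).
Local Notation RR := (measurableTypeR R * measurableTypeR R)%type.
Implicit Types (M N : R * R -> 'M[R]_2) (c k : R) (y z : jetO R).

(* The coefficient fields are only equal almost everywhere to measurable ones: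
   where 1 + gamma vanishes, DA and D2A are derivatives of a junk quotient. *)
Definition bfield c M := [/\ 0 <= c,
  exists M', (forall i j, measurable_fun setT (fun x : RR => M' x i j)) /\
             {ae muO, forall x, M x = M' x} &
  {ae muO, forall x, mxbd c (M x)}].

(** All that [BO] sees of a Sobolev function. It also covers v and the extensions E zeta, which are
    not in the zero-trace space. *)
Definition gradL (r : R) y := y.2.1 \in Lfun muO r%:E /\ y.2.2 \in Lfun muO r%:E.

Lemma gradL_W1O r y : W1O r%:E y -> gradL r y.
Proof. by case. Qed.

Lemma gradL_lincomb r k y z : 1 <= r -> gradL r y -> gradL r z ->
  gradL r (k *: y + z).
Proof.
move=> r1 [y1 y2] [z1 z2].
have rE1 : (1 <= r%:E)%E by rewrite lee_fin.
split.
- exact: (Lfun_lincomb k rE1 y1 z1).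
- exact: (Lfun_lincomb k rE1 y2 z2).
Qed.

Variables p q : R.
Hypotheses (p1 : 1 < p) (q1 : 1 < q) (pq : p^-1 + q^-1 = 1).

Definition BOint y z M (x : R * R) : R := dotv (M x *m grad y x) (grad z x).

(** The integrand itself may fail to be measurable, so bounds and linearity are drawn from the
    version [F] built on the measurable representative of [M]. Hölder's inequality makes it
    integrable. *)
Lemma BOint_bound c M y z : bfield c M -> gradL p y -> gradL q z ->
  exists F : RR -> R, [/\ F \in Lfun muO 1, {ae muO, forall x, BOint y z M x = F x} &
    \int[muO]_x `|F x| <= c * snormO p%:E y * snormO q%:E z].
Proof.
move=> [c0 [M' [mM eM]] bM] [y1 y2] [z1 z2].
have Ly := Lfun_enorm_grad (ltW p1) y1 y2; have Lz := Lfun_enorm_grad (ltW q1) z1 z2.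
pose F (x : RR) := dotv (M' x *m grad y x) (grad z x).
have eF : {ae muO, forall x, BOint y z M x = F x}.
  by apply: filterS eM => x ex; rewrite /BOint /F ex.
have mF : measurable_fun setT F.
  have -> : F = fun x => (M' x 0 0 * y.2.1 x + M' x 0 1 * y.2.2 x) * z.2.1 x
      + (M' x 1 0 * y.2.1 x + M' x 1 1 * y.2.2 x) * z.2.2 x.
    by apply/funext => x; rewrite /F dotv_mulmxE !grad0 !grad1.
  have m1 := Lfun_measurable y1; have m2 := Lfun_measurable y2.
  have m3 := Lfun_measurable z1; have m4 := Lfun_measurable z2.
  have T (i j : 'I_2) (f : RR -> R) : measurable_fun setT f ->
      measurable_fun setT (fun x => M' x i j * f x).
    by move=> mf; exact: (measurable_funM (mM i j) mf).
  exact: (measurable_funD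
    (measurable_funM (measurable_funD (T 0 0 _ m1) (T 0 1 _ m2)) m3)
    (measurable_funM (measurable_funD (T 1 0 _ m1) (T 1 1 _ m2)) m4)).
have [Lyz yz] := hoelder_Lfun p1 q1 pq Ly Lz.
pose D : RR -> R := c *: ((enorm \o grad y) \* (enorm \o grad z)) + 0.
have LD : D \in Lfun muO 1.
  by apply: Lfun_lincomb => //; exact: Lfun0.
have FD : {ae muO, forall x, `|F x| <= `|D x|}.
  apply: filterS2 eM bM => x ex bx.
  apply: (@le_trans _ _ (D x)); last exact: ler_norm.
  rewrite /D -[leRHS]/(c * (enorm (grad y x) * enorm (grad z x)) + 0) addr0 mulrA.
  by rewrite /F -ex; exact: bx.
have LF : F \in Lfun muO 1 by apply: Lfun_dominated FD.
exists F; split => //.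
have DE : \int[muO]_x `|D x| = c * \int[muO]_x `|(enorm (grad y x) * enorm (grad z x))|.
  rewrite -RintegralZl//.
    apply: eq_Rintegral => x _.
    rewrite /D -[X in `|X| = _]/(c * (enorm (grad y x) * enorm (grad z x)) + 0).
    by rewrite addr0 normrM (ger0_norm c0).
  exact: (Lfun1_int (Lfun_norm Lyz)).
apply: (@le_trans _ _ (\int[muO]_x `|D x|)).
  rewrite !Lfun1_norm// fine_le ?Lfun_fin_num//.
  exact: (le_Lnorm_ae (lexx _) mF (Lfun_measurable LD) FD).
by rewrite DE -mulrA ler_wpM2l.
Qed.

Lemma BO_bound c M y z : bfield c M -> gradL p y -> gradL q z ->
  `|BO y z M| <= c * snormO p%:E y * snormO q%:E z.
Proof.
move=> hM hy hz; have [F [LF eF bF]] := BOint_bound hM hy hz.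
apply: le_trans bF.
have -> : BO y z M = \int[muO]_x F x.
  by congr fine; apply: ae_eq_integral_nomeas; apply: filterS eF => x ex; congr EFin.
exact: (le_normr_Rintegral measurableT (Lfun1_int LF)).
Qed.

Lemma Rintegral_lincomb_ae (f g h : RR -> R) (k : R) (f' g' : RR -> R) :
  f' \in Lfun muO 1 -> g' \in Lfun muO 1 ->
  {ae muO, forall x, f x = f' x} -> {ae muO, forall x, g x = g' x} ->
  {ae muO, forall x, h x = k * f x + g x} ->
  \int[muO]_x h x = k * \int[muO]_x f x + \int[muO]_x g x.
Proof.
move=> Lf Lg ef eg eh.
have i1 := Lfun1_int Lf; have i2 := Lfun1_int Lg.
have E (u u' : RR -> R) : {ae muO, forall x, u x = u' x} ->
    \int[muO]_x u x = \int[muO]_x u' x.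
  by move=> e; congr fine; apply: ae_eq_integral_nomeas; apply: filterS e => x /= ->.
rewrite (E _ _ ef) (E _ _ eg) -RintegralZl// -RintegralD//; last first.
  exact: (integrableZl measurableT k i1).
apply: E; apply: filterS3 ef eg eh => x -> ->; exact.
Qed.

Lemma BO_lincombl k c M y y' z : bfield c M -> gradL p y -> gradL p y' ->
  gradL q z -> BO (k *: y + y') z M = k * BO y z M + BO y' z M.
Proof.
move=> hM hy hy' hz.
have [F [LF eF _]] := BOint_bound hM hy hz.
have [F' [LF' eF' _]] := BOint_bound hM hy' hz.
apply: (Rintegral_lincomb_ae LF LF' eF eF'); apply: nearW => x.
by rewrite /BOint grad_lincomb mulmxDr -scalemxAr dotvDl dotvZl.
Qed.

Lemma BO_lincombr k c M y z z' : bfield c M -> gradL p y -> gradL q z ->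
  gradL q z' -> BO y (k *: z + z') M = k * BO y z M + BO y z' M.
Proof.
move=> hM hy hz hz'.
have [F [LF eF _]] := BOint_bound hM hy hz.
have [F' [LF' eF' _]] := BOint_bound hM hy hz'.
apply: (Rintegral_lincomb_ae LF LF' eF eF'); apply: nearW => x.
by rewrite /BOint grad_lincomb dotvDr dotvZr.
Qed.

Lemma BO_lincombM k c c' M N L y z : bfield c M -> bfield c' N ->
  gradL p y -> gradL q z -> {ae muO, forall x, L x = k *: M x + N x} ->
  BO y z L = k * BO y z M + BO y z N.
Proof.
move=> hM hN hy hz eL.
have [F [LF eF _]] := BOint_bound hM hy hz.
have [F' [LF' eF' _]] := BOint_bound hN hy hz.
apply: (Rintegral_lincomb_ae LF LF' eF eF'); apply: filterS eL => x ->.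
by rewrite /BOint mulmxDl -scalemxAl dotvDl dotvZl.
Qed.

Lemma snormO_lincomb r k y z : 1 <= r -> gradL r y -> gradL r z ->
  snormO r%:E (k *: y + z) <= `|k| * snormO r%:E y + snormO r%:E z.
Proof.
move=> r1 hy hz; have hyz := gradL_lincomb k r1 hy hz.
have Ly := Lfun_enorm_grad r1 hy.1 hy.2; have Lz := Lfun_enorm_grad r1 hz.1 hz.2.
rewrite -lee_fin EFinD EFinM (snormOE r1 hyz.1 hyz.2) (snormOE r1 hy.1 hy.2).
rewrite (snormOE r1 hz.1 hz.2) -[`|k|%R]normr_id -Lnorm_scale//.
apply: le_trans (eminkowski muO _ _ _) => //; last first.
- exact: (Lfun_measurable Lz).
- exact: (measurable_funM (measurable_cst _) (Lfun_measurable Ly)).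
apply: le_Lnorm_ae => //.
- exact: (Lfun_measurable (Lfun_enorm_grad r1 hyz.1 hyz.2)).
- exact: (measurable_funD (measurable_funM (measurable_cst _)
    (Lfun_measurable Ly)) (Lfun_measurable Lz)).
apply: nearW => x /=; rewrite ger0_norm ?enorm_ge0// grad_lincomb.
apply: le_trans (ler_norm _); apply: le_trans (enormD _ _) _.
by rewrite enormZ.
Qed.

End BoundedFields.

Section CoefficientFields.
Context {R : realType}.
Local Notation muI := (@muI R).
Local Notation muO := (@muO R).
Local Notation RR := (measurableTypeR R * measurableTypeR R)%type.
Implicit Types (g h d e : jetI R).

Lemma snormI_lincomb (r : \bar R) (k : R) g h : (1 <= r)%E -> W1I r g -> W1I r h ->
  snormI r (k *: g + h) <= `|k| * snormI r g + snormI r h.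
Proof.
move=> r1 Wg Wh; have Wgh := W1I_lincomb k r1 Wg Wh.
have [_ Lg _] := Wg; have [_ Lh _] := Wh.
rewrite -lee_fin EFinD EFinM (snormIE Wgh) (snormIE Wg) (snormIE Wh) -Lnorm_scale//.
apply: (eminkowski muI _ _ r1); last exact: (Lfun_measurable Lh).
exact: (measurable_funM (measurable_cst _) (Lfun_measurable Lg)).
Qed.

Lemma snormI_scale (r : \bar R) (k : R) g : (1 <= r)%E -> W1I r g ->
  snormI r (k *: g) = `|k| * snormI r g.
Proof.
move=> r1 Wg; have [_ Lg _] := Wg.
have Wkg : W1I r (k *: g).
  by rewrite -[k *: g]addr0; apply: W1I_lincomb => //; case: (@W10I0 R r r1).
by apply: EFin_inj; rewrite EFinM (snormIE Wg) (snormIE Wkg) -Lnorm_scale.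
Qed.

(** At s = 0 the second inf-sup inequality says 0 <= alpha times a supremum, which fails if no
    nonzero test function exists, since the empty supremum is -oo. The direction obtained makes the
    suprema in [coef_bound] nonnegative. *)
Lemma unit_direction (kappa alpha : R) : 0 < alpha -> infsupG kappa alpha ->
  exists2 h : jetI R, W10I +oo%E h & snormI +oo%E h = 1.
Proof.
move=> a0 [_ /(_ 0 (W10I0 (lexx _)))] H.
have [z [Wz nz]] : exists z, W10I +oo%E z /\ ~ eqI z (0 : jetI R).
  apply: contrapT => /forallNP none.
  suff E : [set z | W10I +oo%E z /\ ~ eqI z (0 : jetI R)] = set0.
    by move: H; rewrite E image_set0 ereal_sup0 gt0_muleNy ?lte_fin.
  by rewrite -subset0 => z hz; exact: (none z).
have sz : snormI +oo%E z != 0.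
  apply/eqP => z0; apply: nz; rewrite /eqI.
  apply: filterS (W10I_oo_bounds Wz).1 => t; rewrite z0 => h _ /=.
  by apply/eqP; rewrite -normr_le0; have := normr_ge0 (z.1 t); lra.
exists ((snormI +oo%E z)^-1 *: z).
  by rewrite -[_ *: z]addr0; apply: W10I_lincomb; rewrite ?leey//; exact: W10I0 (leey _).
rewrite snormI_scale ?leey//; last by case: Wz.
by rewrite ger0_norm ?invr_ge0 ?snormI_ge0// mulVf.
Qed.

Definition adm g := W10I +oo%E g /\ state_constraint g.

Definition good g (x : R * R) :=
  2^-1 <= 1 + g.1 x.1 /\ `|g.2 x.1 * x.2| <= 1.

(** The factor 2 in the Poincaré inequality turns |gamma'| <= 1 into |gamma| <= 1/2, and 0 < x_2 < 1
    handles the slope. *)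
Lemma ae_good g : adm g -> {ae muO, forall x, good g x}.
Proof.
move=> [Wg sg]; have s1 : snormI +oo%E g <= 1.
  rewrite -lee_fin (snormIE Wg.1); exact/(Lnorm_oo_leP _ _ (@muI_setT R)).
have h1 := ae_muO_fst (W10I_oo_bounds Wg).1; have h2 := ae_muO_fst sg.
apply: filterS3 h1 h2 (ae_muO_snd ae_itvI) => x hx1 hx2 /andP[x0 x1]; split.
  have h : 2 * `|g.1 x.1| <= 1 by exact: le_trans hx1 s1.
  have := ler_norm (- g.1 x.1); rewrite normrN; lra.
rewrite -[1]mulr1; apply: absM => //.
by rewrite ger0_norm ltW.
Qed.

Lemma ae_jet_bound d : W10I +oo%E d ->
  {ae muO, forall x, `|d.1 x.1| <= snormI +oo%E d /\
                     `|d.2 x.1 * x.2| <= snormI +oo%E d}.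
Proof.
move=> Wd; have [b1 b2] := W10I_oo_bounds Wd.
apply: filterS3 (ae_muO_fst b1) (ae_muO_fst b2) (ae_muO_snd ae_itvI).
move=> x hx1 hx2 /andP[x0 x1]; split.
  by have := normr_ge0 (d.1 x.1); lra.
rewrite -[leRHS]mulr1; apply: absM => //.
by rewrite ger0_norm ltW.
Qed.

Lemma good_neq0 g x : good g x -> 1 + g.1 x.1 != 0.
Proof. by move=> [h _]; exact: half_le_neq0. Qed.

Section Measurability.
Variable g : jetI R.
Hypothesis mg : measI g.

Let mfst (f : R -> R) : measurable_fun setT (f : measurableTypeR R -> R) ->
  measurable_fun setT (fun x : RR => f x.1).
Proof. by move=> mf; exact: (measurableT_comp mf measurable_fst). Qed.

(** The point 0, where the inverse is discontinuous, is split off. *)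
Lemma measurable_invr : measurable_fun setT (fun t : measurableTypeR R => t^-1).
Proof.
have -> : [set: measurableTypeR R] = [set 0] `|` ~` [set 0] by rewrite setUv.
apply/measurable_funU; [exact: measurable_set1| |split].
- by apply: measurableC; exact: measurable_set1.
- exact: measurable_fun_set1.
apply: open_continuous_measurable_fun.
  by apply: closed_openC; exact: (compact_closed (@Rhausdorff R) (@compact_set1 _ _)).
by move=> t; rewrite inE => /= t0; apply: inv_continuous; apply/eqP.
Qed.

Definition jet_slope (h : jetI R) (x : R * R) : R := h.2 x.1 * x.2.
Definition jet_inv (x : R * R) : R := (1 + g.1 x.1)^-1.

Lemma measurable_jet1 h : measI h -> measurable_fun setT (fun x : RR => h.1 x.1).
Proof. by move=> [m1 _]; exact: mfst. Qed.

Lemma measurable_jet_slope h : measI h -> measurable_fun setT (jet_slope h : RR -> R).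
Proof. by move=> [_ m2]; exact: (measurable_funM (mfst m2) measurable_snd). Qed.

Lemma measurable_jet_inv : measurable_fun setT (jet_inv : RR -> R).
Proof.
apply: (measurableT_comp measurable_invr).
exact: (measurable_funD (measurable_cst _) (measurable_jet1 mg)).
Qed.

Lemma measurable_mx22 (a b c d : RR -> R) : measurable_fun setT a ->
  measurable_fun setT b -> measurable_fun setT c -> measurable_fun setT d ->
  forall i j, measurable_fun setT (fun x => mx22 (a x) (b x) (c x) (d x) i j).
Proof.
move=> ma mb mc md i j; under eq_fun do rewrite mxE.
by case: (i == 0); case: (j == 0).
Qed.

End Measurability.

End CoefficientFields.

(** * Bounds for A, DA and D2A as matrix fields *)

Section CoefficientBounds.
Context {R : realType}.
Local Notation muI := (@muI R).
Local Notation muO := (@muO R).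
Local Notation RR := (measurableTypeR R * measurableTypeR R)%type.
Implicit Types (g h d e : jetI R).

Definition meas_field (M : R * R -> 'M[R]_2) :=
  exists M' : R * R -> 'M[R]_2,
    (forall i j, measurable_fun setT (fun x : RR => M' x i j)) /\
             {ae muO, forall x, M x = M' x}.

Lemma bfieldI c (M : R * R -> 'M[R]_2) : 0 <= c -> meas_field M ->
  {ae muO, forall x, mxbd c (M x)} -> bfield c M.
Proof. by move=> c0 hM hc; split. Qed.

Lemma meas_field_lincomb (k : R) (M N : R * R -> 'M[R]_2) :
  meas_field M -> meas_field N -> meas_field (fun x => k *: M x + N x).
Proof.
move=> [M' [mM eM]] [N' [mN eN]]; exists (fun x => k *: M' x + N' x); split.
  move=> i j; under eq_fun do rewrite !mxE.
  exact: (measurable_funD (measurable_funM (measurable_cst _) (mM i j)) (mN i j)).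
by apply: filterS2 eM eN => x -> ->.
Qed.

Lemma meas_fieldB (M N : R * R -> 'M[R]_2) :
  meas_field M -> meas_field N -> meas_field (fun x => M x - N x).
Proof.
move=> hM hN; have := meas_field_lincomb (-1) hN hM.
by congr meas_field; apply/funext => x; rewrite scaleN1r addrC.
Qed.

Lemma Acoef_meas g : adm g -> meas_field (Acoef g).
Proof.
move=> [Wg _]; have mg := W1I_meas Wg.1.
exists (Acoef g); split; last exact: nearW.
have mS := measurable_jet_slope mg.
have m1 : measurable_fun setT (fun x : RR => 1 + g.1 x.1).
  exact: (measurable_funD (measurable_cst _) (measurable_jet1 mg)).
have m2 : measurable_fun setT (fun x : RR => - (g.2 x.1 * x.2)).
  exact: (measurableT_comp (@oppr_measurable R _) mS).
apply: (measurable_mx22 m1 m2 m2).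
exact: (measurable_funM (measurable_funD (measurable_cst _)
  (measurable_funX 2 mS)) (measurable_jet_inv mg)).
Qed.

Lemma DA_meas g h : adm g -> W10I +oo%E h -> meas_field (DA g h).
Proof.
move=> ag Wh; have mg := W1I_meas ag.1.1; have mh := W1I_meas Wh.1.
exists (fun x => mx22 (h.1 x.1) (- (jet_slope h x)) (- (jet_slope h x))
    (2 * jet_slope g x * jet_slope h x * jet_inv g x
     - (1 + jet_slope g x ^+ 2) * h.1 x.1 * jet_inv g x ^+ 2)); split; last first.
  apply: filterS (ae_good ag) => x gx.
  by rewrite (DAE _ (good_neq0 gx)) /dA22 /jet_slope /jet_inv exprVn.
have mS := measurable_jet_slope mg; have mT := measurable_jet_slope mh.
have mI := measurable_jet_inv mg; have mH := measurable_jet1 mh.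
have m2 : measurable_fun setT (fun x : RR => - (jet_slope h x)).
  exact: (measurableT_comp (@oppr_measurable R _) mT).
apply: (measurable_mx22 mH m2 m2).
exact: (measurable_funB
  (measurable_funM (measurable_funM (measurable_funM (measurable_cst _) mS) mT) mI)
  (measurable_funM (measurable_funM (measurable_funD (measurable_cst _)
    (measurable_funX 2 mS)) mH) (measurable_funX 2 mI))).
Qed.

Lemma D2A_meas g h d : adm g -> W10I +oo%E h -> W10I +oo%E d ->
  meas_field (D2A g h d).
Proof.
move=> ag Wh Wd; have mg := W1I_meas ag.1.1; have mh := W1I_meas Wh.1.
have md := W1I_meas Wd.1.
pose S := jet_slope g; pose L := jet_slope h; pose M := jet_slope d.
pose I := jet_inv g.
exists (fun x => mx22 0 0 0
    (2 * L x * M x * I x - 2 * S x * L x * d.1 x.1 * I x ^+ 2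
     - 2 * S x * M x * h.1 x.1 * I x ^+ 2
     + 2 * (1 + S x ^+ 2) * h.1 x.1 * d.1 x.1 * I x ^+ 3)); split; last first.
  apply: filterS (ae_good ag) => x gx.
  by rewrite (D2AE _ _ (good_neq0 gx)) /d2A22 /I /jet_inv !exprVn.
have mS : measurable_fun setT (S : RR -> R) := measurable_jet_slope mg.
have mL : measurable_fun setT (L : RR -> R) := measurable_jet_slope mh.
have mM : measurable_fun setT (M : RR -> R) := measurable_jet_slope md.
have mI : measurable_fun setT (I : RR -> R) := measurable_jet_inv mg.
have mH := measurable_jet1 mh; have mK := measurable_jet1 md.
have mc (c : R) : measurable_fun setT (fun _ : RR => c) by exact: measurable_cst.
have m3 (a b c : RR -> R) : measurable_fun setT a -> measurable_fun setT b ->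
    measurable_fun setT c -> measurable_fun setT (fun x => 2 * a x * b x * c x).
  move=> ma mb mc'.
  exact: (measurable_funM (measurable_funM (measurable_funM (mc 2) ma) mb) mc').
apply: measurable_mx22; [exact: mc..|].
exact: (measurable_funD (measurable_funB (measurable_funB (m3 _ _ _ mL mM mI)
  (measurable_funM (m3 _ _ _ mS mL mK) (measurable_funX 2 mI)))
  (measurable_funM (m3 _ _ _ mS mM mH) (measurable_funX 2 mI)))
  (measurable_funM (m3 _ _ _ (measurable_funD (mc 1) (measurable_funX 2 mS)) mH mK)
    (measurable_funX 3 mI))).
Qed.

Lemma mxbd_mx22 (c a0 a1 a2 a3 : R) : `|a0| <= c -> `|a1| <= c -> `|a2| <= c ->
  `|a3| <= c -> mxbd (4 * c) (mx22 a0 a1 a2 a3).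
Proof.
by move=> h0 h1 h2 h3; apply: mxbd_entries => i j; rewrite mxE;
  case: (i == 0); case: (j == 0).
Qed.

Lemma mx22B (a b c d a' b' c' d' : R) :
  mx22 a b c d - mx22 a' b' c' d' = mx22 (a - a') (b - b') (c - c') (d - d').
Proof. by apply/matrixP => i j; rewrite !mxE; case: (i == 0); case: (j == 0). Qed.

Lemma mx22_lincomb (k a b c d a' b' c' d' : R) :
  k *: mx22 a b c d + mx22 a' b' c' d' =
  mx22 (k * a + a') (k * b + b') (k * c + c') (k * d + d').
Proof. by apply/matrixP => i j; rewrite !mxE; case: (i == 0); case: (j == 0). Qed.

Lemma DA_lincomb g h d (k : R) (x : R * R) : good g x ->
  DA g (k *: h + d) x = k *: DA g h x + DA g d x.
Proof.
move=> gx; have a0 := good_neq0 gx; rewrite !DAE// mx22_lincomb.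
rewrite -[(k *: h + d).1 x.1]/(k * h.1 x.1 + d.1 x.1).
rewrite -[(k *: h + d).2 x.1]/(k * h.2 x.1 + d.2 x.1).
by congr mx22; rewrite ?/dA22; [ring|ring|field].
Qed.

Lemma D2A_sym g h d (x : R * R) : good g x -> D2A g h d x = D2A g d h x.
Proof.
move=> gx; have a0 := good_neq0 gx; rewrite !D2AE//.
by congr mx22; rewrite /d2A22; field.
Qed.

Lemma D2A_lincomb g h d e (k : R) (x : R * R) : good g x ->
  D2A g h (k *: d + e) x = k *: D2A g h d x + D2A g h e x.
Proof.
move=> gx; have a0 := good_neq0 gx; rewrite !D2AE// mx22_lincomb.
rewrite -[(k *: d + e).1 x.1]/(k * d.1 x.1 + e.1 x.1).
rewrite -[(k *: d + e).2 x.1]/(k * d.2 x.1 + e.2 x.1).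
by congr mx22; rewrite ?/d2A22; [ring|ring|ring|field].
Qed.

Section Taylor.
Variables g g' : jetI R.
Hypotheses (ag : adm g) (ag' : adm g').
Let d := g' - g.
Let m := snormI +oo%E d.

Lemma Wsub : W10I +oo%E d.
Proof.
rewrite /d addrC -scaleN1r; apply: W10I_lincomb; first by rewrite leey.
  exact: ag.1.
exact: ag'.1.
Qed.

Let pt (x : R * R) : good g x -> good g' x ->
  let a := 1 + g.1 x.1 in let S := g.2 x.1 * x.2 in
  let T := d.2 x.1 * x.2 in
  [/\ 2^-1 <= a, 2^-1 <= a + d.1 x.1, `|S| <= 1 & `|S + T| <= 1] /\
  (1 + g'.1 x.1 = a + d.1 x.1 /\ g'.2 x.1 * x.2 = S + T).
Proof.
move=> [g1 g2] [g1' g2'] a S T.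
have E1 : 1 + g'.1 x.1 = a + d.1 x.1.
  by rewrite /a -[d.1 x.1]/(g'.1 x.1 - g.1 x.1); ring.
have E2 : g'.2 x.1 * x.2 = S + T.
  by rewrite /S /T -[d.2 x.1]/(g'.2 x.1 - g.2 x.1); ring.
by split; split; rewrite -?E1 -?E2.
Qed.

(** The field constants 48, 104, 208 and 624 are four times the pointwise ones, the factor 4 coming
    from [mxbd_entries]. *)
Lemma A_lipschitz_field : bfield (48 * m) (fun x => Acoef g' x - Acoef g x).
Proof.
have m0 : 0 <= m by exact: snormI_ge0.
apply: bfieldI; first by rewrite mulr_ge0.
  by apply: meas_fieldB; exact: Acoef_meas.
apply: filterS3 (ae_good ag) (ae_good ag') (ae_jet_bound Wsub) => x gx gx' [d1 d2].
have [[a2 b2 S1 ST1] [E1 E2]] := pt gx gx'.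
rewrite !AcoefE mx22B E1 E2 (_ : 48 * m = 4 * (12 * m)); last by ring.
have le12 (t : R) : `|t| <= m -> `|t| <= 12 * m by move=> /le_trans; apply; lra.
apply: mxbd_mx22.
- by apply: le12; rewrite addrAC subrr add0r.
- by apply: le12; rewrite opprD addrAC subrr add0r normrN.
- by apply: le12; rewrite opprD addrAC subrr add0r normrN.
- exact: A22_lipschitz.
Qed.

Lemma A_taylor_field :
  bfield (104 * m ^+ 2) (fun x => Acoef g' x - Acoef g x - DA g d x).
Proof.
have m0 : 0 <= m by exact: snormI_ge0.
apply: bfieldI; first by rewrite mulr_ge0// sqr_ge0.
  apply: meas_fieldB; last exact: (DA_meas ag Wsub).
  by apply: meas_fieldB; exact: Acoef_meas.
apply: filterS3 (ae_good ag) (ae_good ag') (ae_jet_bound Wsub) => x gx gx' [d1 d2].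
have [[a2 b2 S1 ST1] [E1 E2]] := pt gx gx'.
rewrite !AcoefE (DAE _ (good_neq0 gx)) !mx22B E1 E2.
rewrite (_ : 104 * m ^+ 2 = 4 * (26 * m ^+ 2)); last by ring.
have z : `|0 : R| <= 26 * m ^+ 2 by rewrite normr0 mulr_ge0// sqr_ge0.
apply: mxbd_mx22; last exact: A22_taylor.
- by rewrite (_ : _ - _ - _ = 0)//; ring.
- by rewrite (_ : _ - _ - _ = 0)//; ring.
- by rewrite (_ : _ - _ - _ = 0)//; ring.
Qed.

Variable h : jetI R.
Hypothesis Wh : W10I +oo%E h.
Let n := snormI +oo%E h.

Lemma DA_lipschitz_field : bfield (208 * m * n) (fun x => DA g' h x - DA g h x).
Proof.
have m0 : 0 <= m by exact: snormI_ge0.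
have n0 : 0 <= n by exact: snormI_ge0.
apply: bfieldI; first by rewrite !mulr_ge0.
  by apply: meas_fieldB; exact: DA_meas.
apply: filterS3 (filterI (ae_good ag) (ae_good ag')) (ae_jet_bound Wsub)
  (ae_jet_bound Wh) => x [gx gx'] [d1 d2] [h1 h2].
have [[a2 b2 S1 ST1] [E1 E2]] := pt gx gx'.
rewrite (DAE _ (good_neq0 gx)) (DAE _ (good_neq0 gx')) mx22B E1 E2.
rewrite (_ : 208 * m * n = 4 * (52 * m * n)); last by ring.
by apply: mxbd_mx22; rewrite ?subrr ?normr0 ?mulr_ge0//; exact: dA22_lipschitz.
Qed.

Lemma DA_taylor_field : bfield (624 * m ^+ 2 * n)
  (fun x => DA g' h x - DA g h x - D2A g h d x).
Proof.
have m0 : 0 <= m by exact: snormI_ge0.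
have n0 : 0 <= n by exact: snormI_ge0.
have m20 : 0 <= m ^+ 2 by exact: sqr_ge0.
have K0 (k : nat) : 0 <= k%:R * m ^+ 2 * n.
  by apply: mulr_ge0 n0; apply: mulr_ge0 m20; exact: ler0n.
apply: bfieldI; first exact: K0.
  apply: meas_fieldB; last exact: (D2A_meas ag Wh Wsub).
  by apply: meas_fieldB; exact: DA_meas.
apply: filterS3 (filterI (ae_good ag) (ae_good ag')) (ae_jet_bound Wsub)
  (ae_jet_bound Wh) => x [gx gx'] [d1 d2] [h1 h2].
have [[a2 b2 S1 ST1] [E1 E2]] := pt gx gx'.
rewrite (DAE _ (good_neq0 gx)) (DAE _ (good_neq0 gx')) (D2AE _ _ (good_neq0 gx)).
rewrite !mx22B E1 E2.
rewrite (_ : 624 * m ^+ 2 * n = 4 * (156 * m ^+ 2 * n)); last by ring.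
apply: mxbd_mx22; last exact: dA22_taylor.
- by rewrite subrr subr0 normr0 K0.
- by rewrite subrr subr0 normr0 K0.
- by rewrite subrr subr0 normr0 K0.
Qed.

End Taylor.

Section UniformBounds.
Variables (kappa alpha CA : R).
Hypotheses (hCA : coef_bound CA) (a0 : 0 < alpha) (hG : infsupG kappa alpha).

(** A bound on the sum of three terms bounds each one because the others are nonnegative; for the
    suprema this is where a unit direction is used. *)
Lemma coef_bound_parts g : adm g -> [/\ (Linfty (Acoef g) <= CA%:E)%E,
  forall h, W10I +oo%E h -> snormI +oo%E h = 1 -> (Linfty (DA g h) <= CA%:E)%E &
  forall h d, W10I +oo%E h -> snormI +oo%E h = 1 -> W10I +oo%E d ->
    snormI +oo%E d = 1 -> (Linfty (D2A g h d) <= CA%:E)%E].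
Proof.
move=> [Wg sg]; have := hCA Wg sg; rewrite /=.
set dirs := [set h | _]; set X := Linfty _; set Y := ereal_sup _.
set Z := ereal_sup _.
have [h0 Wh0 sh0] := unit_direction a0 hG.
have Y0 : (0 <= Y)%E.
  apply: (@le_trans _ _ (Linfty (DA g h0))); first exact: Lnorm_ge0.
  by apply: ereal_sup_ubound; exists h0.
have Z0 : (0 <= Z)%E.
  apply: (@le_trans _ _ (Linfty (D2A g h0 h0))); first exact: Lnorm_ge0.
  by apply: ereal_sup_ubound; exists (h0, h0).
have X0 : (0 <= X)%E by exact: Lnorm_ge0.
move=> H; split.
- by apply: le_trans H; rewrite -addeA leeDl// adde_ge0.
- move=> h Wh sh; apply: (@le_trans _ _ Y).
    by apply: ereal_sup_ubound; exists h.
  by apply: le_trans H; rewrite addeAC leeDr// adde_ge0.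
- move=> h d Wh sh Wd sd; apply: (@le_trans _ _ Z).
    by apply: ereal_sup_ubound; exists (h, d).
  by apply: le_trans H; rewrite leeDr// adde_ge0.
Qed.

Lemma Linfty_mxbd (M : R * R -> 'M[R]_2) (c : R) : (Linfty M <= c%:E)%E ->
  {ae muO, forall x, mxbd c (M x)}.
Proof.
move/(Lnorm_oo_leP _ _ (@muO_setT R)); apply: filterS => x hx.
by apply: mxbd_le (mxbd_opnorm _); apply: le_trans hx; exact: ler_norm.
Qed.

Lemma CA_ge0 : 0 <= CA.
Proof.
have a : adm (0 : jetI R).
  split; first by apply: W10I0; rewrite leey.
  by apply: nearW => t; rewrite normr0.
have [h _ _] := coef_bound_parts a.
by rewrite -lee_fin; apply: le_trans h; exact: Lnorm_ge0.
Qed.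

Lemma A_bfield g : adm g -> bfield CA (Acoef g).
Proof.
move=> ag; have [h _ _] := coef_bound_parts ag.
apply: bfieldI; [exact: CA_ge0|exact: Acoef_meas|exact: Linfty_mxbd].
Qed.

Lemma normalize h : W10I +oo%E h -> snormI +oo%E h != 0 ->
  exists e, [/\ W10I +oo%E e, snormI +oo%E e = 1 &
    h = snormI +oo%E h *: e + 0].
Proof.
move=> Wh sh; exists ((snormI +oo%E h)^-1 *: h); split.
- by rewrite -[_ *: h]addr0; apply: W10I_lincomb; rewrite ?leey//;
    apply: W10I0; rewrite leey.
- by rewrite snormI_scale ?leey//; [rewrite ger0_norm ?invr_ge0 ?snormI_ge0// mulVf|
    exact: Wh.1].
- by rewrite addr0 scalerA mulfV// scale1r.
Qed.

Lemma DA0 g (x : R * R) : good g x -> DA g 0 x = 0.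
Proof.
move=> gx; rewrite (DAE _ (good_neq0 gx)) /=; apply/matrixP => i j; rewrite !mxE /dA22.
by rewrite !mul0r !mulr0 !mul0r subr0 oppr0; case: (i == 0); case: (j == 0).
Qed.

Lemma snorm0_ae h : W10I +oo%E h -> snormI +oo%E h = 0 ->
  {ae muO, forall x, h.1 x.1 = 0 /\ h.2 x.1 * x.2 = 0}.
Proof.
move=> Wh sh; apply: filterS (ae_jet_bound Wh) => x; rewrite sh !normr_le0.
by move=> [/eqP ? /eqP ?].
Qed.

Lemma mxbd0 (M : 'M[R]_2) c : 0 <= c -> M = 0 -> mxbd c M.
Proof.
by move=> c0 -> a b; rewrite mul0mx dotvE !mxE !mul0r addr0 normr0 !mulr_ge0// enorm_ge0.
Qed.

(** [coef_bound] speaks of unit directions, so h is rescaled. A direction of seminorm 0 cannot be,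
    but then h and its slope, hence also [DA g h], vanish almost everywhere. *)
Lemma DA_bfield g h : adm g -> W10I +oo%E h ->
  bfield (CA * snormI +oo%E h) (DA g h).
Proof.
move=> ag Wh; apply: bfieldI; first by rewrite mulr_ge0 ?CA_ge0 ?snormI_ge0.
  exact: DA_meas.
have [s0|s0] := eqVneq (snormI +oo%E h) 0.
  apply: filterS2 (ae_good ag) (snorm0_ae Wh s0) => x gx [h1 h2].
  apply: mxbd0; first by rewrite s0 mulr0.
  rewrite (DAE _ (good_neq0 gx)) h1 h2 /dA22; apply/matrixP => i j; rewrite !mxE.
  by rewrite !mulr0 !mul0r subr0 oppr0; case: (i == 0); case: (j == 0).
have [e [We se he]] := normalize Wh s0.
have [_ h1 _] := coef_bound_parts ag.
apply: filterS2 (ae_good ag) (Linfty_mxbd (h1 _ We se)) => x gx ex.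
rewrite [in DA g h x]he DA_lincomb// DA0// addr0 mulrC.
by rewrite -[X in mxbd (X * _)]ger0_norm ?snormI_ge0//; exact: mxbdZ.
Qed.

Lemma D2Ar0 g h (x : R * R) : good g x -> D2A g h 0 x = 0.
Proof.
move=> gx; rewrite (D2AE _ _ (good_neq0 gx)) /=; apply/matrixP => i j.
rewrite !mxE /d2A22 !(mulr0, mul0r, subr0, addr0).
by case: (i == 0); case: (j == 0).
Qed.

Lemma D2A_bfield g h d : adm g -> W10I +oo%E h -> W10I +oo%E d ->
  bfield (CA * snormI +oo%E h * snormI +oo%E d) (D2A g h d).
Proof.
move=> ag Wh Wd; apply: bfieldI; first by rewrite !mulr_ge0 ?CA_ge0 ?snormI_ge0.
  exact: D2A_meas.
have z (u w : jetI R) : W10I +oo%E u -> snormI +oo%E u = 0 ->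
    {ae muO, forall x, D2A g u w x = 0}.
  move=> Wu su; apply: filterS2 (ae_good ag) (snorm0_ae Wu su) => x gx [h1 h2].
  rewrite (D2AE _ _ (good_neq0 gx)) h1 h2 /d2A22; apply/matrixP => i j; rewrite !mxE.
  by rewrite !(mulr0, mul0r, subr0, addr0); case: (i == 0); case: (j == 0).
have [s0|s0] := eqVneq (snormI +oo%E h) 0.
  apply: filterS (z h d Wh s0) => x; apply: mxbd0.
  by rewrite s0 mulr0 mul0r.
have [t0|t0] := eqVneq (snormI +oo%E d) 0.
  apply: filterS2 (ae_good ag) (z d h Wd t0) => x gx zx.
  apply: mxbd0; first by rewrite t0 mulr0.
  by rewrite D2A_sym.
have [e [We se he]] := normalize Wh s0; have [f [Wf sf hf]] := normalize Wd t0.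
have [_ _ h1] := coef_bound_parts ag.
apply: filterS2 (ae_good ag) (Linfty_mxbd (h1 _ _ We se Wf sf)) => x gx ex.
have -> : D2A g h d x =
    snormI +oo%E h *: (snormI +oo%E d *: D2A g e f x).
  have E1 : D2A g h d x = snormI +oo%E d *: D2A g h f x.
    rewrite [in LHS]hf (@D2A_lincomb g h f 0 (snormI +oo%E d) x gx).
    by rewrite (@D2Ar0 g h x gx) addr0.
  (* Linearity was shown in the last slot; symmetry of [D2A] moves h there. *)
  have E2 : D2A g f h x = snormI +oo%E h *: D2A g f e x.
    rewrite [in LHS]he (@D2A_lincomb g f e 0 (snormI +oo%E h) x gx).
    rewrite (@D2Ar0 g f x gx) addr0; exact: erefl.
  rewrite E1 (@D2A_sym g h f x gx) E2 (@D2A_sym g f e x gx) !scalerA.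
  by congr (_ *: _); exact: mulrC.
rewrite (_ : CA * _ * _ = snormI +oo%E h * (snormI +oo%E d * CA)); last by ring.
rewrite -[X in mxbd (X * _)]ger0_norm ?snormI_ge0//; apply: mxbdZ.
by rewrite -[X in mxbd (X * _)]ger0_norm ?snormI_ge0//; exact: mxbdZ.
Qed.

End UniformBounds.
End CoefficientBounds.

(** * The linearized problem *)

Section LinearizedProblem.
Context {R : realType}.
Variables (kappa CA alpha Q P beta p CE theta2 : R).
Variables (E : jetI R -> jetO R) (v : jetO R).
Local Notation muI := (@muI R).
Local Notation muO := (@muO R).
Local Notation q := (p / (p - 1)).
Hypotheses (hkappa : 0 < kappa) (hCA : coef_bound CA)
  (halpha : 0 < alpha) (hinfsupG : infsupG kappa alpha)
  (hQP : Q < 2 < P) (hbeta : 0 < beta) (hinfsupO : infsupO Q P beta)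
  (hp : 2 < p < P) (hCE : 1 <= CE) (hE : bounded_extension q CE E)
  (htheta2 : 0 < theta2 < 1) (hv : W1O p%:E v) (hv0 : snormO p%:E v <> 0)
  (hv2 : snormO p%:E v <=
         (1 - theta2) * (alpha * CE * CA * (1 + beta * CA) ^+ 2)^-1).
Implicit Types (a b c : jetW R) (g s zeta : jetI R) (y z w : jetO R).

Let CA0 : 0 <= CA := CA_ge0 hCA halpha hinfsupG.
Let Af g : adm g -> bfield CA (Acoef g) := A_bfield hCA halpha hinfsupG (g := g).
Let DAf g h (ag : adm g) (Wh : W10I +oo%E h) := DA_bfield hCA halpha hinfsupG ag Wh.
Let D2Af g h d (ag : adm g) (Wh : W10I +oo%E h) (Wd : W10I +oo%E d) :=
  D2A_bfield hCA halpha hinfsupG ag Wh Wd.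

Let p1 : 1 < p.
Proof. by case/andP: hp => h _; apply: lt_trans h; rewrite ltr1n. Qed.

Let q1 : 1 < q.
Proof. by rewrite ltr_pdivlMr ?subr_gt0// mul1r ltrBlDr ltrDl. Qed.

Let pq : p^-1 + q^-1 = 1.
Proof.
have h0 : p != 0 by rewrite gt_eqF// (lt_trans ltr01).
have h1 : p - 1 != 0 by rewrite gt_eqF// subr_gt0.
by field; rewrite h0 h1.
Qed.

Let pE1 : (1 <= p%:E)%E. Proof. by rewrite lee_fin ltW. Qed.

Let qE1 : (1 <= q%:E)%E. Proof. by rewrite lee_fin ltW. Qed.

Let ooE1 : (1 <= +oo :> \bar R)%E. Proof. by rewrite leey. Qed.

Local Notation V := (snormO p%:E v).
Local Notation B1 := (1 + beta * CA).
Local Notation nG := (snormI +oo%E).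
Local Notation nY := (snormO p%:E).
Local Notation nZ := (snormO q%:E).

Lemma V_gt0 : 0 < V.
Proof. by rewrite lt_neqAle snormO_ge0 andbT eq_sym; apply/eqP. Qed.

(** With C_A = 0 the right side of [hv2] would be 0, because 0^-1 = 0, contradicting |v| > 0. *)
Lemma CA_gt0 : 0 < CA.
Proof.
rewrite lt_neqAle CA0 andbT eq_sym; apply/negP => /eqP C0.
have := V_gt0; rewrite ltNge => /negP; apply; apply: le_trans hv2 _.
by rewrite C0 !mulr0 mul0r invr0 mulr0.
Qed.

Lemma B1_gt0 : 0 < B1.
Proof. by rewrite ltr_pwDl// mulr_ge0// ltW. Qed.

Lemma smallness : alpha * CE * CA * B1 ^+ 2 * V <= 1 - theta2.
Proof.
have c0 : 0 < alpha * CE * CA * B1 ^+ 2.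
  rewrite !mulr_gt0 ?exprn_gt0 ?B1_gt0 ?CA_gt0//.
  exact: lt_le_trans hCE.
apply: le_trans (ler_wpM2l (ltW c0) hv2) _.
by rewrite mulrCA mulfV ?mulr1// gt_eqF.
Qed.

Lemma infsupG_bound g (K : R) : W10I +oo%E g -> 0 <= K ->
  (forall s, W10I 1%E s -> BG kappa g s <= K * snormI 1%E s) -> nG g <= alpha * K.
Proof.
move=> Wg K0 H; have [/(_ g Wg) h _] := hinfsupG.
rewrite -lee_fin; apply: (le_trans h); rewrite [leRHS]EFinM.
apply: lee_wpmul2l; first by rewrite lee_fin ltW.
apply: ge_ereal_sup => _ [s [Ws _] <-]; rewrite lee_fin.
(* For a seminorm 0 the quotient is 0 by convention, which is at most K. *)
have [->|s0] := eqVneq (snormI 1%E s) 0; first by rewrite invr0 mulr0.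
by rewrite ler_pdivrMr ?H// lt_neqAle eq_sym s0 snormI_ge0.
Qed.

Lemma infsupO_bound g y (K : R) : adm g -> W10O p%:E y -> 0 <= K ->
  (forall z, W10O q%:E z -> BO y z (Acoef g) <= K * nZ z) -> nY y <= beta * K.
Proof.
move=> [Wg sg] Wy K0 H.
have hr : Q < p < P.
  case/andP: hQP => h1 _; case/andP: hp => h2 h3.
  by rewrite h3 (lt_trans h1 h2).
have h := hinfsupO hr pq Wg sg Wy.
rewrite -lee_fin; apply: (le_trans h); rewrite [leRHS]EFinM.
apply: lee_wpmul2l; first by rewrite lee_fin ltW.
apply: ge_ereal_sup => _ [z [Wz _] <-]; rewrite lee_fin.
have [->|z0] := eqVneq (nZ z) 0; first by rewrite invr0 mulr0.
by rewrite ler_pdivrMr ?H// lt_neqAle eq_sym z0 snormO_ge0.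
Qed.

(** All that the later estimates use of a state; the state equations themselves do not reappear. *)
Definition stateOK a := [/\ adm a.1, W10O p%:E a.2 & nY (a.2 + v) <= B1 * V].

Lemma gradL_p y : W10O p%:E y -> gradL p y.
Proof. by move=> [W _]; exact: gradL_W1O W. Qed.

Lemma gradL_q z : W10O q%:E z -> gradL q z.
Proof. by move=> [W _]; exact: gradL_W1O W. Qed.

Lemma gradL_add r y z : 1 <= r -> gradL r y -> gradL r z -> gradL r (y + z).
Proof. by move=> r1 hy hz; rewrite -[y]scale1r; exact: gradL_lincomb. Qed.

Lemma gradL_stateO a : stateOK a -> gradL p (a.2 + v).
Proof.
by move=> [_ Wa _]; apply: gradL_add (ltW p1) (gradL_p Wa) (gradL_W1O hv).
Qed.

Lemma gradL_E s : W10I 1%E s -> gradL q (E s).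
Proof. by move=> Ws; have [h _ _ _ _] := hE; exact: gradL_W1O (h _ Ws). Qed.

Lemma nZ_E s : W10I 1%E s -> nZ (E s) <= CE * snormI 1%E s.
Proof. by move=> Ws; have [_ _ _ _ h] := hE; exact: h. Qed.

Lemma snormI0 : snormI 1%E (0 : jetI R) = 0.
Proof.
rewrite -(scale0r (0 : jetI R)) snormI_scale ?normr0 ?mul0r//.
exact: (W10I0 (lexx _)).1.
Qed.

(** [E] is linear only up to equality almost everywhere, so [E 0] need not be the zero jet; its
    boundedness still forces the gradient seminorm to vanish. *)
Lemma nZ_E0 : nZ (E 0) = 0.
Proof.
apply/eqP; rewrite eq_le snormO_ge0 andbT.
by apply: le_trans (nZ_E (W10I0 (lexx _))) _; rewrite snormI0 mulr0.
Qed.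

Lemma nZ_add y z : gradL q y -> gradL q z -> nZ (y + z) <= nZ y + nZ z.
Proof.
move=> hy hz; have := snormO_lincomb 1 (ltW q1) hy hz.
by rewrite scale1r normr1 mul1r.
Qed.

(** The first state equation says B(y, z) = - B(v, z), so the inf-sup condition gives |y| <= beta
    C_A |v|; adding |v| produces the factor 1 + beta C_A. *)
Lemma state_solution_OK u a : state_solution kappa p E v u a -> stateOK a.
Proof.
move=> [[Wg Wy] sg hO _]; have ag : adm a.1 by [].
split=> //.
have gy := gradL_p Wy; have gv := gradL_W1O hv.
have hy : nY a.2 <= beta * (CA * V).
  apply: (infsupO_bound ag) => //; first by rewrite mulr_ge0// snormO_ge0.
  move=> z Wz; have gz := gradL_q Wz.
  have := hO _ Wz; rewrite -{1}[a.2]scale1r.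
  rewrite (BO_lincombl p1 q1 pq 1 (Af ag) gy gv gz) mul1r => /eqP.
  rewrite addr_eq0 => /eqP ->.
  apply: le_trans (ler_norm _) _; rewrite normrN.
  exact: (BO_bound p1 q1 pq (Af ag) gv gz).
have := snormO_lincomb 1 (ltW p1) gy gv.
rewrite scale1r normr1 mul1r => /le_trans; apply.
by rewrite mulrDl mul1r addrC lerD// -mulrA.
Qed.

Definition Lop a b zeta z : R := BG kappa b.1 zeta + DO v b (z + E zeta) a.

Lemma DO_bound a b w : stateOK a -> WW p b -> gradL q w ->
  `|DO v b w a| <= (CA * nY b.2 + CA * nG b.1 * (B1 * V)) * nZ w.
Proof.
move=> sa [Wg Wy] gw; have [ag _ Yb] := sa.
apply: le_trans (ler_normD _ _) _; rewrite mulrDl; apply: lerD.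
  exact: (BO_bound p1 q1 pq (Af ag) (gradL_p Wy) gw).
apply: le_trans (BO_bound p1 q1 pq (DAf ag Wg) (gradL_stateO sa) gw) _.
by rewrite ler_wpM2r ?snormO_ge0// ler_wpM2l// mulr_ge0// snormI_ge0.
Qed.

Lemma int_bounded_L1 (f h : R -> R) (K : R) : f \in Lfun muI 1 ->
  measurable_fun setT (h : measurableTypeR R -> R) ->
  {ae muI, forall t, `|h t| <= K} ->
  (f \* h) \in Lfun muI 1 /\
  `|\int[muI]_t (f t * h t)| <= `|K| * \int[muI]_t `|f t|.
Proof.
move=> Lf mh hK.
have LK : `|K| *: f + 0 \in Lfun muI 1.
  by apply: Lfun_lincomb => //; exact: Lfun0.
have d : {ae muI, forall t, `|(f \* h) t| <= `|(`|K| *: f + 0) t|}.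
  apply: filterS hK => t ht; rewrite -[X in _ <= `|X|]/(`|K| * f t + 0) addr0.
  rewrite /= !normrM normr_id mulrC ler_wpM2r//; exact: le_trans (ler_norm _).
have Lfh : (f \* h) \in Lfun muI 1.
  apply: Lfun_dominated LK d => //.
  exact: (measurable_funM (Lfun_measurable Lf) mh).
split => //.
apply: le_trans (le_normr_Rintegral measurableT (Lfun1_int Lfh)) _.
rewrite -RintegralZl//; last exact: (Lfun1_int (Lfun_norm Lf)).
apply: (@le_trans _ _ (\int[muI]_t `|(`|K| *: f + 0) t|)).
  rewrite !Lfun1_norm// fine_le ?Lfun_fin_num//.
  exact: (le_Lnorm_ae (lexx _) (Lfun_measurable Lfh) (Lfun_measurable LK) d).
rewrite (_ : (\int[muI]_t `|(`|K| *: f + 0) t|) = \int[muI]_t (`|K| * `|f t|))//.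
apply: eq_Rintegral => t _; rewrite -[X in `|X| = _]/(`|K| * f t + 0) addr0.
by rewrite normrM normr_id.
Qed.

Lemma BG_integrable g s : W10I +oo%E g -> W10I 1%E s ->
  (fun t => g.2 t * s.2 t) \in Lfun muI 1 /\
  `|BG kappa g s| <= kappa * (nG g * snormI 1%E s).
Proof.
move=> Wg Ws; have [_ Ls _] := Ws.1; have [_ mg] := W1I_meas Wg.1.
have [L b] := int_bounded_L1 Ls mg (W10I_oo_bounds Wg).2.
have E2 : (s.2 \* g.2) = (fun t => g.2 t * s.2 t).
  by apply/funext => t; rewrite /= mulrC.
split; first by rewrite -E2.
rewrite /BG normrM (gtr0_norm hkappa) ler_pM2l//.
have -> : \int[muI]_t (g.2 t * s.2 t) = \int[muI]_t (s.2 t * g.2 t).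
  by apply: eq_Rintegral => t _; rewrite mulrC.
apply: (le_trans b); rewrite (ger0_norm (snormI_ge0 _ _)) (Lfun1_norm Ls).
by rewrite /snormI.
Qed.

Lemma BG_lincombl (k : R) g h s : W10I +oo%E g -> W10I +oo%E h -> W10I 1%E s ->
  BG kappa (k *: g + h) s = k * BG kappa g s + BG kappa h s.
Proof.
move=> Wg Wh Ws; have [L1 _] := BG_integrable Wg Ws.
have [L2 _] := BG_integrable Wh Ws.
rewrite /BG mulrCA -mulrDr; congr (_ * _).
have i1 := Lfun1_int L1; have i2 := Lfun1_int L2.
rewrite -RintegralZl// -RintegralD//; last exact: (integrableZl measurableT k i1).
apply: eq_Rintegral => t _.
by rewrite -[(k *: g + h).2 t]/(k * g.2 t + h.2 t) mulrDl mulrA.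
Qed.

Lemma DO_lincombl (k : R) a b c w : stateOK a -> WW p b -> WW p c -> gradL q w ->
  DO v (k *: b + c) w a = k * DO v b w a + DO v c w a.
Proof.
move=> sa [Wb Yb] [Wc Yc] gw; have [ag _ _] := sa.
rewrite /DO -[(k *: b + c).2]/(k *: b.2 + c.2) -[(k *: b + c).1]/(k *: b.1 + c.1).
rewrite (BO_lincombl p1 q1 pq k (Af ag) (gradL_p Yb) (gradL_p Yc) gw).
rewrite (@BO_lincombM R p q p1 q1 pq k _ _ _ _ (DA a.1 (k *: b.1 + c.1)) _ _
  (DAf ag Wb) (DAf ag Wc) (gradL_stateO sa) gw).
  by rewrite mulrDr addrACA.
by apply: filterS (ae_good ag) => x gx; exact: DA_lincomb.
Qed.

Lemma gradL_test s z : W10I 1%E s -> W10O q%:E z -> gradL q (z + E s).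
Proof. by move=> Ws Wz; exact: gradL_add (ltW q1) (gradL_q Wz) (gradL_E Ws). Qed.

Lemma Lop_lincomb (k : R) a b c s z : stateOK a -> WW p b -> WW p c ->
  W10I 1%E s -> W10O q%:E z ->
  Lop a (k *: b + c) s z = k * Lop a b s z + Lop a c s z.
Proof.
move=> sa Wb Wc Ws Wz; rewrite /Lop -[(k *: b + c).1]/(k *: b.1 + c.1).
rewrite (BG_lincombl k Wb.1 Wc.1 Ws) (DO_lincombl k sa Wb Wc (gradL_test Ws Wz)).
by rewrite addrACA -mulrDr.
Qed.

Lemma WW_lincomb (k : R) b c : WW p b -> WW p c -> WW p (k *: b + c).
Proof.
move=> [Wb Yb] [Wc Yc]; split.
- exact: (W10I_lincomb k ooE1 Wb Wc).
- exact: (W10O_lincomb k pE1 Yb Yc).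
Qed.

Lemma WWB b c : WW p b -> WW p c -> WW p (b - c).
Proof. by move=> Wb Wc; rewrite addrC -scaleN1r; exact: WW_lincomb. Qed.

Lemma LopB a b c s z : stateOK a -> WW p b -> WW p c ->
  W10I 1%E s -> W10O q%:E z -> Lop a (b - c) s z = Lop a b s z - Lop a c s z.
Proof.
move=> sa Wb Wc Ws Wz; rewrite [b - c]addrC -scaleN1r Lop_lincomb//.
by rewrite mulN1r addrC.
Qed.

(** Removes the extension when the linearized problem is tested with zeta = 0. *)
Lemma BO_E0 (c : R) M y z : bfield c M -> gradL p y -> gradL q z ->
  BO y (z + E 0) M = BO y z M.
Proof.
move=> hM gy gz; have gE := gradL_E (W10I0 (lexx _)).
rewrite -[z]scale1r (BO_lincombr p1 q1 pq 1 hM gy gz gE) scale1r mul1r.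
have := BO_bound p1 q1 pq hM gy gE; rewrite nZ_E0 mulr0 normr_le0 => /eqP ->.
by rewrite addr0.
Qed.

Lemma W10O_0 : W10O q%:E (0 : jetO R).
Proof.
apply/W10OP; split.
  split; [exact: Lfun0 qE1..|move=> phi _].
  have z0 (f : R * R -> R) : \int[muO]_x ((0 : R * R -> R) x * f x) = 0.
    rewrite (_ : \int[muO]_x _ = \int[muO]_x 0).
      by rewrite Rintegral_cst// mul0r.
    by apply: eq_Rintegral => x _; rewrite mul0r.
  by split; rewrite !z0 oppr0.
have L0 (e : R) : 0 < e -> L1near muO e 0 0.
  move=> e0; rewrite /L1near subrr (_ : EFin \o 0 = cst 0%E)// Lnorm0 ?oner_eq0//.
  by rewrite lee_fin ltW.
have D0 (w : R * R) : 'D_w (0 : R * R -> R) = 0.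
  by apply/funext => x; exact: derive_cst.
move=> e e0; exists 0; split; rewrite ?D0; [exact: C1_0|exact: L0..|].
rewrite /bdnorm (eq_integral (cst 0%E)); last first.
  by move=> t _; rewrite !normr0 !addr0.
by rewrite integral0 lee_fin ltW.
Qed.

Lemma BG0 g : BG kappa g (0 : jetI R) = 0.
Proof.
rewrite /BG (_ : \int[muI]_t _ = \int[muI]_t 0); last first.
  by apply: eq_Rintegral => t _; rewrite mulr0.
by rewrite Rintegral_cst// mul0r mulr0.
Qed.

(** Two constants separate functionals of s alone, such as the right-hand side solved by [G'], from
    functionals of z + E s, such as [FO]. The bound for y comes from the test (0, z), the one for
    gamma from the test (s, 0) after elimination of y. *)
Lemma apriori a b (k L : R) : stateOK a -> WW p b -> 0 <= k -> 0 <= L ->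
  (forall s z, W10I 1%E s -> W10O q%:E z ->
    `|Lop a b s z| <= k * snormI 1%E s + L * nZ (z + E s)) ->
  nG b.1 <= alpha / theta2 * (k + CE * B1 * L) /\
  nY b.2 <= beta * (L + CA * B1 * V * nG b.1).
Proof.
move=> sa Wb k0 L0 H; have [ag Wa Yb] := sa; have [Wg Wy] := Wb.
have gav := gradL_stateO sa; have gy := gradL_p Wy.
have V0 := V_gt0; have B0 := B1_gt0; have g0 : 0 <= nG b.1 := snormI_ge0 _ _.
have W0 : W10I 1%E (0 : jetI R) := W10I0 (lexx _).
have DAb w : gradL q w -> `|BO (a.2 + v) w (DA a.1 b.1)| <=
    CA * B1 * V * nG b.1 * nZ w.
  move=> gw; apply: le_trans (BO_bound p1 q1 pq (DAf ag Wg) gav gw) _.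
  rewrite ler_wpM2r ?snormO_ge0//.
  rewrite (_ : CA * B1 * V * nG b.1 = CA * nG b.1 * (B1 * V)); last by ring.
  by rewrite ler_wpM2l// mulr_ge0.
have hy : nY b.2 <= beta * (L + CA * B1 * V * nG b.1).
  apply: (infsupO_bound ag Wy).
    by rewrite addr_ge0// !mulr_ge0// ltW.
  move=> z Wz; have gz := gradL_q Wz.
  have := H 0 z W0 Wz; rewrite /Lop BG0 add0r snormI0 mulr0 add0r /DO.
  rewrite (BO_E0 (Af ag) gy gz) (BO_E0 (DAf ag Wg) gav gz).
  have := nZ_add gz (gradL_E W0); rewrite nZ_E0 addr0 => hz h.
  have h1 : BO b.2 z (Acoef a.1) + BO (a.2 + v) z (DA a.1 b.1) <= L * nZ z.
    apply: le_trans (ler_norm _) (le_trans h _).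
    by rewrite ler_wpM2l.
  have := DAb z gz; rewrite ler_norml => /andP[h2 _].
  rewrite mulrDl; lra.
split=> //.
have [t0 t1] := andP htheta2.
have CE0 : 0 <= CE by apply: le_trans hCE.
pose K := k + CE * (L + CA * nY b.2 + CA * B1 * V * nG b.1).
have y0 : 0 <= nY b.2 := snormO_ge0 _ _.
have K0 : 0 <= K.
  have := mulr_ge0 CA0 y0; have h : 0 <= CA * B1 * V * nG b.1.
    by rewrite !mulr_ge0// ltW.
  by move=> h'; rewrite addr_ge0// mulr_ge0// !addr_ge0.
have hg : nG b.1 <= alpha * K.
  apply: (infsupG_bound Wg K0) => s Ws.
  have := H s 0 Ws W10O_0; rewrite /Lop add0r /DO.
  have gE := gradL_E Ws.
  have := DAb _ gE; have := BO_bound p1 q1 pq (Af ag) gy gE.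
  set X := BO _ _ _; set Y := BO _ _ _; set Z := BG _ _ _ => hX hY.
  rewrite ler_norml => /andP[_ h].
  move: hX hY; rewrite !ler_norml => /andP[hX _] /andP[hY _].
  have : Z <= k * snormI 1%E s + (L + CA * nY b.2 + CA * B1 * V * nG b.1) * nZ (E s).
    by rewrite !mulrDl; lra.
  move=> /le_trans; apply; rewrite /K [leRHS]mulrDl lerD2l.
  rewrite [leRHS]mulrAC [leRHS]mulrC.
  rewrite ler_wpM2l ?nZ_E//.
  by rewrite !addr_ge0// !mulr_ge0// ltW.
have sm := smallness.
(* Inserting [hy] turns the coefficient C_E of L into C_E (1 + beta C_A), and raises the power of 1
   + beta C_A in front of [nG b.1] from 1 to 2. [smallness] then absorbs that term. *)
have h1 : nG b.1 <= alpha * (k + CE * B1 * L) + alpha * CE * CA * B1 ^+ 2 * V * nG b.1.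
  apply: (le_trans hg).
  have h2 : CE * (CA * nY b.2) <= CE * (CA * (beta * (L + CA * B1 * V * nG b.1))).
    by rewrite !ler_wpM2l.
  have h3 := ler_wpM2l (ltW halpha) h2.
  rewrite /K; apply: (@le_trans _ _ (alpha * k + alpha * CE * L +
    alpha * (CE * (CA * (beta * (L + CA * B1 * V * nG b.1)))) +
    alpha * CE * CA * B1 * V * nG b.1)).
    have : alpha * (k + CE * (L + CA * nY b.2 + CA * B1 * V * nG b.1)) =
      alpha * k + alpha * CE * L + alpha * (CE * (CA * nY b.2)) +
      alpha * CE * CA * B1 * V * nG b.1 by ring.
    by move=> ->; rewrite lerD2r lerD2l.
  by rewrite le_eqVlt; apply/orP; left; apply/eqP; ring.
have h2 := ler_wpM2r g0 sm.
have h3 : theta2 * nG b.1 <= alpha * (k + CE * B1 * L) by lra.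
by rewrite mulrAC ler_pdivlMr// mulrC.
Qed.

Ltac nonneg := repeat first
  [ assumption | exact: sqr_ge0 | exact: snormI_ge0 | exact: snormO_ge0
  | exact: ler01 | exact: ler0n | by apply: ltW; assumption
  | apply: mulr_ge0 | apply: addr_ge0 ].

Lemma L2_lincomb (k : R) (f h : R -> R) : L2 f -> L2 h -> L2 (k *: f + h).
Proof. by move=> Lf Lh; apply: Lfun_lincomb => //; rewrite lee_fin ler1n. Qed.

Lemma L2normE (f : R -> R) : L2 f -> (L2norm f)%:E = ('N[muI]_2%:E[EFin \o f])%E.
Proof. by move=> Lf; rewrite fineK// Lfun_fin_num// lee_fin ler1n. Qed.

Lemma L2norm_ge0 (f : R -> R) : 0 <= L2norm f.
Proof. by rewrite fine_ge0 ?Lnorm_ge0. Qed.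

Lemma L2norm_lincomb (k : R) (f h : R -> R) : L2 f -> L2 h ->
  L2norm (k *: f + h) <= `|k| * L2norm f + L2norm h.
Proof.
move=> Lf Lh; have L := L2_lincomb k Lf Lh.
have h2 : (1 <= 2%:E :> \bar R)%E by rewrite lee_fin ler1n.
rewrite -lee_fin EFinD EFinM !L2normE// -Lnorm_scale//.
apply: (eminkowski muI _ _ h2); last exact: (Lfun_measurable Lh).
exact: (measurable_funM (measurable_cst _) (Lfun_measurable Lf)).
Qed.

Lemma L2_scale (k : R) (f : R -> R) : L2 f -> L2 (k *: f).
Proof.
move=> Lf; rewrite -[k *: f]addr0; apply: L2_lincomb => //.
by apply: Lfun0; rewrite lee_fin ler1n.
Qed.

Lemma L2norm_scale (k : R) (f : R -> R) : L2 f ->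
  L2norm (k *: f) = `|k| * L2norm f.
Proof.
move=> Lf; apply: EFin_inj; rewrite EFinM !L2normE//; last exact: L2_scale.
by rewrite -Lnorm_scale// lee_fin ler1n.
Qed.

(** Poincaré's inequality on I bounds s uniformly, so the L^1 norm of h suffices, which is at most
    its L^2 norm. *)
Lemma rhs_bound (h : R -> R) s : L2 h -> W10I 1%E s ->
  (fun t => h t * s.1 t) \in Lfun muI 1 /\
  `|\int[muI]_t (h t * s.1 t)| <= L2norm h * snormI 1%E s.
Proof.
move=> Lh Ws; have h2 : (1 <= 2%:E :> \bar R)%E by rewrite lee_fin ler1n.
have [Lh1 le1] := Lfun1_le_Lnorm (@muI_setT R) h2 Lh.
have [ms _] := W1I_meas Ws.1.
have bs : {ae muI, forall t, `|s.1 t| <= snormI 1%E s}.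
  apply: filterS (W10I_1_bound Ws) => t; apply: le_trans.
  by rewrite mulr2n mulrDl mul1r lerDr.
have [L b] := int_bounded_L1 Lh1 ms bs; split=> //.
apply: (le_trans b); rewrite ger0_norm ?snormI_ge0// mulrC.
rewrite ler_wpM2r ?snormI_ge0// (Lfun1_norm Lh1).
by rewrite -lee_fin L2normE// fineK ?Lfun_fin_num.
Qed.

Lemma rhs_lincomb (k : R) (f h : R -> R) s : L2 f -> L2 h -> W10I 1%E s ->
  \int[muI]_t ((k *: f + h) t * s.1 t) =
  k * \int[muI]_t (f t * s.1 t) + \int[muI]_t (h t * s.1 t).
Proof.
move=> Lf Lh Ws; have [L1 _] := rhs_bound Lf Ws; have [L2 _] := rhs_bound Lh Ws.
have i1 := Lfun1_int L1; have i2 := Lfun1_int L2.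
rewrite -RintegralZl// -RintegralD//; last exact: (integrableZl measurableT k i1).
by apply: eq_Rintegral => t _; rewrite -[(k *: f + h) t]/(k * f t + h t) mulrDl mulrA.
Qed.

Lemma WW_scale (k : R) b : WW p b -> WW p (k *: b).
Proof.
move=> Wb; rewrite -[k *: b]addr0; apply: WW_lincomb => //; split.
  exact: (W10I0 ooE1).
have [_ Yb] := Wb; have := W10O_lincomb (-1) pE1 Yb Yb.
by rewrite scaleN1r addNr.
Qed.

Lemma snormI_lincomb_oo (k : R) g h : W10I +oo%E g -> W10I +oo%E h ->
  nG (k *: g + h) <= `|k| * nG g + nG h.
Proof. by move=> [Wg _] [Wh _]; exact: snormI_lincomb. Qed.

Lemma snormO_lincomb_p (k : R) y z : W10O p%:E y -> W10O p%:E z ->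
  nY (k *: y + z) <= `|k| * nY y + nY z.
Proof. by move=> /gradL_p Wy /gradL_p Wz; exact: snormO_lincomb (ltW p1) Wy Wz. Qed.

Lemma nG_le_sub g h : W10I +oo%E g -> W10I +oo%E h -> nG g <= nG (g - h) + nG h.
Proof.
move=> Wg Wh; have W : W10I +oo%E (g - h).
  by rewrite addrC -scaleN1r; apply: W10I_lincomb.
by have := snormI_lincomb_oo 1 W Wh; rewrite scale1r subrK normr1 mul1r.
Qed.

Lemma W10O_sub y z : W10O p%:E y -> W10O p%:E z -> W10O p%:E (y - z).
Proof. by move=> Wy Wz; rewrite addrC -scaleN1r; apply: W10O_lincomb. Qed.

Lemma W10I_sub g h : W10I +oo%E g -> W10I +oo%E h -> W10I +oo%E (g - h).
Proof. by move=> Wg Wh; rewrite addrC -scaleN1r; apply: W10I_lincomb. Qed.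

Lemma nY_le_sub y z : W10O p%:E y -> W10O p%:E z -> nY y <= nY (y - z) + nY z.
Proof.
move=> Wy Wz.
by have := snormO_lincomb_p 1 (W10O_sub Wy Wz) Wz; rewrite scale1r subrK normr1 mul1r.
Qed.

Lemma nG_sub_eq0_eqI g h : W10I +oo%E g -> W10I +oo%E h -> nG (g - h) <= 0 ->
  eqI g h.
Proof.
move=> Wg Wh n0; have [b _] := W10I_oo_bounds (W10I_sub Wg Wh).
apply: filterS b => t /le_trans/(_ n0) b _; apply/eqP; rewrite -subr_eq0 -normr_le0.
by have : 2 * `|g.1 t - h.1 t| <= 0 := b; lra.
Qed.

Lemma nY_sub_eq0_eqO y z : W10O p%:E y -> W10O p%:E z -> nY (y - z) <= 0 ->
  eqO y z.
Proof.
move=> Wy Wz n0; have Wd := W10O_sub Wy Wz; have [Ld _ _ _] := Wd.1.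
have [g1 g2] := gradL_p Wd; have [m0 m1 m2] := W1O_meas Wd.1.
have [_ /(approxOP m0 m1 m2) ad] := Wd.
have [h1 _ _] := Lnorm_grad_le pE1 m1 m2.
have le0 : ('N[muO]_p%:E[EFin \o (y - z)%R.1] <= 0)%E.
  apply: le_trans (poincareO (ltW p1) (And3 m0 m1 m2) ad) (le_trans h1 _).
  by rewrite -(snormOE (ltW p1) g1 g2) lee_fin.
have eq0 : ('N[muO]_p%:E[EFin \o (y - z)%R.1] = 0)%E.
  by apply/eqP; rewrite eq_le le0 Lnorm_ge0.
have /measurable_EFinP mE := m0.
have p0 : (0 < p%:E)%E by rewrite lte_fin (lt_trans _ p1).
have h0 := @Lnorm_eq0_eq0 _ _ _ muO _ _ mE p0 eq0.
apply: filterS h0 => x /(_ I) h _; apply/eqP.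
have [{}h] : (y.1 x - z.1 x)%:E = 0%:E := h.
by rewrite -subr_eq0 h.
Qed.

Lemma eqW_of_snorm0 b c : WW p b -> WW p c -> nG (b - c).1 <= 0 ->
  nY (b - c).2 <= 0 -> eqW b c.
Proof.
move=> [Wb Yb] [Wc Yc] h1 h2.
by split; [exact: nG_sub_eq0_eqI|exact: nY_sub_eq0_eqO].
Qed.

Lemma FO_bound a b c w : stateOK a -> WW p b -> WW p c -> gradL q w ->
  `|FO v a b c w| <= (CA * nG c.1 * nY b.2 + CA * nG b.1 * nY c.2 +
                      CA * nG b.1 * nG c.1 * (B1 * V)) * nZ w.
Proof.
move=> sa [Wb Yb] [Wc Yc] gw; have [ag _ Ya] := sa.
have h1 := BO_bound p1 q1 pq (DAf ag Wc) (gradL_p Yb) gw.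
have h2 := BO_bound p1 q1 pq (DAf ag Wb) (gradL_p Yc) gw.
have h3 := BO_bound p1 q1 pq (D2Af ag Wb Wc) (gradL_stateO sa) gw.
have h4 : CA * nG b.1 * nG c.1 * nY (a.2 + v) * nZ w <=
          CA * nG b.1 * nG c.1 * (B1 * V) * nZ w.
  by rewrite ler_wpM2r ?snormO_ge0// ler_wpM2l// !mulr_ge0 ?snormI_ge0.
have {h3 h4} h3 := le_trans h3 h4.
rewrite /FO mulrDl [X in _ <= X + _]mulrDl.
apply: le_trans (ler_normB _ _) (lerD _ h3).
by apply: le_trans (ler_normB _ _) (lerD _ h2); rewrite normrN.
Qed.

Lemma BO_ae_eq M N y z : {ae muO, forall x, M x = N x} -> BO y z M = BO y z N.
Proof.
move=> e; apply: (f_equal fine); apply: ae_eq_integral_nomeas.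
by apply: filterS e => x ->.
Qed.

Lemma FO_sym a b c w : adm a.1 -> FO v a b c w = FO v a c b w.
Proof.
move=> ag.
have e : BO (a.2 + v) w (D2A a.1 b.1 c.1) = BO (a.2 + v) w (D2A a.1 c.1 b.1).
  by apply: BO_ae_eq; apply: filterS (ae_good ag) => x gx; exact: D2A_sym.
have H (x1 x2 x3 : R) : - x1 - x2 - x3 = - x2 - x1 - x3 by ring.
exact: (etrans (f_equal (fun t => - BO b.2 w (DA a.1 c.1) -
  BO c.2 w (DA a.1 b.1) - t) e) (H _ _ _)).
Qed.

Let FO_ring (k y1 y2 y3 x1 x2 x3 x4 x5 x6 : R) :
  y1 = k * x1 + x2 -> y2 = k * x3 + x4 -> y3 = k * x5 + x6 ->
  - y1 - y2 - y3 = k * (- x1 - x3 - x5) + (- x2 - x4 - x6).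
Proof. by move=> -> -> ->; ring. Qed.

Lemma BO_DA_lincomb (k : R) g h d y w : adm g -> W10I +oo%E h -> W10I +oo%E d ->
  gradL p y -> gradL q w ->
  BO y w (DA g (k *: h + d)) = k * BO y w (DA g h) + BO y w (DA g d).
Proof.
move=> ag Wh Wd gy gw; apply: (BO_lincombM p1 q1 pq (DAf ag Wh) (DAf ag Wd) gy gw).
by apply: filterS (ae_good ag) => x gx; exact: DA_lincomb.
Qed.

Lemma BO_D2A_lincomb (k : R) g e h d y w : adm g -> W10I +oo%E e ->
  W10I +oo%E h -> W10I +oo%E d -> gradL p y -> gradL q w ->
  BO y w (D2A g e (k *: h + d)) = k * BO y w (D2A g e h) + BO y w (D2A g e d).
Proof.
move=> ag We Wh Wd gy gw.
apply: (BO_lincombM p1 q1 pq (D2Af ag We Wh) (D2Af ag We Wd) gy gw).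
by apply: filterS (ae_good ag) => x gx; exact: (@D2A_lincomb R g e h d k x gx).
Qed.

Lemma FO_lincombr (k : R) a b c c' w : stateOK a -> WW p b -> WW p c -> WW p c' ->
  gradL q w -> FO v a b (k *: c + c') w = k * FO v a b c w + FO v a b c' w.
Proof.
move=> sa [Wb Yb] [Wc Yc] [Wc' Yc'] gw; have [ag _ _] := sa.
exact: (FO_ring (BO_DA_lincomb k ag Wc Wc' (gradL_p Yb) gw)
  (BO_lincombl p1 q1 pq k (DAf ag Wb) (gradL_p Yc) (gradL_p Yc') gw)
  (BO_D2A_lincomb k ag Wb Wc Wc' (gradL_stateO sa) gw)).
Qed.

Lemma FO_lincombl (k : R) a b b' c w : stateOK a -> WW p b -> WW p b' -> WW p c ->
  gradL q w -> FO v a (k *: b + b') c w = k * FO v a b c w + FO v a b' c w.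
Proof.
move=> sa Wb Wb' Wc gw; have [ag _ _] := sa.
have e2 := FO_lincombr k sa Wc Wb Wb' gw.
have e3 := FO_sym c b w ag.
have e4 := FO_sym c b' w ag.
have e1 := FO_sym (k *: b + b') c w ag.
apply: (etrans e1).
apply: (etrans e2).
exact: (f_equal2 (fun x y : R => k * x + y) e3 e4).
Qed.

Lemma FO_lincombw (k : R) a b c w w' : stateOK a -> WW p b -> WW p c ->
  gradL q w -> gradL q w' ->
  FO v a b c (k *: w + w') = k * FO v a b c w + FO v a b c w'.
Proof.
move=> sa [Wb Yb] [Wc Yc] gw gw'; have [ag _ _] := sa.
exact: (FO_ring (BO_lincombr p1 q1 pq k (DAf ag Wc) (gradL_p Yb) gw gw')
  (BO_lincombr p1 q1 pq k (DAf ag Wb) (gradL_p Yc) gw gw')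
  (BO_lincombr p1 q1 pq k (D2Af ag Wb Wc) (gradL_stateO sa) gw gw')).
Qed.

Lemma FO_dual a b c : stateOK a -> WW p b -> WW p c -> W1q_dual p (FO v a b c).
Proof.
move=> sa Wb Wc; split=> [k y z Wy Wz|].
  by apply: FO_lincombw => //; exact: gradL_W1O.
have [C0 hC] : exists2 C, 0 <= C & forall w, gradL q w -> `|FO v a b c w| <= C * nZ w.
  exists (CA * nG c.1 * nY b.2 + CA * nG b.1 * nY c.2 + CA * nG b.1 * nG c.1 * (B1 * V)).
    by nonneg.
  by move=> w gw; exact: FO_bound.
move=> hC'; exists C0 => z Wz; have [g1 g2] := gradL_W1O Wz.
apply: (@le_trans _ _ (C0 * nZ z)%:E).
  by rewrite lee_fin hC'.
rewrite EFinM; apply: lee_wpmul2l; first by rewrite lee_fin.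
by rewrite (snormOE (ltW q1) g1 g2) /normO leeDr// Lnorm_ge0.
Qed.

Ltac mono := repeat first
  [ assumption | exact: lexx | apply: ler_pM; [by nonneg|by nonneg| |]
  | apply: lerD ].

Let lincombN1 (x s t : R) : x = -1 * s + t -> x = t - s.
Proof. by move=> ->; rewrite mulN1r addrC. Qed.

Lemma BO_subM (r r' : R) M N y w : bfield r M -> bfield r' N -> gradL p y -> gradL q w ->
  BO y w (fun x => M x - N x) = BO y w M - BO y w N.
Proof.
move=> hM hN gy gw; apply: lincombN1.
apply: (BO_lincombM p1 q1 pq hN hM gy gw).
by apply: nearW => x; rewrite scaleN1r addrC.
Qed.

Lemma BO_subl (r : R) M y z w : bfield r M -> gradL p y -> gradL p z -> gradL q w ->
  BO (y - z) w M = BO y w M - BO z w M.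
Proof.
move=> hM gy gz gw; have e : y - z = -1 *: z + y by rewrite scaleN1r addrC.
apply: etrans (f_equal (fun t => BO t w M) e) _.
exact: (lincombN1 (BO_lincombl p1 q1 pq (-1) hM gz gy gw)).
Qed.

Lemma BO_DA_sub g h d y w : adm g -> W10I +oo%E h -> W10I +oo%E d ->
  gradL p y -> gradL q w ->
  BO y w (DA g (h - d)) = BO y w (DA g h) - BO y w (DA g d).
Proof.
move=> ag Wh Wd gy gw; have e : h - d = -1 *: d + h by rewrite scaleN1r addrC.
apply: etrans (f_equal (fun t => BO y w (DA g t)) e) _.
exact: (lincombN1 (BO_DA_lincomb (-1) ag Wd Wh gy gw)).
Qed.

Lemma BO_D2A_sub g e h d y w : adm g -> W10I +oo%E e -> W10I +oo%E h ->
  W10I +oo%E d -> gradL p y -> gradL q w ->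
  BO y w (D2A g e (h - d)) = BO y w (D2A g e h) - BO y w (D2A g e d).
Proof.
move=> ag We Wh Wd gy gw; have E0 : h - d = -1 *: d + h by rewrite scaleN1r addrC.
apply: etrans (f_equal (fun t => BO y w (D2A g e t)) E0) _.
exact: (lincombN1 (BO_D2A_lincomb (-1) ag We Wd Wh gy gw)).
Qed.

Lemma BO_le (r r' n : R) M y w : bfield r M -> gradL p y -> gradL q w ->
  r <= r' -> nY y <= n -> `|BO y w M| <= r' * n * nZ w.
Proof.
move=> hM gy gw rr yn; have [r0 _ _] := hM.
by apply: (le_trans (BO_bound p1 q1 pq hM gy gw)); mono.
Qed.

(** * Comparison of the forms at two states *)

Section StateDifferences.
Variables (a a' : jetW R) (w : jetO R).
Hypotheses (sa : stateOK a) (sa' : stateOK a') (gw : gradL q w).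
Variables (mg my : R).
Hypotheses (hmg : nG (a'.1 - a.1) <= mg) (hmy : nY (a'.2 - a.2) <= my).

Let ag : adm a.1. Proof. by case: sa. Qed.

Let ag' : adm a'.1. Proof. by case: sa'. Qed.

Let Ya : nY (a.2 + v) <= B1 * V. Proof. by case: sa. Qed.

Let WY : W10O p%:E (a'.2 - a.2).
Proof. by case: sa => _ ? _; case: sa' => _ ? _; exact: W10O_sub. Qed.

Let gya : gradL p (a.2 + v) := gradL_stateO sa.
Let gyd : gradL p (a'.2 - a.2) := gradL_p WY.

Let BO_state M (r : R) : bfield r M ->
  BO (a'.2 + v) w M = BO (a'.2 - a.2) w M + BO (a.2 + v) w M.
Proof.
move=> hM; have e : a'.2 + v = 1 *: (a'.2 - a.2) + (a.2 + v).
  by rewrite scale1r addrA subrK.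
apply: etrans (f_equal (fun t => BO t w M) e) _.
by rewrite (BO_lincombl p1 q1 pq 1 hM gyd gya gw) mul1r.
Qed.

Let combine3 (x1 x2 x3 x4 x5 t1 t2 t3 c1 c2 c3 n : R) :
  x4 = t3 + x5 -> t1 = x3 - x1 -> t2 = x5 - x2 ->
  `|t1| <= c1 * n -> `|t2| <= c2 * n -> `|t3| <= c3 * n ->
  `|(x1 + x2) - (x3 + x4)| <= (c1 + c2 + c3) * n.
Proof.
move=> -> e1 e2; rewrite !ler_norml !mulrDl.
by move=> /andP[? ?] /andP[? ?] /andP[? ?]; apply/andP; split; lra.
Qed.

(** Three variations are collected, in this order: of A, of DA acting on the first state, and of the
    state in the term with DA at the second state. *)
Lemma DO_sub_bound b (bg by_ : R) : WW p b -> nG b.1 <= bg -> nY b.2 <= by_ ->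
  `|DO v b w a - DO v b w a'| <=
    (48 * mg * by_ + 208 * mg * bg * (B1 * V) + CA * bg * my) * nZ w.
Proof.
move=> [Wg Wy] hg hy; have gy := gradL_p Wy.
apply: (combine3 (BO_state (DAf ag' Wg)) (BO_subM (Af ag') (Af ag) gy gw)
  (BO_subM (DAf ag' Wg) (DAf ag Wg) gya gw)).
- by apply: (BO_le (A_lipschitz_field ag ag') gy gw) => //; mono.
- by apply: (BO_le (DA_lipschitz_field ag ag' Wg) gya gw) => //; mono.
- by apply: (BO_le (DAf ag' Wg) gyd gw) => //; mono.
Qed.

(* The sums t1 + t2 + t3, t4 + t5 + t6 and t7 + t8 + t9 telescope: they collect
   the variations of A, of DA, and of the factor y + v, respectively. *)
Let combine9 (x1 x2 x3 x4 x5 x6 y1 y2 y3 y4 y5 y6 z0 z1 z2 z3 z4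
  t1 t2 t3 t4 t5 t6 t7 t8 t9 c1 c2 c3 c4 c5 c6 c7 c8 c9 n : R) :
  t1 = (x1 - x3) - (x2 - x4) -> t2 = x3 - x4 - x5 -> t3 = x5 - x6 ->
  t4 = (y1 - y3) - (y2 - y4) -> t5 = y3 - y4 - y5 -> t6 = y5 - y6 ->
  t7 = z1 - z2 -> t8 = z2 - z3 -> t9 = z3 - z4 -> z0 = z1 + y1 ->
  `|t1| <= c1 * n -> `|t2| <= c2 * n -> `|t3| <= c3 * n ->
  `|t4| <= c4 * n -> `|t5| <= c5 * n -> `|t6| <= c6 * n ->
  `|t7| <= c7 * n -> `|t8| <= c8 * n -> `|t9| <= c9 * n ->
  `|(x2 + y2) - (x1 + z0) - (- x6 - z4 - y6)| <=
    (c1 + c2 + c3 + (c4 + c5 + c6) + (c7 + c8 + c9)) * n.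
Proof.
move=> e1 e2 e3 e4 e5 e6 e7 e8 e9 ->.
have -> : x2 + y2 - (x1 + (z1 + y1)) - (- x6 - z4 - y6) =
  - (t1 + t2 + t3 + (t4 + t5 + t6) + (t7 + t8 + t9)).
  by rewrite e1 e2 e3 e4 e5 e6 e7 e8 e9; ring.
move=> h1 h2 h3 h4 h5 h6 h7 h8 h9; rewrite normrN.
rewrite ![(_ + _) * n]mulrDl.
have tri (s t c d : R) : `|s| <= c -> `|t| <= d -> `|s + t| <= c + d.
  by move=> hs ht; apply: le_trans (ler_normD _ _) (lerD hs ht).
by repeat (assumption || apply: (tri)).
Qed.

(** To be read with [a] = G(u), [a'] = G(u + h), [ah] = G'(u) h, [b] = G'(u) k and [b'] = G'(u + h)
    k. Each of the nine terms contains either two small differences or the Fréchet remainder,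
    measured by [eg] and [ey]. *)
Lemma DO_taylor_bound ah b b' (eg ey dg dy bg by_ : R) :
  WW p ah -> WW p b -> WW p b' ->
  nG (a'.1 - a.1 - ah.1) <= eg -> nY (a'.2 - a.2 - ah.2) <= ey ->
  nG (b'.1 - b.1) <= dg -> nY (b'.2 - b.2) <= dy -> nG b.1 <= bg -> nY b.2 <= by_ ->
  `|DO v b' w a - DO v b' w a' - FO v a b ah w| <=
    (48 * mg * dy + 104 * mg ^+ 2 * by_ + CA * eg * by_ +
     (208 * mg * dg * (B1 * V) + 624 * mg ^+ 2 * bg * (B1 * V) +
      CA * bg * eg * (B1 * V)) +
     (CA * dg * my + 208 * mg * bg * my + CA * bg * ey)) * nZ w.
Proof.
move=> [Wh Yh] [Wb Yb] [Wb' Yb'] heg hey hdg hdy hbg hby.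
have Wd : W10I +oo%E (a'.1 - a.1) := W10I_sub ag'.1 ag.1.
have We := W10I_sub Wd Wh; have Wbb := W10I_sub Wb' Wb.
have gb := gradL_p Yb; have gb' := gradL_p Yb'; have gh := gradL_p Yh.
have gbb := gradL_p (W10O_sub Yb' Yb); have ge := gradL_p (W10O_sub WY Yh).
have sq : nG (a'.1 - a.1) ^+ 2 <= mg ^+ 2.
  by rewrite lerXn2r// nnegrE ?snormI_ge0// (le_trans (snormI_ge0 _ _) hmg).
have fA := A_lipschitz_field ag ag'; have fD := DA_lipschitz_field ag ag' Wb.
have f1 := BO_subM (Af ag') (Af ag) gb gw.
have f2 := BO_subM (DAf ag' Wb) (DAf ag Wb) gya gw.
apply: (combine9 (etrans (BO_subM (Af ag') (Af ag) gbb gw) (f_equal2 (fun x y : R => x - y)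
    (BO_subl (Af ag') gb' gb gw) (BO_subl (Af ag) gb' gb gw)))
  (etrans (BO_subM fA (DAf ag Wd) gb gw) (f_equal (fun x : R => x - _) f1))
  (BO_DA_sub ag Wd Wh gb gw)
  (etrans (BO_subM (DAf ag' Wbb) (DAf ag Wbb) gya gw) (f_equal2 (fun x y : R => x - y)
    (BO_DA_sub ag' Wb' Wb gya gw) (BO_DA_sub ag Wb' Wb gya gw)))
  (etrans (BO_subM fD (D2Af ag Wb Wd) gya gw) (f_equal (fun x : R => x - _) f2))
  (BO_D2A_sub ag Wb Wd Wh gya gw)
  (BO_DA_sub ag' Wb' Wb gyd gw)
  (BO_subM (DAf ag' Wb) (DAf ag Wb) gyd gw)
  (BO_subl (DAf ag Wb) gyd gh gw)
  (BO_state (DAf ag' Wb'))).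
- by apply: (BO_le fA gbb gw) => //; mono.
- by apply: (BO_le (A_taylor_field ag ag') gb gw) => //; mono.
- by apply: (BO_le (DAf ag We) gb gw) => //; mono.
- by apply: (BO_le (DA_lipschitz_field ag ag' Wbb) gya gw) => //; mono.
- by apply: (BO_le (DA_taylor_field ag ag' Wb) gya gw) => //; mono.
- by apply: (BO_le (D2Af ag Wb We) gya gw) => //; mono.
- by apply: (BO_le (DAf ag' Wbb) gyd gw) => //; mono.
- by apply: (BO_le fD gyd gw) => //; mono.
- by apply: (BO_le (DAf ag Wb) ge gw) => //; mono.
Qed.

End StateDifferences.

(** * The second derivative *)

(** Uniqueness for the linearized problem, kept in seminorms because [FO] depends on gradients. *)
Lemma apriori0 a b : stateOK a -> WW p b ->
  (forall s z, W10I 1%E s -> W10O q%:E z -> Lop a b s z = 0) ->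
  nG b.1 <= 0 /\ nY b.2 <= 0.
Proof.
move=> sa Wb H; have [||s z Ws Wz|h1 h2] := @apriori a b 0 0 sa Wb.
- by [].
- by [].
- by rewrite (H s z Ws Wz) normr0 !mul0r addr0.
rewrite mulr0 addr0 mulr0 in h1; split=> //.
have e0 : nG b.1 = 0 by apply/eqP; rewrite eq_le h1 snormI_ge0.
by rewrite e0 mulr0 addr0 mulr0 in h2.
Qed.

Lemma stateOK_WW a : stateOK a -> WW p a.
Proof. by case=> -[Wg _] Wy _; split. Qed.

Lemma FO_eq0 a b c w : stateOK a -> WW p b -> WW p c -> gradL q w ->
  nG b.1 <= 0 -> nY b.2 <= 0 -> FO v a b c w = 0.
Proof.
move=> sa Wb Wc gw hg hy.
have g0 : nG b.1 = 0 by apply/eqP; rewrite eq_le hg snormI_ge0.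
have y0 : nY b.2 = 0 by apply/eqP; rewrite eq_le hy snormO_ge0.
have := FO_bound sa Wb Wc gw; rewrite g0 y0 !mulr0 !mul0r !addr0 !mul0r.
by rewrite normr_le0 => /eqP.
Qed.

Let lipschitz_arith (c1 c2 Y A m1 m2 H K : R) :
  48 * (m1 * H) * (c2 * K) + 208 * (m1 * H) * (c1 * K) * Y + A * (c1 * K) * (m2 * H)
    <= (48 * m1 * c2 + 208 * m1 * c1 * Y + A * c1 * m2) * (H * K).
Proof. by rewrite le_eqVlt; apply/orP; left; apply/eqP; ring. Qed.

Let half_arith (s x e : R) : 0 <= s -> x <= e / (2 * (s + 1)) -> 0 <= x ->
  s * x <= e / 2.
Proof.
move=> s0; have s1 : 0 < 2 * (s + 1) by rewrite mulr_gt0// ltr_wpDl.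
rewrite ler_pdivlMr// => h x0; rewrite ler_pdivlMr//; nra.
Qed.

Let eq_le_norm (x y : R) : x = y -> `|x| <= `|y|.
Proof. by move=> ->. Qed.

(** Every summand is H K times either a further H (collected in [S]) or the Fréchet tolerance e1
    (collected in [T]); each group may use e / 2. *)
Lemma residual_arith (c1 c2 D1 D2 Y A m1 m2 H K e e1 : R) : 0 <= H -> 0 <= K ->
  (48 * m1 * D2 + 104 * m1 ^+ 2 * c2 + 208 * m1 * D1 * Y + 624 * m1 ^+ 2 * c1 * Y
   + A * D1 * m2 + 208 * m1 * c1 * m2) * H <= e / 2 ->
  (A * c2 + A * c1 * Y + A * c1) * e1 <= e / 2 ->
  48 * (m1 * H) * (D2 * (H * K)) + 104 * (m1 * H) ^+ 2 * (c2 * K) +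
    A * (e1 * H) * (c2 * K) +
    (208 * (m1 * H) * (D1 * (H * K)) * Y + 624 * (m1 * H) ^+ 2 * (c1 * K) * Y +
     A * (c1 * K) * (e1 * H) * Y) +
    (A * (D1 * (H * K)) * (m2 * H) + 208 * (m1 * H) * (c1 * K) * (m2 * H) +
     A * (c1 * K) * (e1 * H)) <= e * (H * K).
Proof.
move=> H0 K0; set S := _ + 208 * m1 * c1 * m2; set T := _ + A * c1 => hS hT.
have h : S * H + T * e1 <= e by lra.
apply: le_trans (ler_wpM2r (mulr_ge0 H0 K0) h).
by rewrite le_eqVlt; apply/orP; left; apply/eqP; rewrite /S /T; ring.
Qed.

Let addrKl_sub (x y z : R) : x + y - (x + z) = y - z.
Proof. by ring. Qed.

Section SecondDerivative.
Variables (rad : R) (G : (R -> R) -> jetW R) (G' : (R -> R) -> (R -> R) -> jetW R).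
Local Notation U := [set u : R -> R | L2 u /\ L2norm u < rad].
Hypotheses (hG : control_to_state kappa p E v U G) (hF : frechet CA beta p v U G G')
  (hL : forall u h, U u -> L2 h -> linearized_solution kappa p E v (G u)
     (fun zeta _ => \int[muI]_t (h t * zeta.1 t)) (G' u h)).
Implicit Types (u h k : R -> R).
Local Notation c1 := (alpha / theta2).
Local Notation c2 := (beta * (CA * B1 * V * c1)).
Local Notation Y := (B1 * V).

Let CE0 : 0 <= CE. Proof. exact: le_trans hCE. Qed.

Let t0 : 0 < theta2. Proof. by case/andP: htheta2. Qed.

Let V0 : 0 < V := V_gt0.
Let B0 : 0 < B1 := B1_gt0.
Let Y0 : 0 < Y. Proof. exact: mulr_gt0. Qed.

Let c10 : 0 <= c1. Proof. by rewrite divr_ge0// ltW. Qed.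

Let c20 : 0 <= c2. Proof. by nonneg. Qed.

Lemma U_open u : U u -> exists2 d, 0 < d & forall h, L2 h -> L2norm h < d -> U (u + h).
Proof.
move=> [Lu ru]; exists (rad - L2norm u); first by rewrite subr_gt0.
move=> h Lh hd; split; first by rewrite -[u]scale1r; exact: L2_lincomb.
have := L2norm_lincomb 1 Lu Lh; rewrite scale1r normr1 mul1r => /le_lt_trans; apply.
by rewrite addrC -ltrBrDr.
Qed.

Let sU u : U u -> stateOK (G u).
Proof. by move=> /hG[/state_solution_OK]. Qed.

Let lW u h : U u -> L2 h -> WW p (G' u h).
Proof. by move=> Uu Lh; have [] := hL Uu Lh. Qed.

Let lE u h s z : U u -> L2 h -> W10I 1%E s -> W10O q%:E z ->
  Lop (G u) (G' u h) s z = \int[muI]_t (h t * s.1 t).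
Proof. by move=> Uu Lh Ws Wz; have [_ /(_ _ _ Ws Wz)] := hL Uu Lh. Qed.

(** The constants do not depend on u, so the same bound serves at the perturbed control u + h. *)
Lemma linearized_bound u h : U u -> L2 h ->
  nG (G' u h).1 <= c1 * L2norm h /\ nY (G' u h).2 <= c2 * L2norm h.
Proof.
move=> Uu Lh.
have [||s z Ws Wz|h1 h2] := @apriori _ _ (L2norm h) 0 (sU Uu) (lW Uu Lh).
- exact: L2norm_ge0.
- by [].
- by rewrite (lE Uu Lh Ws Wz) mul0r addr0; exact: (rhs_bound Lh Ws).2.
rewrite mulr0 addr0 in h1; split=> //; apply: (le_trans h2).
rewrite add0r -[leRHS]mulrA; apply: ler_wpM2l; first exact: ltW.
by rewrite -[leRHS]mulrA; apply: ler_wpM2l h1; nonneg.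
Qed.

(** [bounded_linear] gives linearity of [G'] up to almost everywhere equality of functions; [FO]
    requires it for gradients, and this follows from the equations that [G'] solves. *)
Lemma linearized_lincomb (r : R) u h k : U u -> L2 h -> L2 k ->
  let D := G' u (r *: h + k) - (r *: G' u h + G' u k) in
  [/\ WW p D, nG D.1 <= 0 & nY D.2 <= 0].
Proof.
move=> Uu Lh Lk D; have Lhk := L2_lincomb r Lh Lk.
have W1 := lW Uu Lhk; have W2 := WW_lincomb r (lW Uu Lh) (lW Uu Lk).
have WD : WW p D := WWB W1 W2.
have [|h1 h2] := apriori0 (sU Uu) WD; last by [].
move=> s z Ws Wz; apply: etrans (LopB (sU Uu) W1 W2 Ws Wz) _.
have e1 := lE Uu Lhk Ws Wz; have e2 := Lop_lincomb r (sU Uu) (lW Uu Lh) (lW Uu Lk) Ws Wz.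
apply: etrans (f_equal2 (fun x y : R => x - y) e1 e2) _.
rewrite (lE Uu Lh Ws Wz) (lE Uu Lk Ws Wz) (rhs_lincomb r Lh Lk Ws).
exact: subrr.
Qed.

Lemma FO_linearized_lincomb (r : R) u h k c w : U u -> L2 h -> L2 k -> WW p c ->
  gradL q w -> FO v (G u) (G' u (r *: h + k)) c w =
    r * FO v (G u) (G' u h) c w + FO v (G u) (G' u k) c w.
Proof.
move=> Uu Lh Lk Wc gw; have [WD h1 h2] := linearized_lincomb r Uu Lh Lk.
set D := _ - _ in WD h1 h2.
have W2 := WW_lincomb r (lW Uu Lh) (lW Uu Lk).
have e : G' u (r *: h + k) = 1 *: D + (r *: G' u h + G' u k).
  by rewrite scale1r /D subrK.
apply: etrans (f_equal (fun t => FO v (G u) t c w) e) _.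
apply: etrans (FO_lincombl 1 (sU Uu) WD W2 Wc gw) _.
have e0 := FO_eq0 (sU Uu) WD Wc gw h1 h2.
apply: etrans (f_equal (fun t : R => 1 * t + _) e0) _.
rewrite mulr0 add0r; exact: (FO_lincombl r (sU Uu) (lW Uu Lh) (lW Uu Lk) Wc gw).
Qed.

Lemma frechet_remainder u (e : R) : U u -> 0 < e -> exists2 d, 0 < d &
  forall h, L2 h -> L2norm h < d -> U (u + h) /\
    nG ((G (u + h)).1 - (G u).1 - (G' u h).1) <= e * L2norm h /\
    nY ((G (u + h)).2 - (G u).2 - (G' u h).2) <= e * L2norm h.
Proof.
move=> Uu e0; have Y1 : 0 < 1 + Y by rewrite addr_gt0.
(* [normW] weighs gamma by [Y]. The tolerance e Y / (1 + Y) lies below both e and e Y, so each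
   component separately gets the bound e. *)
have e'0 : 0 < e * Y / (1 + Y) by rewrite divr_gt0// mulr_gt0.
have [_ /(_ _ e'0)[d d0 hd]] := hF Uu; have [d' d'0 hd'] := U_open Uu.
exists (Num.min d d'); first by rewrite lt_min d0.
move=> h Lh; rewrite lt_min => /andP[h1 h2]; have Uh := hd' h Lh h2; split=> //.
have H0 := L2norm_ge0 h.
have := hd h Lh h1 Uh; rewrite /normW.
rewrite -[(_ - _ - _).1]/((G (u + h)).1 - (G u).1 - (G' u h).1).
rewrite -[(_ - _ - _).2]/((G (u + h)).2 - (G u).2 - (G' u h).2).
have := snormI_ge0 +oo%E ((G (u + h)).1 - (G u).1 - (G' u h).1).
have := snormO_ge0 p%:E ((G (u + h)).2 - (G u).2 - (G' u h).2).
move: (nG _) (nY _) (L2norm h) H0 => x y H H0 y0 x0 hxy.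
have e1 : e * Y / (1 + Y) <= e by rewrite ler_pdivrMr// ler_pM2l// lerDr.
split; last first.
  have := ler_wpM2r H0 e1; have := mulr_ge0 (ltW Y0) x0; lra.
rewrite -(ler_pM2l Y0).
have e2 : e * Y / (1 + Y) <= Y * e.
  rewrite ler_pdivrMr// [e * Y]mulrC ler_peMr ?lerDl ?(ltW Y0)//.
  exact: mulr_ge0 (ltW Y0) (ltW e0).
have := ler_wpM2r H0 e2; lra.
Qed.

(** G'(u) k and G'(u') k solve their problems with the same right-hand side, and [BG] does not
    involve the state, so only the change of [DO] remains. *)
Lemma Lop_linearized_sub u u' k s z : U u -> U u' -> L2 k ->
  W10I 1%E s -> W10O q%:E z -> Lop (G u) (G' u' k - G' u k) s z =
    DO v (G' u' k) (z + E s) (G u) - DO v (G' u' k) (z + E s) (G u').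
Proof.
move=> Uu Uu' Lk Ws Wz.
have e1 := LopB (sU Uu) (lW Uu' Lk) (lW Uu Lk) Ws Wz.
have e2 := etrans (lE Uu Lk Ws Wz) (esym (lE Uu' Lk Ws Wz)).
have e3 : Lop (G u) (G' u' k) s z - Lop (G u') (G' u' k) s z =
    DO v (G' u' k) (z + E s) (G u) - DO v (G' u' k) (z + E s) (G u').
  exact: addrKl_sub.
exact: (etrans e1 (etrans (f_equal (fun t : R => _ - t) e2) e3)).
Qed.

Local Notation L0 m1 m2 := (48 * m1 * c2 + 208 * m1 * c1 * Y + CA * c1 * m2).

(** The radius d depends on u and e but not on k: this uniformity is what differentiability of [G']
    in operator norm demands. *)
Lemma linearized_residual u (e : R) : U u -> 0 < e -> exists2 d, 0 < d &
  forall h, L2 h -> L2norm h < d -> U (u + h) /\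
    forall k w, L2 k -> gradL q w ->
    `|DO v (G' (u + h) k) w (G u) - DO v (G' (u + h) k) w (G (u + h))
      - FO v (G u) (G' u h) (G' u k) w| <= e * (L2norm h * L2norm k) * nZ w.
Proof.
move=> Uu e0.
(* [T] is the total coefficient of the Fréchet tolerance in [residual_arith], and [e1] makes T e1 <=
   e / 2. *)
pose T := CA * c2 + CA * c1 * Y + CA * c1.
have T0 : 0 <= T by rewrite /T; nonneg.
pose e1 := e / (2 * (T + 1)).
have T1 : 0 < 2 * (T + 1) by rewrite mulr_gt0// ltr_wpDl.
have e10 : 0 < e1 by rewrite divr_gt0.
(* Bounds for |G(u + h) - G(u)| / |h|: derivative plus remainder. *)
pose m1 := c1 + e1; pose m2 := c2 + e1.
have m10 : 0 <= m1 by rewrite /m1; nonneg.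
have m20 : 0 <= m2 by rewrite /m2; nonneg.
pose L := L0 m1 m2; have LL0 : 0 <= L by rewrite /L; nonneg.
(* What [apriori] gives for G'(u + h) k - G'(u) k, relative to |h| |k|, from a residual of size
   [L]. *)
pose D1 := c1 * (CE * B1 * L); have D10 : 0 <= D1 by rewrite /D1; nonneg.
pose D2 := beta * (L + CA * B1 * V * D1); have D20 : 0 <= D2 by rewrite /D2; nonneg.
pose S := 48 * m1 * D2 + 104 * m1 ^+ 2 * c2 + 208 * m1 * D1 * Y
  + 624 * m1 ^+ 2 * c1 * Y + CA * D1 * m2 + 208 * m1 * c1 * m2.
have S0 : 0 <= S by rewrite /S; nonneg.
have S1 : 0 < 2 * (S + 1) by rewrite mulr_gt0// ltr_wpDl.
have [d d0 hd] := frechet_remainder Uu e10.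
exists (Num.min d (e / (2 * (S + 1)))); first by rewrite lt_min d0 divr_gt0.
move=> h Lh; rewrite lt_min => /andP[h1 h2].
have [Uh [hg hy]] := hd h Lh h1; split=> // k w Lk gw.
have H0 := L2norm_ge0 h; have K0 := L2norm_ge0 k.
have sa := sU Uu; have sa' := sU Uh; have [Wh Yh] := lW Uu Lh.
have Wa := stateOK_WW sa; have Wa' := stateOK_WW sa'.
have [bh1 bh2] := linearized_bound Uu Lh.
have hmg : nG ((G (u + h)).1 - (G u).1) <= m1 * L2norm h.
  apply: le_trans (nG_le_sub (W10I_sub Wa'.1 Wa.1) Wh) _.
  by rewrite /m1 mulrDl addrC lerD.
have hmy : nY ((G (u + h)).2 - (G u).2) <= m2 * L2norm h.
  apply: le_trans (nY_le_sub (W10O_sub Wa'.2 Wa.2) Yh) _.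
  by rewrite /m2 mulrDl addrC lerD.
have Wb := lW Uu Lk; have Wb' := lW Uh Lk.
have [bk1 bk2] := linearized_bound Uu Lk.
have [bk'1 bk'2] := linearized_bound Uh Lk.
have HK0 : 0 <= L2norm h * L2norm k by rewrite mulr_ge0.
have [||s z Ws Wz|dg dy] := @apriori _ _ 0 (L * (L2norm h * L2norm k)) sa (WWB Wb' Wb).
- by [].
- exact: mulr_ge0.
- have gt := gradL_test Ws Wz; rewrite mul0r add0r.
  apply: le_trans (eq_le_norm (Lop_linearized_sub Uu Uh Lk Ws Wz)) _.
  apply: le_trans (DO_sub_bound sa sa' gt hmg hmy Wb' bk'1 bk'2) _.
  apply: ler_wpM2r; first exact: snormO_ge0.
  exact: lipschitz_arith.
rewrite add0r in dg.
have {}dg : nG ((G' (u + h) k).1 - (G' u k).1) <= D1 * (L2norm h * L2norm k).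
  by apply: le_trans dg _; rewrite /D1 !mulrA.
have {}dy : nY ((G' (u + h) k).2 - (G' u k).2) <= D2 * (L2norm h * L2norm k).
  apply: le_trans dy _; rewrite /D2 -[leRHS]mulrA; apply: ler_wpM2l; first exact: ltW.
  rewrite [leRHS]mulrDl lerD2l -[leRHS]mulrA; apply: ler_wpM2l dg; nonneg.
have ag : adm (G u).1 by case: sa.
(* The expansion produces h in the second slot of [FO], the claim has it in the first. *)
have es := FO_sym (G' u h) (G' u k) w ag.
apply: le_trans (eq_le_norm (f_equal (fun t : R => _ - t) es)) _.
have tb := DO_taylor_bound sa sa' gw hmg hmy (lW Uu Lh) Wb Wb' hg hy dg dy bk1 bk2.
apply: (le_trans tb).
apply: ler_wpM2r; first exact: snormO_ge0.
exact: (residual_arith H0 K0 (half_arith S0 (ltW h2) H0)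
  (half_arith T0 (lexx _) (ltW e10))).
Qed.

Lemma Lop_bound a b s z : stateOK a -> WW p b -> W10I 1%E s -> W10O q%:E z ->
  `|Lop a b s z| <= kappa * (nG b.1 * snormI 1%E s) +
    (CA * nY b.2 + CA * nG b.1 * Y) * nZ (z + E s).
Proof.
move=> sa Wb Ws Wz; apply: le_trans (ler_normD _ _) _; apply: lerD.
  exact: (BG_integrable Wb.1 Ws).2.
exact: DO_bound sa Wb (gradL_test Ws Wz).
Qed.

(** Writing r b as (r - 1) b + b stays within [Lop_lincomb]. *)
Lemma LopZ (r : R) a b s z : stateOK a -> WW p b -> W10I 1%E s -> W10O q%:E z ->
  Lop a (r *: b) s z = r * Lop a b s z.
Proof.
move=> sa Wb Ws Wz; have e : r *: b = (r - 1) *: b + b.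
  by rewrite scalerBl scale1r subrK.
apply: etrans (f_equal (fun t => Lop a t s z) e) _.
apply: etrans (Lop_lincomb (r - 1) sa Wb Wb Ws Wz) _.
by rewrite mulrBl mul1r subrK.
Qed.

Lemma FO_linearizedZ (r : R) u h c w : U u -> L2 h -> WW p c -> gradL q w ->
  FO v (G u) (G' u (r *: h)) c w = r * FO v (G u) (G' u h) c w.
Proof.
move=> Uu Lh Wc gw; have e : r *: h = (r - 1) *: h + h.
  by rewrite scalerBl scale1r subrK.
apply: etrans (f_equal (fun t => FO v (G u) (G' u t) c w) e) _.
apply: etrans (FO_linearized_lincomb (r - 1) Uu Lh Lh Wc gw) _.
by rewrite mulrBl mul1r subrK.
Qed.

Let quotient_arith (t X F e H K n : R) : 0 < t ->
  `|X - t * F| <= e * (t * H * K) * n -> `|t^-1 * X - F| <= e * (H * K) * n.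
Proof.
move=> t0' h; rewrite -(ler_pM2l t0') -{1}(gtr0_norm t0') -normrM mulrBr.
rewrite mulVKf ?gt_eqF//; apply: le_trans h _.
by rewrite le_eqVlt; apply/orP; left; apply/eqP; ring.
Qed.

Lemma approximate_solution u h k (e : R) : U u -> L2 h -> L2 k -> 0 < e ->
  exists2 x, WW p x & forall s z, W10I 1%E s -> W10O q%:E z ->
    `|Lop (G u) x s z - FO v (G u) (G' u h) (G' u k) (z + E s)|
      <= e * (L2norm h * L2norm k) * nZ (z + E s).
Proof.
move=> Uu Lh Lk e0; have [d d0 hd] := linearized_residual Uu e0.
have H0 := L2norm_ge0 h; have H1 : 0 < L2norm h + 1 by rewrite ltr_wpDl.
(* The added 1 covers h = 0 and makes t |h| strictly smaller than d. *)
pose t := d / (L2norm h + 1); have t0' : 0 < t by rewrite divr_gt0.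
have nth : L2norm (t *: h) = t * L2norm h by rewrite L2norm_scale// gtr0_norm.
have td : L2norm (t *: h) < d.
  by rewrite nth /t -mulrA gtr_pMr// mulrC ltr_pdivrMr// mul1r ltrDl.
have Lth := L2_scale t Lh; have [Uh R0] := hd _ Lth td.
have WD := WWB (lW Uh Lk) (lW Uu Lk).
exists (t^-1 *: (G' (u + t *: h) k - G' u k)); first exact: WW_scale.
move=> s z Ws Wz; have gw := gradL_test Ws Wz.
have := R0 k _ Lk gw; rewrite nth => R1.
have e1 := LopZ t^-1 (sU Uu) WD Ws Wz.
have e2 := Lop_linearized_sub Uu Uh Lk Ws Wz.
have e3 := FO_linearizedZ t Uu Lh (lW Uu Lk) gw.
have {}R1 := le_trans (eq_le_norm (f_equal2 (fun x y : R => x - y) e2 (esym e3))) R1.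
apply: le_trans (eq_le_norm (f_equal (fun x : R => x - _) e1)) _.
exact: quotient_arith R1.
Qed.

(** The iterates n + 1 and n have tolerances e / 2 and e; the sum 3 e / 2 is rounded up to 2 e. *)
Let cauchy_arith (x y F e K n : R) : 0 <= K -> 0 <= n -> 0 < e ->
  `|x - F| <= e / 2 * K * n -> `|y - F| <= e * K * n -> `|x - y| <= 2 * K * e * n.
Proof.
move=> K0 n0 e0 hx hy; have h : `|x - y| <= e / 2 * K * n + e * K * n.
  by rewrite -(subrKA F) -[F - y]opprB; apply: le_trans (ler_normB _ _) (lerD hx hy).
apply: (le_trans h); have : 0 <= e * K * n by rewrite !mulr_ge0// ltW.
lra.
Qed.

Let dist_arith (x y F c d : R) : `|x - y| <= c -> `|y - F| <= d -> `|x - F| <= c + d.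
Proof.
move=> hx hy; rewrite -(subrKA y).
exact: le_trans (ler_normD _ _) (lerD hx hy).
Qed.

Lemma second_derivative_exists u h k : U u -> L2 h -> L2 k ->
  exists c, linearized_solution kappa p E v (G u)
    (fun s z => FO v (G u) (G' u h) (G' u k) (z + E s)) c.
Proof.
move=> Uu Lh Lk; pose HK := L2norm h * L2norm k.
have HK0 : 0 <= HK by rewrite mulr_ge0 ?L2norm_ge0.
have e0 n : 0 < (2 ^+ n)^-1 :> R by rewrite invr_gt0 exprn_gt0.
have /choice[x hx] : forall n, exists x, WW p x /\
    forall s z, W10I 1%E s -> W10O q%:E z ->
    `|Lop (G u) x s z - FO v (G u) (G' u h) (G' u k) (z + E s)|
      <= (2 ^+ n)^-1 * HK * nZ (z + E s).
  by move=> n; have [x ? ?] := approximate_solution Uu Lh Lk (e0 n); exists x.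
have sa := sU Uu.
pose C1 := c1 * (CE * B1 * (2 * HK)).
have C10 : 0 <= C1 by rewrite /C1; nonneg.
pose C2 := beta * (2 * HK + CA * B1 * V * C1).
have C20 : 0 <= C2 by rewrite /C2; nonneg.
(* The difference of two approximate solutions nearly solves the homogeneous problem, so [apriori]
   makes the sequence geometrically Cauchy. *)
have step n : nG (x n.+1 - x n).1 <= C1 / 2 ^+ n /\ nY (x n.+1 - x n).2 <= C2 / 2 ^+ n.
  have [Wn hn] := hx n; have [Wn1 hn1] := hx n.+1.
  have L0' : 0 <= 2 * HK / 2 ^+ n by rewrite mulr_ge0 ?(ltW (e0 n))// mulr_ge0.
  have [||s z Ws Wz|h1 h2] := @apriori _ _ 0 (2 * HK / 2 ^+ n) sa (WWB Wn1 Wn).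
  - by [].
  - exact: L0'.
  - rewrite mul0r add0r; apply: le_trans (eq_le_norm (LopB sa Wn1 Wn Ws Wz)) _.
    apply: cauchy_arith HK0 (snormO_ge0 _ _) (e0 n) _ (hn s z Ws Wz).
    by have := hn1 s z Ws Wz; rewrite exprSr invfM.
  rewrite add0r in h1; have {}h1 : nG (x n.+1 - x n).1 <= C1 / 2 ^+ n.
    by apply: le_trans h1 _; rewrite /C1 !mulrA.
  split=> //; apply: le_trans h2 _; rewrite /C2 -[leRHS]mulrA.
  apply: ler_wpM2l; first exact: ltW.
  by rewrite [leRHS]mulrDl lerD2l -[leRHS]mulrA; apply: ler_wpM2l h1; nonneg.
have Wx n : WW p (x n) by case: (hx n).
have [w1 Ww1 cw1] := W10I_complete (u := fun n => (x n).1) C10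
  (fun n => (Wx n).1) (fun n => (step n).1).
have [w2 Ww2 cw2] := W10O_complete (y := fun n => (x n).2) (ltW p1) C20
  (fun n => (Wx n).2) (fun n => (step n).2).
have Ww : WW p (w1, w2) by split.
exists (w1, w2); split=> // s z Ws Wz.
(* [C3] gathers the continuity of [Lop], with the tails 2 C1 and 4 C2 of the completeness lemmas,
   and the residual of the n-th approximation; all of them scale like 2^-n. *)
pose C3 := kappa * (2 * C1 * snormI 1%E s) +
  (CA * (4 * C2) + CA * (2 * C1) * Y) * nZ (z + E s) + HK * nZ (z + E s).
have key n : `|Lop (G u) (w1, w2) s z - FO v (G u) (G' u h) (G' u k) (z + E s)|
    <= C3 / 2 ^+ n.
  have [Wn hn] := hx n; have h1 := LopB sa Ww Wn Ws Wz.
  have h2 := Lop_bound sa (WWB Ww Wn) Ws Wz.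
  have {}h2 := le_trans (eq_le_norm (esym h1)) h2.
  have h3 : kappa * (nG ((w1, w2) - x n).1 * snormI 1%E s) +
      (CA * nY ((w1, w2) - x n).2 + CA * nG ((w1, w2) - x n).1 * Y) * nZ (z + E s) <=
      kappa * (2 * C1 / 2 ^+ n * snormI 1%E s) +
      (CA * (4 * C2 / 2 ^+ n) + CA * (2 * C1 / 2 ^+ n) * Y) * nZ (z + E s).
    have g1 := cw1 n; have g2 := cw2 n; have k0 := ltW hkappa.
    by mono; nonneg.
  have {}h2 := le_trans h2 h3; have {}hn := hn s z Ws Wz.
  apply: le_trans (dist_arith h2 hn) _.
  by rewrite le_eqVlt; apply/orP; left; apply/eqP; rewrite /C3; ring.
apply/eqP; rewrite -subr_eq0 -normr_le0; apply/ler_addgt0Pr => e e1.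
rewrite add0r; have [n hn] := half_pow_small C3 e1.
exact: le_trans (key n) hn.
Qed.

Lemma solution_eqW a b c : stateOK a -> WW p b -> WW p c ->
  (forall s z, W10I 1%E s -> W10O q%:E z -> Lop a b s z = Lop a c s z) -> eqW b c.
Proof.
move=> sa Wb Wc H; have [|h1 h2] := apriori0 sa (WWB Wb Wc).
  move=> s z Ws Wz; apply: etrans (LopB sa Wb Wc Ws Wz) _.
  by apply/eqP; rewrite subr_eq0; apply/eqP; exact: H.
exact: eqW_of_snorm0 Wb Wc h1 h2.
Qed.

Let N0 := B1 * V * (c1 * (CE * B1)) + beta * (1 + CA * B1 * V * (c1 * (CE * B1))).

Let N0_ge0 : 0 <= N0. Proof. by rewrite /N0; nonneg. Qed.

Lemma apriori_normW a b (L : R) : stateOK a -> WW p b -> 0 <= L ->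
  (forall s z, W10I 1%E s -> W10O q%:E z -> `|Lop a b s z| <= L * nZ (z + E s)) ->
  normW CA beta p v b <= N0 * L.
Proof.
move=> sa Wb L0' H; have [||s z Ws Wz|h1 h2] := @apriori a b 0 L sa Wb.
- by [].
- exact: L0'.
- by rewrite mul0r add0r; exact: H.
rewrite add0r in h1; have g0 := snormI_ge0 +oo%E b.1.
have h3 : CA * B1 * V * nG b.1 <= CA * B1 * V * (c1 * (CE * B1 * L)).
  by apply: ler_wpM2l h1; nonneg.
have h4 : B1 * V * nG b.1 <= B1 * V * (c1 * (CE * B1 * L)).
  by apply: ler_wpM2l h1; nonneg.
have h5 : beta * (L + CA * B1 * V * nG b.1) <=
    beta * (L + CA * B1 * V * (c1 * (CE * B1 * L))).
  by apply: ler_wpM2l; [exact: ltW|rewrite lerD2l].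
apply: le_trans (lerD h4 (le_trans h2 h5)) _.
by rewrite le_eqVlt; apply/orP; left; apply/eqP; rewrite /N0; ring.
Qed.

(** The 1 in the last factor comes from the D2A term of [FO], and each of the two mixed DA terms
    contributes beta C_A through the bound on the y component. *)
Let K0 := CA * B1 * V * c1 ^+ 2 * (1 + 2 * beta * CA).

Let K0_ge0 : 0 <= K0. Proof. by rewrite /K0; nonneg. Qed.

Let forcing_arith (x B H K d : R) :
  CA * (x * K) * (beta * (CA * B * d * x) * H) +
  CA * (x * H) * (beta * (CA * B * d * x) * K) + CA * (x * H) * (x * K) * (B * d) =
  CA * B * d * x ^+ 2 * (1 + 2 * beta * CA) * (H * K).
Proof. by ring. Qed.

Lemma FO_linearized_bound u h k w : U u -> L2 h -> L2 k -> gradL q w ->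
  `|FO v (G u) (G' u h) (G' u k) w| <= K0 * (L2norm h * L2norm k) * nZ w.
Proof.
move=> Uu Lh Lk gw; have [g1 y1] := linearized_bound Uu Lh.
have [g2 y2] := linearized_bound Uu Lk.
have H0 := L2norm_ge0 h; have K1 := L2norm_ge0 k; have Y1 := ltW Y0.
apply: le_trans (FO_bound (sU Uu) (lW Uu Lh) (lW Uu Lk) gw) _.
apply: ler_wpM2r; first exact: snormO_ge0.
rewrite /K0 -forcing_arith; mono.
Qed.

Section Solution.
Variables (u h k : R -> R) (c : jetW R).
Hypotheses (Uu : U u) (Lh : L2 h) (Lk : L2 k).
Hypothesis hc : linearized_solution kappa p E v (G u)
  (fun s z => FO v (G u) (G' u h) (G' u k) (z + E s)) c.

Lemma second_derivative_Lop s z : W10I 1%E s -> W10O q%:E z ->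
  Lop (G u) c s z = FO v (G u) (G' u h) (G' u k) (z + E s).
Proof. exact: hc.2. Qed.

Let L := K0 * (L2norm h * L2norm k).

Let L_ge0 : 0 <= L. Proof. exact: mulr_ge0 K0_ge0 (mulr_ge0 (L2norm_ge0 h) (L2norm_ge0 k)). Qed.

Let Lop_le s z : W10I 1%E s -> W10O q%:E z ->
  `|Lop (G u) c s z| <= L * nZ (z + E s).
Proof.
move=> Ws Wz; apply: le_trans (eq_le_norm (second_derivative_Lop Ws Wz)) _.
exact: FO_linearized_bound (gradL_test Ws Wz).
Qed.

Lemma second_derivative_normW :
  normW CA beta p v c <= N0 * K0 * L2norm h * L2norm k.
Proof.
apply: le_trans (apriori_normW (sU Uu) hc.1 L_ge0 Lop_le) _.
by rewrite /L !mulrA.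
Qed.

(** The second summand is K / t times alpha C_E C_A B^2 d <= 1 - t, so the sum collapses to K / t.
    This is why the bound on y contains neither C_E nor a third power of alpha. *)
Let elimination_arith (K B d t : R) : 0 <= K -> 0 < t ->
  alpha * CE * CA * B ^+ 2 * d <= 1 - t ->
  K + CA * B * d * (alpha / t * (CE * B * K)) <= K / t.
Proof.
move=> Kge t0' sm; rewrite ler_pdivlMr// mulrDl.
have -> : CA * B * d * (alpha / t * (CE * B * K)) * t =
    alpha * CE * CA * B ^+ 2 * d * K.
  by field; rewrite gt_eqF.
have := ler_wpM2r Kge sm; lra.
Qed.

Lemma second_derivative_bounds :
  nG c.1 <= alpha ^+ 3 / theta2 ^+ 3 * CE * CA * (1 + 2 * beta * CA)
              * (1 + beta * CA) ^+ 2 * V * L2norm h * L2norm k /\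
  nY c.2 <= alpha ^+ 2 / theta2 ^+ 3 * beta * CA * (1 + 2 * beta * CA)
              * (1 + beta * CA) * V * L2norm h * L2norm k.
Proof.
have [||s z Ws Wz|h1 h2] := @apriori (G u) c 0 L (sU Uu) hc.1.
- by [].
- exact: L_ge0.
- by rewrite mul0r add0r; exact: Lop_le.
have tn : theta2 != 0 by rewrite gt_eqF.
rewrite add0r in h1; split.
  apply: le_trans h1 _; rewrite le_eqVlt; apply/orP; left; apply/eqP.
  rewrite /L /K0; move: B1 V (L2norm h) (L2norm k) => B d H K.
  by field.
apply: le_trans h2 _.
have h3 : CA * B1 * V * nG c.1 <= CA * B1 * V * (c1 * (CE * B1 * L)).
  by apply: ler_wpM2l h1; nonneg.
have h4 : L + CA * B1 * V * nG c.1 <= L / theta2.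
  by apply: le_trans (elimination_arith L_ge0 t0 smallness); rewrite lerD2l.
apply: le_trans (ler_wpM2l (ltW hbeta) h4) _.
rewrite le_eqVlt; apply/orP; left; apply/eqP.
rewrite /L /K0; move: B1 V (L2norm h) (L2norm k) => B d H K.
by field.
Qed.

Lemma second_derivative_remainder (x : jetW R) (e : R) : WW p x -> 0 <= e ->
  (forall s z, W10I 1%E s -> W10O q%:E z ->
    `|Lop (G u) x s z - FO v (G u) (G' u h) (G' u k) (z + E s)|
      <= e * (L2norm h * L2norm k) * nZ (z + E s)) ->
  normW CA beta p v (x - c) <= N0 * e * L2norm h * L2norm k.
Proof.
move=> Wx e0 H; have L0' : 0 <= e * (L2norm h * L2norm k).
  exact: mulr_ge0 e0 (mulr_ge0 (L2norm_ge0 h) (L2norm_ge0 k)).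
have h1 := @apriori_normW _ _ _ (sU Uu) (WWB Wx hc.1) L0'.
apply: le_trans (h1 _) _; last by rewrite !mulrA.
move=> s z Ws Wz; have h2 := LopB (sU Uu) Wx hc.1 Ws Wz.
have h3 := f_equal (fun t : R => Lop (G u) x s z - t) (second_derivative_Lop Ws Wz).
apply: le_trans (eq_le_norm (etrans h2 h3)) _.
exact: H.
Qed.

End Solution.

Theorem second_frechet_derivative :
  exists G'' : (R -> R) -> (R -> R) -> (R -> R) -> jetW R,
    frechet2 CA beta p v U G' G'' /\
    forall u h k, U u -> L2 h -> L2 k ->
      let F := FO v (G u) (G' u h) (G' u k) in
      [/\ W1q_dual p F,
          linearized_solution kappa p E v (G u)
            (fun s z => F (z + E s)) (G'' u h k),
          nG (G'' u h k).1 <=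
            alpha ^+ 3 / theta2 ^+ 3 * CE * CA * (1 + 2 * beta * CA)
              * (1 + beta * CA) ^+ 2 * V * L2norm h * L2norm k &
          nY (G'' u h k).2 <=
            alpha ^+ 2 / theta2 ^+ 3 * beta * CA * (1 + 2 * beta * CA)
              * (1 + beta * CA) * V * L2norm h * L2norm k].
Proof.
(* The choice runs over all triples; outside the admissible ones the value is 0. *)
have /choice[T hT] : forall x : (R -> R) * (R -> R) * (R -> R), exists c,
    U x.1.1 -> L2 x.1.2 -> L2 x.2 -> linearized_solution kappa p E v (G x.1.1)
      (fun s z => FO v (G x.1.1) (G' x.1.1 x.1.2) (G' x.1.1 x.2) (z + E s)) c.
  move=> [[u h] k] /=; have [[Uu [Lh Lk]]|n] := pselect (U u /\ L2 h /\ L2 k).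
    by have [c hc] := second_derivative_exists Uu Lh Lk; exists c.
  by exists 0 => ? ? ?; case: n.
pose G'' u h k := T (u, h, k).
have hG'' u h k : U u -> L2 h -> L2 k -> linearized_solution kappa p E v (G u)
    (fun s z => FO v (G u) (G' u h) (G' u k) (z + E s)) (G'' u h k).
  exact: (hT (u, h, k)).
have WG u h k (Uu : U u) (Lh : L2 h) (Lk : L2 k) : WW p (G'' u h k).
  by have [] := hG'' _ _ _ Uu Lh Lk.
have LG u h k s z (Uu : U u) (Lh : L2 h) (Lk : L2 k) (Ws : W10I 1%E s)
    (Wz : W10O q%:E z) :
    Lop (G u) (G'' u h k) s z = FO v (G u) (G' u h) (G' u k) (z + E s).
  exact: second_derivative_Lop (hG'' _ _ _ Uu Lh Lk) _ _ Ws Wz.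
exists G''; split; last first.
  move=> u h k Uu Lh Lk F.
  have [b1 b2] := second_derivative_bounds Uu Lh Lk (hG'' _ _ _ Uu Lh Lk).
  split=> //; first exact: FO_dual (sU Uu) (lW Uu Lh) (lW Uu Lk).
  exact: hG''.
move=> u Uu; split.
  split.
  - by move=> h k Lh Lk; exact: WG.
  - move=> r h h' k Lh Lh' Lk; have Lr := L2_lincomb r Lh Lh'.
    have W1 := WG u _ _ Uu Lr Lk; have W2 := WG u _ _ Uu Lh Lk.
    have W3 := WG u _ _ Uu Lh' Lk.
    apply: (solution_eqW (sU Uu) W1 (WW_lincomb r W2 W3)) => s z Ws Wz.
    have gw := gradL_test Ws Wz.
    apply: etrans (LG _ _ _ _ _ Uu Lr Lk Ws Wz) _.
    apply: etrans (FO_linearized_lincomb r Uu Lh Lh' (lW Uu Lk) gw) _.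
    have e1 := LG _ _ _ _ _ Uu Lh Lk Ws Wz; have e2 := LG _ _ _ _ _ Uu Lh' Lk Ws Wz.
    apply: etrans (f_equal2 (fun x y : R => r * x + y) (esym e1) (esym e2)) _.
    exact: esym (Lop_lincomb r (sU Uu) W2 W3 Ws Wz).
  - move=> r h k k' Lh Lk Lk'; have Lr := L2_lincomb r Lk Lk'.
    have W1 := WG u _ _ Uu Lh Lr; have W2 := WG u _ _ Uu Lh Lk.
    have W3 := WG u _ _ Uu Lh Lk'; have [ag _ _] := sU Uu.
    apply: (solution_eqW (sU Uu) W1 (WW_lincomb r W2 W3)) => s z Ws Wz.
    have gw := gradL_test Ws Wz.
    apply: etrans (LG _ _ _ _ _ Uu Lh Lr Ws Wz) _.
    (* Linearity in the second direction is reduced to the first slot by symmetry of [FO]. *)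
    apply: etrans (FO_sym (G' u h) (G' u (r *: k + k')) _ ag) _.
    apply: etrans (FO_linearized_lincomb r Uu Lk Lk' (lW Uu Lh) gw) _.
    have s1 := FO_sym (G' u k) (G' u h) (z + E s) ag.
    have s2 := FO_sym (G' u k') (G' u h) (z + E s) ag.
    have e1 := etrans (LG _ _ _ _ _ Uu Lh Lk Ws Wz) (esym s1).
    have e2 := etrans (LG _ _ _ _ _ Uu Lh Lk' Ws Wz) (esym s2).
    apply: etrans (f_equal2 (fun x y : R => r * x + y) (esym e1) (esym e2)) _.
    exact: esym (Lop_lincomb r (sU Uu) W2 W3 Ws Wz).
  - exists (N0 * K0) => h k Lh Lk.
    exact: second_derivative_normW Uu Lh Lk (hG'' _ _ _ Uu Lh Lk).
(* Passing from residuals to [normW] costs the factor [N0], hence the tolerance e / (N0 + 1). *)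
move=> e e0; have N1 : 0 < N0 + 1 by rewrite ltr_wpDl.
have e'0 : 0 < e / (N0 + 1) by rewrite divr_gt0.
have [d d0 hd] := linearized_residual Uu e'0; exists d => // h Lh hh Uh k Lk.
have [_ R0] := hd h Lh hh.
have H s z : W10I 1%E s -> W10O q%:E z ->
    `|Lop (G u) (G' (u + h) k - G' u k) s z -
      FO v (G u) (G' u h) (G' u k) (z + E s)|
    <= e / (N0 + 1) * (L2norm h * L2norm k) * nZ (z + E s).
  move=> Ws Wz; have h1 := R0 k _ Lk (gradL_test Ws Wz).
  have h2 := Lop_linearized_sub Uu Uh Lk Ws Wz.
  exact: le_trans (eq_le_norm (f_equal (fun t : R => t - _) h2)) h1.
have h1 := second_derivative_remainder Uu (hG'' _ _ _ Uu Lh Lk)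
  (WWB (lW Uh Lk) (lW Uu Lk)) (ltW e'0) H.
apply: (le_trans h1).
have en : N0 * (e / (N0 + 1)) <= e.
  by rewrite mulrCA ger_pMr// ler_pdivrMr// mul1r lerDl.
by have := ler_wpM2r (mulr_ge0 (L2norm_ge0 h) (L2norm_ge0 k)) en; rewrite !mulrA.
Qed.

End SecondDerivative.
End LinearizedProblem.

Theorem theorem4p14 (R : realType)
  (kappa CA alpha Q P beta p q CE theta1 theta2 : R)
  (E : jetI R -> jetO R) (v : jetO R)
  (G : (R -> R) -> jetW R) (G' : (R -> R) -> (R -> R) -> jetW R)
  (hkappa : 0 < kappa)
  (hCA : coef_bound CA)
  (halpha : 0 < alpha) (hinfsupG : infsupG kappa alpha)
  (hQP : Q < 2 < P) (hconj : Q^-1 + P^-1 = 1)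
  (hbeta : 0 < beta) (hinfsupO : infsupO Q P beta)
  (hp : 2 < p < P) (hq : q = p / (p - 1))
  (hCE : 1 <= CE) (hE : bounded_extension q CE E)
  (htheta1 : beta * CA / (1 + beta * CA) < theta1 < 1)
  (htheta2 : 0 < theta2 < 1)
  (hv : W1O p%:E v) (hv0 : snormO p%:E v <> 0)
  (hv1 : snormO p%:E v <=
         (1 - theta1) * (alpha * CE * CA * (1 + beta * CA))^-1)
  (hv2 : snormO p%:E v <=
         (1 - theta2) * (alpha * CE * CA * (1 + beta * CA) ^+ 2)^-1) :
  let U : set (R -> R) := [set u | L2 u /\ L2norm u < theta1 / alpha] in
  control_to_state kappa p E v U G ->
  frechet CA beta p v U G G' ->
  (forall u h, U u -> L2 h ->
     linearized_solution kappa p E v (G u)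
       (fun zeta _ => \int[@muI R]_t (h t * zeta.1 t)) (G' u h)) ->
  exists G'' : (R -> R) -> (R -> R) -> (R -> R) -> jetW R,
    frechet2 CA beta p v U G' G'' /\
    forall u h1 h2, U u -> L2 h1 -> L2 h2 ->
      let F := FO v (G u) (G' u h1) (G' u h2) in
      [/\ W1q_dual p F,
          linearized_solution kappa p E v (G u)
            (fun zeta z => F (z + E zeta)) (G'' u h1 h2),
          snormI +oo%E (G'' u h1 h2).1 <=
            alpha ^+ 3 / theta2 ^+ 3 * CE * CA * (1 + 2 * beta * CA)
              * (1 + beta * CA) ^+ 2 * snormO p%:E v * L2norm h1 * L2norm h2 &
          snormO p%:E (G'' u h1 h2).2 <=
            alpha ^+ 2 / theta2 ^+ 3 * beta * CA * (1 + 2 * beta * CA)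
              * (1 + beta * CA) * snormO p%:E v * L2norm h1 * L2norm h2].
Proof.
rewrite hq in hE *; move=> U hG hF hL.
exact: (second_frechet_derivative hkappa hCA halpha hinfsupG hQP hbeta hinfsupO hp
  hCE hE htheta2 hv hv0 hv2 hG hF hL).
Qed.
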